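(* For every $\rho\in(0,\infty)$ there exist a complex polynomial $p$ of degree at least $2$, a repelling fixed point $z_0$ of $p$, and a linearizer $L$ of $p$ at $z_0$ such that $L$ has order $\rho$ and the escaping set $I(L)$ is a spider's web.
   Context: A fixed point $z_0$ of $p$ is repelling if $|p'(z_0)|>1$. A linearizer (Poincaré function) of $p$ at $z_0$ is a non-constant entire function $L$ with $L(0)=z_0$ and $p(L(z))=L(p'(z_0)\cdot z)$ for all $z\in\mathbb{C}$. The order of an entire function $f$ is $\rho(f):=\limsup_{r\to\infty}\frac{\log\log M(f,r)}{\log r}$ with $M(f,r):=\max_{|z|=r}|f(z)|$. The escaping set is $I(f):=\{z\in\mathbb{C}: f^n(z)\to\infty\text{ as }n\to\infty\}$, where $f^n$ is the $n$-th iterate. A set $E\subset\mathbb{C}$ is an (infinite) spider's web if $E$ is connected and there is a sequence $(G_n)$ of bounded simply-connected domains with $G_n\subset G_{n+1}$ and $\partial G_n\subset E$ for all $n$, and $\bigcup_n G_n=\mathbb{C}$. *)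

(* Defs.v *)
From HB Require Import structures.
From mathcomp Require Import all_boot all_order all_algebra.
From mathcomp Require Import all_classical all_reals all_analysis.
From mathcomp Require Import complex.

Set Implicit Arguments.
Unset Strict Implicit.
Unset Printing Implicit Defensive.

Import Order.TTheory GRing.Theory Num.Theory.
Import numFieldNormedType.Exports.

Local Open Scope classical_set_scope.
Local Open Scope ring_scope.

(* R[i] carries the topology and the normed space structure over itself that
   the library attaches to any numFieldType. *)
HB.instance Definition _ (R : realType) :=
  PseudoPointedMetric.copy R[i] (R[i])^o.
HB.instance Definition _ (R : realType) :=
  NormedModule.copy R[i] (R[i])^o.

(* The norm `|z| on R[i] takes values in R[i]; this is the real number |z|. *)
Definition modulus (R : realType) (z : R[i]) : R := complex.Re `|z|.

(* Differentiability over the field R[i], i.e. complex differentiability. *)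
Definition entire (R : realType) (f : R[i] -> R[i]) : Prop :=
  forall z : R[i], derivable f z 1.

Definition repelling_fixed_point (R : realType) (p : {poly R[i]}) (z0 : R[i])
    : Prop :=
  p.[z0] = z0 /\ 1 < modulus p^`().[z0].

Definition linearizer (R : realType) (p : {poly R[i]}) (z0 : R[i])
    (L : R[i] -> R[i]) : Prop :=
  [/\ entire L, ~ (exists c : R[i], forall z, L z = c), L 0 = z0
    & forall z : R[i], p.[L z] = L (p^`().[z0] * z)].

(* For continuous f and r >= 0 the supremum is attained. *)
Definition max_modulus (R : realType) (f : R[i] -> R[i]) (r : R) : R :=
  sup [set modulus (f z) | z in [set z : R[i] | modulus z = r]].

(* Since ln x = 0 for x <= 0, the quotient is defined for all r; for
   non-constant entire f it has its usual meaning for all large r. *)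
Definition entire_order (R : realType) (f : R[i] -> R[i]) : \bar R :=
  limf_esup (fun r : R => (ln (ln (max_modulus f r)) / ln r)%:E) +oo.

Definition escaping_set (R : realType) (f : R[i] -> R[i]) : set R[i] :=
  [set z | modulus (iter n f z) @[n --> \oo] --> +oo].

Definition boundary (T : topologicalType) (A : set T) : set T :=
  closure A `\` A°.

Definition domain (R : realType) (G : set R[i]) : Prop :=
  [/\ open G, connected G & G !=set0].

Definition closed_curve (R : realType) (G : set R[i]) (g : R -> R[i]) : Prop :=
  [/\ {within `[0, 1], continuous g}, g @` `[0, 1] `<=` G & g 0 = g 1].

(* The homotopy h from g to a constant runs through closed curves in G, with
   curve parameter first and homotopy parameter second; the base point is
   allowed to move. *)
Definition null_homotopic (R : realType) (G : set R[i]) (g : R -> R[i])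
    : Prop :=
  exists (h : R * R -> R[i]) (c : R[i]),
    [/\ {within `[0, 1] `*` `[0, 1], continuous h},
        h @` (`[0, 1] `*` `[0, 1]) `<=` G,
        forall s : R, s \in `[0, 1] -> h (s, 0) = g s /\ h (s, 1) = c
      & forall t : R, t \in `[0, 1] -> h (0, t) = h (1, t)].

Definition simply_connected_domain (R : realType) (G : set R[i]) : Prop :=
  domain G /\ forall g : R -> R[i], closed_curve G g -> null_homotopic G g.

Definition spiders_web (R : realType) (E : set R[i]) : Prop :=
  connected E /\
  exists G : nat -> set R[i],
    (forall n, [/\ bounded_set (G n), simply_connected_domain (G n),
                   G n `<=` G n.+1 & boundary (G n) `<=` E]) /\
    \bigcup_n G n = setT.

(* Main.v *)
From HB Require Import structures.
Require Import Defs.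
From mathcomp Require Import all_boot all_order all_algebra.
From mathcomp Require Import all_classical all_reals all_analysis.
From mathcomp Require Import complex.
From mathcomp Require Import ring lra zify.

Set Implicit Arguments.
Unset Strict Implicit.
Unset Printing Implicit Defensive.

Import Order.TTheory GRing.Theory Num.Theory.
Import numFieldNormedType.Exports.

(** Let p = lam X + X^d with d >= 3 and lam = d^(1/rho), where d is so large that
    lam >= 4, and let q be the map of p. The origin is a repelling fixed point, and
    the polynomials q^n(z / lam^n) converge locally uniformly to its linearizer L:
    their coefficients are nonnegative, so that everything is majorized on the
    positive real line ([poincare_functional], [poincare_entire]).

    Order. Iterating L(lam z) = q(L(z)) shows that |L| is at most lam^(2 d^n) on
    the disc of radius lam^n, and at least 2^(d^n) at lam^(n+1). So ln ln M(L, r)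
    is asymptotic to n ln d for r between lam^n and lam^(n+1), and the order is
    ln d / ln lam = rho ([entire_order_eq]).

    The web. Define radii lam^(n_k) / 2 by n_0 = N and n_(k+1) = 2 d^(n_k). They grow
    like the maximum modulus, so an orbit that once is below its radius remains
    below; call its starting point slow. Points that are not slow escape. Let
    [hole N] be the component of 0 in the open set of slow points. Its boundary
    consists of escaping points, and the holes exhaust the plane. A hole is bounded
    because L has no small values all along a long continuum: a continuum from 0 to
    the circle of radius 2 lam^n contains a point with |L(z)| >= 2 (3/2)^(d^(n-1)),
    as it must cross the set where |L(z / lam^n)| = 1 ([crossing], [hole_bounded]).
    By the maximum principle the set of slow points has no holes in the sense of
    [filled], and closed curves in such a set contract ([filled_null_homotopic]);
    this makes each [hole N] simply connected.

    Connectedness of the escaping set. Suppose that it splits into two separated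
    parts, and fix a point of each. An open neighbourhood of one part, cut off by a
    hole, has a boundary covered by finitely many open pieces; each piece either is
    close to the boundary of the hole, or is mapped by an iterate of L into a hole
    that excludes the same iterates of the two fixed points. The plane topology
    lemma [separate_many] finds a bounded closed set T that separates the two points
    and has its frontier in a single piece. The first kind of piece is excluded
    since the two points are joined inside the hole, the second one by the maximum
    principle ([connected_escaping]).

    Both facts of plane topology, [filled_null_homotopic] and [separate_many], are
    proved on a fine square grid. The tool in each case is the winding parity: an
    edge set of even degree at each vertex is the frontier of a set of cells. *)

(** * Winding parity and contraction of loops on the square lattice *)

(** The parity of the number of edges crossed by a vertical ray that goes down
    from the unit cell with lower left corner (i, j), where [Sh i k] says that
    the edge from (i, k) to (i+1, k) is present. *)
Definition winding (Sh : nat -> nat -> bool) (i j : nat) : bool :=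
  \big[addb/false]_(k < j.+1) Sh i k.

Lemma winding0 Sh i : winding Sh i 0 = Sh i 0.
Proof. by rewrite /winding big_ord_recr big_ord0. Qed.

Lemma winding_up Sh i j : winding Sh i j.+1 = winding Sh i j (+) Sh i j.+1.
Proof. by rewrite /winding big_ord_recr. Qed.

(** If the edge set is even at every vertex, the evenness conditions along a
    vertical ray telescope: the rays below two neighbouring cells of a row
    cross the same number of edges mod 2, up to the edge between the cells. *)
Lemma winding_right (Sh Sv : nat -> nat -> bool) :
  (forall i, Sh i 0 = false) -> (forall i, Sv i 0 = false) ->
  (forall i j, Sh i j.+1 (+) Sh i.+1 j.+1 = Sv i.+1 j (+) Sv i.+1 j.+1) ->
  forall i j, winding Sh i.+1 j = winding Sh i j (+) Sv i.+1 j.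
Proof.
move=> Sh0 Sv0 even i; elim=> [|j IH]; first by rewrite !winding0 !Sh0 Sv0.
rewrite !winding_up IH; move: (even i j).
by case: (winding _ _ _) (Sh _ _) (Sh _ _) (Sv _ _) (Sv _ _) => [] [] [] [] [].
Qed.

Definition hedge (i j : nat) (u w : nat * nat) : bool :=
  (u == (i, j)) && (w == (i.+1, j)) || (u == (i.+1, j)) && (w == (i, j)).

Definition vedge (i j : nat) (u w : nat * nat) : bool :=
  (u == (i, j)) && (w == (i, j.+1)) || (u == (i, j.+1)) && (w == (i, j)).

Fixpoint parity (e : nat * nat -> nat * nat -> bool) u l : bool :=
  if l is w :: l' then e u w (+) parity e w l' else false.

Lemma parity_split e u l : parity e u l ->
  exists l1 w l2, l = l1 ++ w :: l2 /\ e (last u l1) w.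
Proof.
elim: l u => //= w l IH u; case Euw: (e u w) => /= H.
  by exists [::], w, l.
by have [l1 [w' [l2 [-> He]]]] := IH _ H; exists (w :: l1), w', l2.
Qed.

Section Complexes.

Definition edge (Eh Ev : nat -> nat -> bool) (u w : nat * nat) : bool :=
  (u.2 == w.2) && ((w.1 == u.1.+1) && Eh u.1 u.2 || (u.1 == w.1.+1) && Eh w.1 w.2)
  || (u.1 == w.1) && ((w.2 == u.2.+1) && Ev u.1 u.2 || (u.2 == w.2.+1) && Ev w.1 w.2).

Definition walk Eh Ev u l := path (fun x y => (x == y) || edge Eh Ev x y) u l.

Lemma edgeP Eh Ev u w : edge Eh Ev u w ->
  (exists i j, Eh i j /\ hedge i j u w) \/ (exists i j, Ev i j /\ vedge i j u w).
Proof.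
case: u w => [a b] [c d] /orP[] /= /andP[/eqP <-] /orP[] /andP[/eqP -> H].
- by left; exists a, b; rewrite /hedge !eqxx.
- by left; exists c, b; rewrite /hedge !eqxx orbT.
- by right; exists a, b; rewrite /vedge !eqxx.
- by right; exists a, d; rewrite /vedge !eqxx orbT.
Qed.

Lemma hedge_in Eh Ev i j u w :
  (u == w) || edge Eh Ev u w -> hedge i j u w -> Eh i j.
Proof.
rewrite /edge /hedge; case: u w => [a b] [c d]; rewrite /= !xpair_eqE /=.
move=> H /orP[] /andP[/andP[/eqP ? /eqP ?] /andP[/eqP ? /eqP ?]]; subst; move: H.
  by move: (Eh _ _) (Ev _ _) (Eh _ _) (Ev _ _) => p q r s; lia.
by move: (Eh _ _) (Ev _ _) (Eh _ _) (Ev _ _) => p q r s; lia.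
Qed.

Lemma vedge_in Eh Ev i j u w :
  (u == w) || edge Eh Ev u w -> vedge i j u w -> Ev i j.
Proof.
rewrite /edge /vedge; case: u w => [a b] [c d]; rewrite /= !xpair_eqE /=.
move=> H /orP[] /andP[/andP[/eqP ? /eqP ?] /andP[/eqP ? /eqP ?]]; subst; move: H.
  by move: (Eh _ _) (Ev _ _) (Eh _ _) (Ev _ _) => p q r s; lia.
by move: (Eh _ _) (Ev _ _) (Eh _ _) (Ev _ _) => p q r s; lia.
Qed.

Lemma parity_hedge_in Eh Ev i j u l :
  walk Eh Ev u l -> parity (hedge i j) u l -> Eh i j.
Proof.
elim: l u => //= w l IH u /andP[uw wl].
by case Eh1: (hedge i j u w) => /= H; [exact: hedge_in uw Eh1 | exact: IH wl H].
Qed.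

Lemma parity_vedge_in Eh Ev i j u l :
  walk Eh Ev u l -> parity (vedge i j) u l -> Ev i j.
Proof.
elim: l u => //= w l IH u /andP[uw wl].
by case Eh1: (vedge i j u w) => /= H; [exact: vedge_in uw Eh1 | exact: IH wl H].
Qed.

(** Each end of a non-trivial step accounts for exactly one of the four edges at
    that vertex. *)
Lemma step_even Eh Ev i j u w : (u == w) || edge Eh Ev u w ->
  hedge i j.+1 u w (+) hedge i.+1 j.+1 u w (+)
  (vedge i.+1 j u w (+) vedge i.+1 j.+1 u w) =
  (u == (i.+1, j.+1)) (+) (w == (i.+1, j.+1)).
Proof.
case/orP=> [/eqP <-|/edgeP].
  rewrite addbb /hedge /vedge; case: u => c d; rewrite !xpair_eqE /=.
  by repeat (case: eqP => //= ?); lia.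
case=> [] [a [b [_ /orP[] /andP[/eqP -> /eqP ->]]]];
  rewrite /hedge /vedge !xpair_eqE /= ?eqSS.
- repeat (case: eqP => //= ?); lia.
- repeat (case: eqP => //= ?); lia.
- repeat (case: eqP => //= ?); lia.
- repeat (case: eqP => //= ?); lia.
Qed.

(** A closed walk enters a vertex as often as it leaves it, so the edges that it
    traverses an odd number of times form an even edge set. *)
Lemma closed_walk_even Eh Ev i j u l : walk Eh Ev u l -> last u l = u ->
  parity (hedge i j.+1) u l (+) parity (hedge i.+1 j.+1) u l =
  parity (vedge i.+1 j) u l (+) parity (vedge i.+1 j.+1) u l.
Proof.
move=> wl lu.
suff : parity (hedge i j.+1) u l (+) parity (hedge i.+1 j.+1) u l (+)
  (parity (vedge i.+1 j) u l (+) parity (vedge i.+1 j.+1) u l) =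
  (u == (i.+1, j.+1)) (+) (last u l == (i.+1, j.+1)).
  by rewrite lu addbb; do 4!case: (parity _ _ _).
elim: l u wl {lu} => [|w l IH] u /=; first by rewrite addbb.
case/andP=> /step_even - /(_ i j) uw /IH wl.
move: uw wl; move: (hedge _ _ _ _) (hedge _ _ _ _) (vedge _ _ _ _) (vedge _ _ _ _).
move: (parity _ _ _) (parity _ _ _) (parity _ _ _) (parity _ _ _) => p q r s p' q' r' s'.
move: (_ == _) (_ == _) (_ == _) => x y z.
by case: p q r s p' q' r' s' x y z => [] [] [] [] [] [] [] [] [] [] [].
Qed.

(* [tog s] stands for: the vertices in s lie together in one convex piece of the
   set under study, so that a path may be moved freely among them. *)
Variable tog : seq (nat * nat) -> Prop.
Hypothesis tog_sub : forall s s', {subset s <= s'} -> tog s' -> tog s.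

(** Homotopy of lattice paths, generated by waiting at a vertex and by replacing
    a vertex when old and new vertex and both neighbours lie together. *)
Inductive heq : seq (nat * nat) -> seq (nat * nat) -> Prop :=
| heq_stutter p u q : heq (p ++ u :: q) (p ++ [:: u, u & q])
| heq_replace p u w w' u' q : tog [:: u; w; w'; u'] ->
    heq (p ++ [:: u, w, u' & q]) (p ++ [:: u, w', u' & q])
| heq_refl l : heq l l
| heq_sym l l' : heq l l' -> heq l' l
| heq_trans l1 l2 l3 : heq l1 l2 -> heq l2 l3 -> heq l1 l3.

Lemma heq_cat p q l l' : heq l l' -> heq (p ++ l ++ q) (p ++ l' ++ q).
Proof.
elim=> {l l'} [p' u q'|p' u w w' u' q' H|l|l l' _ IH|l1 l2 l3 _ IH1 _ IH2].
- rewrite -!catA !cat_cons !(catA p); exact: heq_stutter.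
- rewrite -!catA !cat_cons !(catA p); exact: heq_replace.
- exact: heq_refl.
- exact: heq_sym.
- exact: heq_trans IH1 IH2.
Qed.

Lemma heq_cons u l l' : heq l l' -> heq (u :: l) (u :: l').
Proof. by move/(heq_cat [:: u] [::]); rewrite !cats0. Qed.

Lemma heq_backtrack u w q : tog [:: u; w] -> heq [:: u, w, u & q] (u :: q).
Proof.
move=> uw; apply: (@heq_trans _ [:: u, u, u & q]).
  apply: (@heq_replace [::]); apply: tog_sub uw => x.
  by rewrite !inE; do 3!case: (x == _).
apply: (@heq_trans _ [:: u, u & q]); apply: heq_sym.
  exact: (@heq_stutter [:: u] u q).
exact: (@heq_stutter [::] u q).
Qed.

Lemma heq_push u a b w q : tog [:: u; a; b; w] ->
  heq [:: u, w & q] [:: u, a, b, w & q].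
Proof.
move=> T; apply: (@heq_trans _ [:: u, u, w & q]).
  exact: (@heq_stutter [::] u (w :: q)).
apply: (@heq_trans _ [:: u, u, u, w & q]); first exact: (@heq_stutter [:: u] u (w :: q)).
apply: (@heq_trans _ [:: u, a, u, w & q]).
  apply: (@heq_replace [::]); apply: tog_sub T => x.
  by rewrite !inE; do 4!case: (x == _).
apply: (@heq_replace [:: u]); apply: tog_sub T => x.
by rewrite !inE; do 4!case: (x == _).
Qed.

(** No set W of cells is cut off from the cell (0, 0) by the complex with edges
    Eh, Ev and faces F, other than by its faces; in the plane this says that the
    complex has no holes. *)
Definition surrounding_free Eh Ev (F : nat -> nat -> bool) :=
  forall W : nat -> nat -> bool, W 0 0 = false ->
  (forall i j, ~~ Eh i j.+1 -> ~~ F i j -> ~~ F i j.+1 -> W i j.+1 = W i j) ->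
  (forall i j, ~~ Ev i.+1 j -> ~~ F i j -> ~~ F i.+1 j -> W i.+1 j = W i j) ->
  forall i j, ~~ F i j -> W i j = false.

Definition margin Eh Ev := forall i : nat,
  [/\ Eh i 0 = false, Eh 0 i = false, Ev i 0 = false & Ev 0 i = false].

(** A complex without faces and holes is a forest, and closed walks backtrack: the
    winding parity of a closed walk u, x, ... is constant across absent
    edges, hence zero, hence the walk traverses the edge ux an even number of
    times. A later traversal of ux splits the walk into shorter closed walks. *)
Lemma heq_forest Eh Ev u l : margin Eh Ev ->
  surrounding_free Eh Ev (fun _ _ => false) ->
  (forall u w, edge Eh Ev u w -> tog [:: u; w]) ->
  walk Eh Ev u l -> last u l = u -> heq (u :: l) [:: u].
Proof.
move=> mar free Etog; elim: {l}(size l).+1 {-2}l (ltnSn (size l)) u => // n IH l.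
rewrite ltnS => ln u wl lu.
pose W := winding (fun i j => parity (hedge i j) u l).
have h0 i : parity (hedge i 0) u l = false.
  by apply: contraFF (@parity_hedge_in Eh Ev i 0 u l wl) _; case: (mar i).
have v0 i : parity (vedge i 0) u l = false.
  by apply: contraFF (@parity_vedge_in Eh Ev i 0 u l wl) _; case: (mar i).
have v0' i : parity (vedge 0 i) u l = false.
  by apply: contraFF (@parity_vedge_in Eh Ev 0 i u l wl) _; case: (mar i).
have Wr := @winding_right (fun i j => parity (hedge i j) u l)
  (fun i j => parity (vedge i j) u l) h0 v0 (fun i j => closed_walk_even i j wl lu).
have Wf i j : W i j = false.
  apply: (free W) => // [|{}i {}j Eij _ _|{}i {}j Eij _ _].
  - by rewrite /W winding0 h0.
  - rewrite /W winding_up; case P : (parity _ _ _); last by rewrite addbF.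
    by rewrite (parity_hedge_in wl P) in Eij.
  - rewrite /W Wr; case P : (parity _ _ _); last by rewrite addbF.
    by rewrite (parity_vedge_in wl P) in Eij.
have hf i j : parity (hedge i j) u l = false.
  case: j => // j; move: (Wf i j.+1) (Wf i j); rewrite /W winding_up => + e.
  by rewrite e addFb.
have vf i j : parity (vedge i j) u l = false.
  case: i => // i; move: (Wf i.+1 j) (Wf i j); rewrite /W Wr => + e.
  by rewrite e addFb.
case: l ln wl lu {W h0 v0 v0' Wr Wf} hf vf => [|x l] ln; first by move=> *; exact: heq_refl.
move=> /= /andP[ux wl] lu hf vf.
have [xu|xu] := eqVneq u x.
  subst x; apply: heq_trans (IH _ _ u wl lu); last by [].
  exact/heq_sym/(@heq_stutter [::]).
rewrite (negbTE xu) /= in ux.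
have [l1 [w [l2 [lE H]]]] : exists l1 w l2, l = l1 ++ w :: l2 /\
    ((last x l1 = u /\ w = x) \/ (last x l1 = x /\ w = u)).
  (* The first step made the parity of its edge odd, so the rest of the walk
     traverses that edge again. *)
  have [e [e1 e2]] : exists e : nat * nat -> nat * nat -> bool,
      parity e x l /\ forall a b, e a b -> (a = u /\ b = x) \/ (a = x /\ b = u).
    case: (edgeP ux) => [] [i [j [_ Hij]]].
      exists (hedge i j); split; first by move: (hf i j); rewrite Hij; case: parity.
      by move=> a b; move: Hij => /orP[]/andP[/eqP -> /eqP ->] /orP[]/andP[/eqP -> /eqP ->]; tauto.
    exists (vedge i j); split; first by move: (vf i j); rewrite Hij; case: parity.
    by move=> a b; move: Hij => /orP[]/andP[/eqP -> /eqP ->] /orP[]/andP[/eqP -> /eqP ->]; tauto.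
  by have [l1 [w [l2 [-> He]]]] := parity_split e1; exists l1, w, l2; split => //; exact: e2.
have tux := Etog _ _ ux.
move: ln wl lu; rewrite lE /= size_cat /walk cat_path last_cat /= => ln /and3P[w1 s1 w2] lu.
case: H => -[l1E wE]; subst w.
(* The edge is traversed again in the same direction; the closed part
   u, x, ..., u is contracted first. *)
- apply: (@heq_trans _ (u :: x :: l2)); last first.
    apply: IH => //=; first by move: ln; lia.
    by rewrite ux orbT.
  have : heq (u :: x :: l1) [:: u].
    apply: IH => //=; first by move: ln; lia.
    by rewrite ux orbT.
  by move/(heq_cat [::] (x :: l2)).
(* The edge is traversed back: the part between contracts to x, and the
   remaining excursion u, x, u is a backtrack. *)
- apply: (@heq_trans _ [:: u, x, u & l2]).
    have : heq (x :: l1) [:: x] by apply: (IH l1 _ x w1 l1E); exact: leq_ltn_trans (leq_addr _ _) ln.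
    by move/(heq_cat [:: u] (u :: l2)).
  apply: heq_trans (heq_backtrack _ tux) _.
  by apply: (IH l2 _ u w2 lu); exact: leq_ltn_trans (leq_trans (leqnSn _) (leq_addl _ _)) ln.
Qed.

Lemma code_inj n a b i j :
  a < n -> i < n -> b * n + a = j * n + i -> b = j /\ a = i.
Proof.
move=> an ino E; have n0 : 0 < n by case: n an {ino E}.
have := congr1 (fun m => m %/ n) E; have := congr1 (fun m => m %% n) E.
by rewrite !modnMDl !divnMDl // !modn_small // !divn_small // !addn0.
Qed.

Fixpoint detour (tl tr bl br u : nat * nat) l :=
  if l is w :: l' then
    if (u == tl) && (w == tr) then [:: bl, br, tr & detour tl tr bl br w l']
    else if (u == tr) && (w == tl) then [:: br, bl, tl & detour tl tr bl br w l']
    else w :: detour tl tr bl br w l'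
  else [::].

Lemma heq_detour tl tr bl br u l : tog [:: tl; bl; br; tr] ->
  heq (u :: l) (u :: detour tl tr bl br u l).
Proof.
move=> T; elim: l u => [|w l IH] u /=; first exact: heq_refl.
case: ifP => [/andP[/eqP -> /eqP ->]|_].
  apply: heq_trans (heq_push _ T) _.
  by apply: heq_cons; apply: heq_cons; apply: heq_cons; exact: IH.
case: ifP => [/andP[/eqP -> /eqP ->]|_]; last exact/heq_cons/IH.
apply: (@heq_trans _ [:: tr, br, bl, tl & l]).
  apply: heq_push; apply: tog_sub T => x.
  by rewrite !inE; do 4!case: (x == _).
by apply: heq_cons; apply: heq_cons; apply: heq_cons; exact: IH.
Qed.

Lemma last_detour tl tr bl br u l : last u (detour tl tr bl br u l) = last u l.
Proof.
by elim: l u => //= w l IH u; case: ifP => [/andP[_ /eqP ->]|_] /=;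
  [exact: IH | case: ifP => [/andP[_ /eqP ->]|_] /=; exact: IH].
Qed.

(** The faces are collapsed one at a time, the last one in row-major order first.
    There is no face above it, so its top edge is free: paths are pushed off
    that edge along the other three, and then the face and the edge are
    deleted. This creates no hole. *)
Lemma heq_full n m Eh Ev (F : nat -> nat -> bool) u l :
  (forall i j, F i j -> i < n /\ j * n + i < m) ->
  surrounding_free Eh Ev F -> margin Eh Ev ->
  (forall i j, F i j -> [/\ Eh i j, Eh i j.+1, Ev i j & Ev i.+1 j]) ->
  (forall i j, F i j -> tog [:: (i, j.+1); (i, j); (i.+1, j); (i.+1, j.+1)]) ->
  (forall u w, edge Eh Ev u w -> tog [:: u; w]) ->
  walk Eh Ev u l -> last u l = u -> heq (u :: l) [:: u].
Proof.
elim: m Eh F l => [|m IH] Eh F l Fm free mar FE FT ET wl lu.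
  apply: (heq_forest mar _ ET wl lu) => W W0 Wh Wv i j _; apply: free => //.
  - by move=> {}i {}j E _ _; exact: Wh.
  - by move=> {}i {}j E _ _; exact: Wv.
  - by apply/negP => /Fm[].
case: (boolP [exists i : 'I_n, exists j : 'I_m.+1, (j * n + i == m) && F i j]); last first.
  move=> noF; apply: (IH Eh F) => // i j Fij; have [ltin] := Fm _ _ Fij.
  rewrite ltnS leq_eqVlt => /orP[/eqP jm|//]; case/negP: noF.
  apply/existsP; exists (Ordinal ltin); apply/existsP.
  have ltjm : j < m.+1 by rewrite ltnS -jm (leq_trans _ (leq_addr _ _)) // leq_pmulr //; exact: leq_ltn_trans (leq0n _) ltin.
  by exists (Ordinal ltjm); rewrite /= jm eqxx.
case/existsP=> -[i ltin] /existsP[[j ltj]] /= /andP[/eqP jm Fij].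
have Ftop : F i j.+1 = false by apply/negP => /Fm[_]; rewrite -jm mulSn; lia.
pose Eh' a b := Eh a b && ((a, b) != (i, j.+1)).
pose F' a b := F a b && ((a, b) != (i, j)).
have T := FT _ _ Fij.
have wE x y : edge Eh' Ev x y -> edge Eh Ev x y.
  by move=> /orP[]/andP[e /orP[]/andP[e' H]]; rewrite /edge e e' /=;
    try (case/andP: H => H _); rewrite H ?orbT.
apply: (heq_trans (heq_detour u l T)).
apply: (IH Eh' F') => //.
- move=> a b /andP[Fab nab]; have [ltan H] := Fm _ _ Fab; split=> //.
  rewrite ltn_neqAle -ltnS H andbT; apply: contra nab => /eqP bm.
  by have [-> ->] : b = j /\ a = i by apply: (@code_inj n); rewrite ?bm ?jm.
- move=> W W0 Wh Wv a b.
  have Wf c d : ~~ F c d -> W c d = false.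
    apply: free => // {}c {}d E Fcd Fcd'.
      by apply: Wh; rewrite ?negb_and ?E ?Fcd ?Fcd'.
    by apply: Wv; rewrite ?negb_and ?E ?Fcd ?Fcd'.
  rewrite negb_and negbK => /orP[/Wf//|/eqP[-> ->]].
  rewrite -(Wh i j) ?Wf ?Ftop //.
    by rewrite /Eh' eqxx andbF.
  by rewrite /F' eqxx andbF.
  by rewrite /F' Ftop.
- by move=> a; have [e1 e2 e3 e4] := mar a; split; rewrite // /Eh' ?e1 ?e2.
- move=> a b /andP[Fab nab]; have [e1 e2 e3 e4] := FE _ _ Fab; split => //.
    rewrite /Eh' e1 /=; apply/eqP => -[? ?]; subst.
    by rewrite Ftop in Fab.
  by rewrite /Eh' e2 /=; apply: contra nab => /eqP[-> ->].
- by move=> a b /andP[Fab _]; exact: FT.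
- by move=> x y /wE; exact: ET.
- have [e1 e2 e3 e4] := FE _ _ Fij.
  elim: l u wl {lu IH} => //= w l IHl u /andP[uw wl].
  have neqj : (j == j.+1) = false by rewrite ltn_eqF.
  have s1 : edge Eh' Ev (i, j.+1) (i, j) by rewrite /edge /= !eqxx e3 !orbT.
  have s1' : edge Eh' Ev (i, j) (i, j.+1) by rewrite /edge /= !eqxx e3 !orbT.
  have s2 : edge Eh' Ev (i, j) (i.+1, j).
    by rewrite /edge /Eh' /= e1 !xpair_eqE /= !eqxx /= neqj.
  have s2' : edge Eh' Ev (i.+1, j) (i, j).
    rewrite /edge /Eh' /= e1 !xpair_eqE /= !eqxx /= neqj.
    by rewrite !orbT.
  have s3 : edge Eh' Ev (i.+1, j) (i.+1, j.+1) by rewrite /edge /= !eqxx e4 !orbT.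
  have s3' : edge Eh' Ev (i.+1, j.+1) (i.+1, j) by rewrite /edge /= !eqxx e4 !orbT.
  case: ifP => [/andP[/eqP uE /eqP wE']|n1].
    by rewrite /= -/(walk _ _ _ _) uE s1 s2 s3 !orbT /= wE'; apply: IHl; rewrite -wE'.
  case: ifP => [/andP[/eqP uE /eqP wE']|n2].
    by rewrite /= -/(walk _ _ _ _) uE s1' s2' s3' !orbT /= wE'; apply: IHl; rewrite -wE'.
  rewrite /= -/(walk _ _ _ _) IHl // andbT; case/orP: uw => [->//|uw].
  apply/orP; right; move: uw n1 n2; rewrite /edge /Eh'; case: u w {wl} => [a b] [c d].
  rewrite /= !xpair_eqE.
  case/orP=> /andP[/eqP <- /orP[]/andP[/eqP ->]] -> /=; rewrite !eqxx /= ?orbT //.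
    by rewrite !eqSS => + _; case: (a == i); case: (b == j.+1).
  by rewrite !eqSS => _; case: (c == i); case: (b == j.+1); rewrite ?orbT.
- by rewrite last_detour.
Qed.

(** W is a union of complementary components of the graph, none of which is the
    component of the cell (0, 0). *)
Definition uncrossed Eh Ev (W : nat -> nat -> bool) :=
  [/\ W 0 0 = false, forall i j, ~~ Eh i j.+1 -> W i j.+1 = W i j
    & forall i j, ~~ Ev i.+1 j -> W i.+1 j = W i j].

Definition confined n (Eh Ev : nat -> nat -> bool) :=
  forall i j, (Eh i j -> i < n /\ j < n) /\ (Ev i j -> i < n /\ j < n).

Lemma uncrossed_bounded n Eh Ev W i j : margin Eh Ev -> confined n Eh Ev ->
  uncrossed Eh Ev W -> W i j -> i < n /\ j < n.
Proof.
move=> mar conf [W0 Wh Wv] Wij.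
have row0 a : W a 0 = false.
  by elim: a => // a <-; apply: Wv; have [_ _ ->] := mar a.+1.
have right a b : n <= a -> W a b = false.
  move=> na; elim: b => // b <-; apply: Wh; apply/negP => /(proj1 (conf _ _)) [].
  by rewrite ltnNge na.
split; rewrite ltnNge; apply/negP => le.
  by rewrite right in Wij.
suff : forall c, W (i + c) j = W i j by move/(_ n); rewrite Wij right // leq_addl.
elim=> [|c <-]; first by rewrite addn0.
rewrite addnS; apply: Wv; apply/negP => /(proj2 (conf _ _)) [_].
by rewrite ltnNge le.
Qed.

Lemma uncrossed_margin Eh Ev W k : margin Eh Ev -> uncrossed Eh Ev W ->
  W k 0 = false /\ W 0 k = false.
Proof.
move=> mar [W0 Wh Wv]; split; elim: k => // k <-.
  by apply: Wv; have [_ _ ->] := mar k.+1.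
by apply: Wh; have [_ ->] := mar k.+1.
Qed.

(** Filling in all cells that the edges enclose leaves no hole, so a closed walk
    contracts as soon as the enclosed cells consist of vertices lying together. *)
Lemma heq_enclosed n Eh Ev u l : margin Eh Ev -> confined n Eh Ev ->
  (forall u w, edge Eh Ev u w -> tog [:: u; w]) ->
  (forall W i j, uncrossed Eh Ev W -> W i j ->
     tog [:: (i, j.+1); (i, j); (i.+1, j); (i.+1, j.+1)]) ->
  walk Eh Ev u l -> last u l = u -> heq (u :: l) [:: u].
Proof.
move=> mar conf ET WT wl lu.
pose F i j := `[< exists2 W, uncrossed Eh Ev W & W i j >].
have Fn i j : F i j -> i < n /\ j < n.
  by case/asboolP=> W; exact: uncrossed_bounded.
have Frow i : F i 0 = false.
  apply/negP => /asboolP[W [W0 Wh Wv]]; suff -> : W i 0 = false by [].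
  by elim: i => // i <-; apply: Wv; have [_ _ ->] := mar i.+1.
have Fcol j : F 0 j = false.
  apply/negP => /asboolP[W [W0 Wh Wv]]; suff -> : W 0 j = false by [].
  by elim: j => // j <-; apply: Wh; have [_ ->] := mar j.+1.
pose Eh' i j := [|| Eh i j, F i j | (0 < j) && F i j.-1].
pose Ev' i j := [|| Ev i j, F i j | (0 < i) && F i.-1 j].
have FT i j : F i j -> tog [:: (i, j.+1); (i, j); (i.+1, j); (i.+1, j.+1)].
  by case/asboolP => W; exact: WT.
apply: (@heq_full n (n * n) Eh' Ev' F) => //.
- by move=> i j /Fn[lti ltj]; split=> //; nia.
- move=> W W0 Wh Wv i j Fij.
  have FEh a b : ~~ Eh a b.+1 -> F a b = F a b.+1.
    move=> E; apply/asboolP/asboolP => -[U ucU Uab]; exists U => //.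
      by case: ucU => _ -> .
    by case: ucU => _ <-.
  have FEv a b : ~~ Ev a.+1 b -> F a b = F a.+1 b.
    move=> E; apply/asboolP/asboolP => -[U ucU Uab]; exists U => //.
      by case: ucU => _ _ -> .
    by case: ucU => _ _ <-.
  apply/negbTE; apply: contra (Fij) => Wij; apply/asboolP.
  (* A set of cells surrounded by the filled complex is, off the enclosed cells,
     not crossed by the edges, hence enclosed itself. *)
  exists (fun a b => W a b && ~~ F a b); last by rewrite Wij.
  split; first by rewrite W0.
  + move=> a b E; have Fe := FEh _ _ E; rewrite -Fe.
    case Fab : (F a b); first by rewrite !andbF.
    have E' : ~~ Eh' a b.+1 by rewrite /Eh' /= -Fe Fab !orbF.
    by rewrite !andbT Wh // -?Fe Fab.
  + move=> a b E; have Fe := FEv _ _ E; rewrite -Fe.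
    case Fab : (F a b); first by rewrite !andbF.
    have E' : ~~ Ev' a.+1 b by rewrite /Ev' /= -Fe Fab !orbF.
    by rewrite !andbT Wv // -?Fe Fab.
- move=> i; have [e1 e2 e3 e4] := mar i.
  by split; rewrite /Eh' /Ev' ?e1 ?e2 ?e3 ?e4 ?Frow ?Fcol ?andbF.
- by move=> i j Fij; rewrite /Eh' /Ev' /= Fij !orbT.
- move=> x y xy.
  have [E|[i [j [Fij]]]] : edge Eh Ev x y \/ exists i j, F i j /\
      {subset [:: x; y] <= [:: (i, j.+1); (i, j); (i.+1, j); (i.+1, j.+1)]}.
  + move: xy; rewrite /edge; case: x y => [a b] [c d] /=.
    case/orP => /andP[/eqP <- /orP[]/andP[/eqP -> /or3P[->|H|/andP[/prednK <- H]]]];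
      rewrite ?eqxx ?orbT; try (by left); right; do 2 eexists; (split; [exact: H|]);
      move=> z; rewrite !inE => /orP[] /eqP->; by rewrite !eqxx ?orbT.
  + exact: ET.
  + by move=> sub; exact: tog_sub sub (FT _ _ Fij).
- apply: sub_path wl => a b /orP[->//|H]; apply/orP; right.
  move: H; rewrite /edge /Eh' /Ev'.
  by case/orP => /andP[-> /orP[]/andP[-> ->]]; rewrite ?orbT.
Qed.

(** The default value v of [nth] makes the list l stand for the loop that rests at
    its base point v after its last entry; rows of different length can then be
    compared at every time. *)
Definition wf_loop v l := head v l = v /\ forall i, tog [:: nth v l i; nth v l i.+1].

Definition contiguous v l l' :=
  forall i, tog [:: nth v l i; nth v l i.+1; nth v l' i; nth v l' i.+1].

Inductive chain v : seq (nat * nat) -> seq (nat * nat) -> Prop :=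
| chain_refl l : wf_loop v l -> chain v l l
| chain_step l1 l2 l3 : wf_loop v l1 -> contiguous v l1 l2 -> chain v l2 l3 -> chain v l1 l3.

Lemma chain_wfl v l l' : chain v l l' -> wf_loop v l.
Proof. by case. Qed.

Lemma chain_wfr v l l' : chain v l l' -> wf_loop v l'.
Proof. by elim. Qed.

Lemma contiguous_sym v l l' : contiguous v l l' -> contiguous v l' l.
Proof.
by move=> C i; apply: tog_sub (C i) => x; rewrite !inE; do 4!case: (x == _).
Qed.

Lemma chain_trans v l1 l2 l3 : chain v l1 l2 -> chain v l2 l3 -> chain v l1 l3.
Proof. by move=> c; elim: c => // a b c wa ab bc IH /IH; exact: chain_step. Qed.

Lemma chain_sym v l l' : chain v l l' -> chain v l' l.
Proof.
elim=> [a|a b c wa ab bc IH]; first exact: chain_refl.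
apply: (chain_trans IH); apply: chain_step (chain_wfl bc) (contiguous_sym ab) _.
exact: chain_refl.
Qed.

Lemma contiguous_replace v p u a a' q : wf_loop v (p ++ [:: u, a & q]) ->
  tog [:: u; a; a'] -> tog [:: a; a'; head v q] ->
  contiguous v (p ++ [:: u, a & q]) (p ++ [:: u, a' & q]).
Proof.
move=> [_ wf] T1 T2 i; have {}wf := wf i; move: wf.
rewrite !nth_cat; have [lt|] := ltnP i (size p).
  case: (ltngtP i.+1 (size p)) lt => // [_ _|-> _] wf; apply: tog_sub wf => x.
    by rewrite !inE; do 2!case: (x == _).
  by rewrite subnn /= !inE; do 2!case: (x == _).
move=> le; rewrite ltnNge (leqW le) /= subSn //.
case: (i - size p) => [|[|k]] /= wf.
- by apply: tog_sub T1 => x; rewrite !inE; do 3!case: (x == _).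
- by apply: tog_sub T2 => x; rewrite nth0 !inE; do 3!case: (x == _).
- by apply: tog_sub wf => x; rewrite !inE; do 2!case: (x == _).
Qed.

Lemma chain_replace v p u w w' u' q : tog [:: u; w; w'; u'] ->
  wf_loop v (p ++ [:: u, w, u' & q]) ->
  chain v (p ++ [:: u, w, u' & q]) (p ++ [:: u, w', u' & q]).
Proof.
move=> T wf.
have C : contiguous v (p ++ [:: u, w, u' & q]) (p ++ [:: u, w', u' & q]).
  apply: contiguous_replace => //; apply: tog_sub T => x;
  by rewrite !inE; do 3!case: (x == _); rewrite ?orbT.
apply: (chain_step wf C); apply: chain_refl; split.
  by case: wf => <- _; case: p C.
by move=> i; apply: tog_sub (C i) => x; rewrite !inE => /orP[]->; rewrite ?orbT.
Qed.

Lemma chain_stutter v p u q : wf_loop v (p ++ u :: q) ->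
  chain v (p ++ u :: q) (p ++ [:: u, u & q]).
Proof.
elim: q p u => [|w q IH] p u wf.
  have C : contiguous v (p ++ [:: u]) (p ++ [:: u; u]).
    move=> i; have [_ wfn] := wf; have Ti := wfn i; have Tp := wfn (size p).
    have sp : ((size p).+1 < size p) = false by lia.
    move: Ti Tp; rewrite !nth_cat ltnn subnn sp subSnn /= => Ti Tp.
    have [lt|le] := ltnP i (size p).
      move: Ti; rewrite lt; case: (ltngtP i.+1 (size p)) lt => // [_ _|-> _] Ti;
      apply: tog_sub Ti => x; rewrite ?subnn /= !inE; by do 2!case: (x == _).
    have -> : (i.+1 < size p) = false by lia.
    rewrite subSn //; case: (i - size p) => [|[|k]] /=; apply: tog_sub Tp => x;
    rewrite ?nth_nil !inE; by do 2!case: (x == _).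
  apply: (chain_step wf C); apply: chain_refl; split.
    by case: wf => <- _; case: p C.
  by move=> i; apply: tog_sub (C i) => x; rewrite !inE => /orP[]->; rewrite ?orbT.
rewrite -cat_rcons in wf; have H := IH _ _ wf.
rewrite !cat_rcons in wf H; apply: (chain_trans H).
apply: chain_replace (chain_wfr H).
have sp : ((size p).+1 < size p) = false by lia.
have [_ /(_ (size p))] := wf.
rewrite !nth_cat ltnn subnn sp subSnn /= => T; apply: tog_sub T => x.
by rewrite !inE; do 2!case: (x == _).
Qed.

(** Each half serves the other one in the case of symmetry. *)
Lemma heq_chain v l l' : heq l l' ->
  (wf_loop v l -> chain v l l') /\ (wf_loop v l' -> chain v l l').
Proof.
elim=> {l l'} [p u q|p u w w' u' q T|l|l l' _ [IH1 IH2]|l1 l2 l3 _ [IH1 IH2] _ [IH3 IH4]].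
- split; first exact: chain_stutter.
  move=> wf; apply: chain_stutter; split; first by case: wf => <- _; case: p.
  move=> i; have [_ wfn] := wf.
  have := wfn i; have := wfn i.+1; rewrite !nth_cat.
  have [lt|le] := ltnP i (size p).
    have [//|ge] := ltnP i.+1 (size p); have -> : size p = i.+1 by lia.
    by rewrite subnn.
  have -> : (i.+1 < size p) = false by lia.
  have -> : (i.+2 < size p) = false by lia.
  by rewrite !subSn ?leqW.
- split; first exact: chain_replace.
  move=> wf; apply: chain_sym; apply: chain_replace => //.
  by apply: tog_sub T => x; rewrite !inE; do 4!case: (x == _).
- by split; exact: chain_refl.
- by split=> [/IH2|/IH1]; exact: chain_sym.
- split=> wf; first by have H := IH1 wf; exact: chain_trans H (IH3 (chain_wfr H)).
  by have H := IH4 wf; exact: chain_trans (IH2 (chain_wfl H)) H.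
Qed.

Lemma chain_rows v l l' : chain v l l' ->
  exists T (x : nat -> seq (nat * nat)),
  [/\ x 0 = l, x T = l', forall j, head v (x j) = v &
      forall j, j < T -> contiguous v (x j) (x j.+1)].
Proof.
elim=> [a [wa _]|a b c [wa _] ab bc [T [x [x0 xT xv xc]]]].
  by exists 0, (fun=> a); split.
exists T.+1, (fun j => if j is k.+1 then x k else a); split=> //; first by case.
by case=> [|j] /= lt; [rewrite x0 | exact: xc].
Qed.

End Complexes.

Local Open Scope classical_set_scope.
Local Open Scope ring_scope.

(** * Topology of the complex numbers in terms of the modulus *)

Section Modulus.
Variable R : realType.
Implicit Types z w x y : R[i].

Lemma norm_modulus z : `|z| = (modulus z)%:C%C.
Proof. by rewrite /modulus normc_def. Qed.

Lemma modulus_ge0 z : 0 <= modulus z.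
Proof. by rewrite -lecR -norm_modulus normr_ge0. Qed.

Lemma modulusD z w : modulus (z + w) <= modulus z + modulus w.
Proof. by rewrite -lecR rmorphD /= -!norm_modulus ler_normD. Qed.

Lemma modulusM z w : modulus (z * w) = modulus z * modulus w.
Proof. by apply: (@complexI R); rewrite rmorphM /= -!norm_modulus normrM. Qed.

Lemma modulusX z n : modulus (z ^+ n) = modulus z ^+ n.
Proof. by apply: (@complexI R); rewrite rmorphXn /= -!norm_modulus normrX. Qed.

Lemma modulusN z : modulus (- z) = modulus z.
Proof. by rewrite /modulus normrN. Qed.

Lemma modulusC z w : modulus (z - w) = modulus (w - z).
Proof. by rewrite /modulus distrC. Qed.

Lemma modulus0 : modulus (0 : R[i]) = 0.
Proof. by rewrite /modulus normr0. Qed.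

Lemma modulus_eq0 z : (modulus z == 0) = (z == 0).
Proof. by rewrite -(inj_eq (@complexI R)) -norm_modulus normr_eq0. Qed.

Lemma modulus_gt0 z : (0 < modulus z) = (z != 0).
Proof. by rewrite lt_def modulus_ge0 andbT modulus_eq0. Qed.

Lemma modulus_real (a : R) : modulus a%:C%C = `|a|.
Proof. by apply: (@complexI R); rewrite -norm_modulus normc_def /= expr0n addr0 sqrtr_sqr. Qed.

Lemma modulusV z : modulus z^-1 = (modulus z)^-1.
Proof. by apply: (@complexI R); rewrite fmorphV /= -!norm_modulus normfV. Qed.

Lemma modulusB z w : modulus z - modulus w <= modulus (z - w).
Proof. by rewrite lerBlDr -{1}(subrK w z) modulusD. Qed.

Lemma modulus_Re z : `|complex.Re z| <= modulus z.
Proof. by rewrite -lecR -norm_modulus normc_ge_Re. Qed.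

Lemma modulus_Im z : `|complex.Im z| <= modulus z.
Proof.
case: z => a b; rewrite -[leLHS]sqrtr_sqr /modulus normc_def /= ler_sqrt.
  by rewrite lerDr sqr_ge0.
by rewrite addr_ge0 ?sqr_ge0.
Qed.

Lemma modulus_ReIm z : modulus z <= `|complex.Re z| + `|complex.Im z|.
Proof.
case: z => a b /=; have -> : (a +i* b)%C = a%:C%C + 'i%C * b%:C%C.
  by rewrite mulrC; apply/eqP; rewrite eq_complex /= !(mulr0, mulr1, mul0r, subr0, addr0, add0r) !eqxx.
apply: (le_trans (modulusD _ _)); rewrite modulusM !modulus_real.
have -> : modulus ('i%C : R[i]) = 1.
  by rewrite /modulus normc_def /= expr0n expr1n add0r sqrtr1.
by rewrite mul1r.
Qed.

Lemma nbhs_modulus x (A : set R[i]) :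
  nbhs x A <-> exists2 e : R, 0 < e & forall y, modulus (y - x) < e -> A y.
Proof.
split=> [/nbhs_ballP [e /= e0 eA]|[e e0 eA]].
  have eE : e = (complex.Re e)%:C%C.
    by move: e0; case: e {eA} => a b; rewrite ltcE /= => /andP[/eqP -> _].
  exists (complex.Re e); first by move: e0; rewrite eE ltcR.
  move=> y yx; apply: eA.
  by rewrite /ball /= distrC norm_modulus eE ltcR.
apply/nbhs_ballP; exists e%:C%C; first by rewrite /= ltcR.
by move=> y; rewrite /ball /= distrC norm_modulus ltcR; exact: eA.
Qed.

Lemma open_modulusP (A : set R[i]) :
  open A <-> forall x, A x -> exists2 e : R, 0 < e & forall y, modulus (y - x) < e -> A y.
Proof.
rewrite openE; split=> [H x /H /nbhs_modulus //|H x /H ?]; exact/nbhs_modulus.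
Qed.

Lemma closure_modulusP (A : set R[i]) x :
  closure A x <-> forall e : R, 0 < e -> exists2 y, A y & modulus (y - x) < e.
Proof.
split=> [cA e e0|H B /nbhs_modulus[e e0 eB]].
  have [|y [Ay By]] := cA [set y | modulus (y - x) < e]; last by exists y.
  by apply/nbhs_modulus; exists e.
by have [y Ay yx] := H e e0; exists y; split => //; exact: eB.
Qed.

Lemma cvg_modulusP T (F : set_system T) (FF : Filter F) (f : T -> R[i]) l :
  f @ F --> l <-> forall e : R, 0 < e -> \forall t \near F, modulus (f t - l) < e.
Proof.
split=> [fl e e0|H A /nbhs_modulus[e e0 eA]].
  by apply: (fl [set y | modulus (y - l) < e]); apply/nbhs_modulus; exists e.
by move: (H _ e0); apply: filterS => t; exact: eA.
Qed.

Lemma modulus_continuous : continuous (@modulus R).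
Proof.
move=> x; apply/(@cvgrPdist_lt _ _ _ (nbhs x)) => e e0.
apply/nbhs_modulus; exists e => // y yx.
rewrite ltr_norml; have := modulusB x y; have := modulusB y x.
rewrite (modulusC x y) => h1 h2; apply/andP; split; lra.
Qed.

Lemma open_modulus_lt (f : R[i] -> R[i]) r :
  continuous f -> open [set z | modulus (f z) < r].
Proof.
move=> cf; have -> : [set z | modulus (f z) < r] = (@modulus R \o f) @^-1` [set t | t < r] by [].
apply: open_comp; last exact: open_lt.
by move=> z _; apply: continuous_comp; [exact: cf | exact: modulus_continuous].
Qed.

Lemma complex_continuous : continuous (fun p : R * R => (p.1 +i* p.2)%C).
Proof.
move=> [a b]; apply/cvg_modulusP => e e0.
have : \forall p \near (a, b), `|p.1 - a| < e / 2 /\ `|p.2 - b| < e / 2.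
  have e20 : 0 < e / 2 by lra.
  exists (ball a (e / 2), ball b (e / 2)); first by split; exact: nbhsx_ballx.
  by move=> [c d] [/=]; rewrite /ball /= (distrC c) (distrC d).
apply: filterS => -[c d] /= [h1 h2].
apply: (le_lt_trans (modulus_ReIm _)) => /=; lra.
Qed.

Lemma compact_modulus (A : set R[i]) (B : R) :
  closed A -> (forall z, A z -> modulus z <= B) -> compact A.
Proof.
move=> cA AB.
apply: (@subclosed_compact _ _ ((fun p : R * R => (p.1 +i* p.2)%C) @` (`[-B, B] `*` `[-B, B]))) => //.
  apply: continuous_compact; first exact/continuous_subspaceT/complex_continuous.
  by apply: compact_setX; exact: segment_compact.
move=> [a b] /AB; exists (a, b) => //=.
have := modulus_Re (a +i* b)%C; have := modulus_Im (a +i* b)%C => /= h1 h2.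
split => /=; rewrite in_itv /= -ler_norml; lra.
Qed.

Lemma compact_argmax (A : set R[i]) (f : R[i] -> R) :
  continuous f -> compact A -> A !=set0 -> exists2 x, A x & forall y, A y -> f y <= f x.
Proof.
move=> cf cA A0; have [x xA H] := compact_EVT_max A0 cA (continuous_subspaceT cf).
by exists x; [exact: set_mem | move=> y Ay; apply: H; exact: mem_set].
Qed.

End Modulus.

(** * The maximum principle for locally uniform limits of polynomials *)

Section MaximumPrinciple.
Variable R : realType.
Implicit Types (p q : {poly R[i]}) (x y z : R[i]) (T O : set R[i]).

Lemma horner_continuous p : continuous (horner p).
Proof.
elim/poly_ind: p => [|p c IH] x.
  have -> : horner (0 : {poly R[i]}) = fun=> 0 by apply/funext => y; rewrite horner0.
  exact: (@cst_continuous _ _ (0 : R[i])) .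
have -> : horner (p * 'X + c%:P) = (horner p \* id) + cst c.
  by apply/funext => y; rewrite hornerMXaddC.
by apply: continuousD; [apply: continuousM; [exact: IH | exact: cvg_id] | exact: cst_continuous].
Qed.

(** Write p(y) = w + q(y) (y - x)^m with w = p(x) and q(x) = b non-zero. In the
    direction c for which b c^m is a positive multiple of w (or is 1, if w = 0),
    the term b (y - x)^m adds to the modulus, and q(y) - b is too small near x
    to compensate. *)
Lemma poly_modulus_increases p x (e : R) : (1 < size p)%N -> 0 < e ->
  exists2 y, modulus (y - x) < e & modulus p.[x] < modulus p.[y].
Proof.
move=> sp e0; set w := p.[x].
have pw0 : p - w%:P != 0.
  apply/eqP => /eqP; rewrite subr_eq0 => /eqP pE.
  by move: sp; rewrite pE size_polyC; case: (w != 0).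
have [m [q]] := multiplicity_XsubC (p - w%:P) x; rewrite pw0 /= => qx pE.
have hE y : p.[y] = w + q.[y] * (y - x) ^+ m.
  by rewrite -[LHS](subrK w) -{1}(hornerC w y) -hornerN -hornerD pE hornerM horner_exp hornerXsubC addrC.
have m0 : (0 < m)%N.
  case: m pE hE => // pE /(_ x); rewrite expr0 mulr1 -/w => /eqP.
  by rewrite -subr_eq0 opprD addrA subrr add0r oppr_eq0 => /eqP q0; rewrite /root q0 eqxx in qx.
set b := q.[x] in qx; have b0 : b != 0 by [].
pose u := if w == 0 then 1 else w.
have u0 : u != 0 by rewrite /u; case: ifP => [_|/negbT //]; exact: oner_neq0.
pose c := m.-root (u / b).
have cE : c ^+ m = u / b by rewrite rootCK.
have [d d0 dq] : exists2 d : R, 0 < d & forall y, modulus (y - x) < d -> modulus (q.[y] - b) < modulus b.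
  have /cvg_modulusP/(_ (modulus b)) := @horner_continuous q x.
  by rewrite modulus_gt0 => /(_ b0) /nbhs_modulus.
(* The point y = x + t c stays within both d and e of x. *)
pose t := Num.min d e / (1 + modulus c).
have c1 : 0 < 1 + modulus c by rewrite ltr_wpDr ?modulus_ge0.
have de0 : 0 < Num.min d e by rewrite lt_min d0.
have t0 : 0 < t by rewrite divr_gt0.
have tc : t * modulus c < Num.min d e.
  rewrite /t mulrAC ltr_pdivrMr // ltr_pM2l //; lra.
pose y := x + t%:C%C * c.
have yx : modulus (y - x) < Num.min d e by rewrite /y addrC addKr modulusM modulus_real gtr0_norm.
exists y; first by move: yx; rewrite lt_min => /andP[].
have {}dq : modulus (q.[y] - b) < modulus b by apply: dq; move: yx; rewrite lt_min => /andP[].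
have tm0 : 0 < t ^+ m by rewrite exprn_gt0.
have -> : p.[y] = (w + (t ^+ m)%:C%C * u) + (t ^+ m)%:C%C * (u / b) * (q.[y] - b).
  rewrite hE /y [x + _ - x]addrC addKr exprMn cE rmorphXn /=.
  by rewrite -addrA; congr (_ + _); field.
have wu : modulus (w + (t ^+ m)%:C%C * u) = modulus w + t ^+ m * modulus u.
  rewrite /u; case: eqP => [->|_]; first by rewrite !add0r modulus0 add0r modulusM modulus_real gtr0_norm.
  have -> : w + (t ^+ m)%:C%C * w = (1 + t ^+ m)%:C%C * w by rewrite rmorphD mulrDl mul1r.
  by rewrite modulusM modulus_real gtr0_norm ?addr_gt0 // mulrDl mul1r.
have := modulusB (w + (t ^+ m)%:C%C * u) (- ((t ^+ m)%:C%C * (u / b) * (q.[y] - b))).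
rewrite opprK wu modulusN 2!modulusM modulus_real gtr0_norm // modulusM modulusV.
apply: lt_le_trans; rewrite -addrA ltrDl subr_gt0 -mulrA ltr_pM2l // -mulrA gtr_pMr ?modulus_gt0 //.
by rewrite mulrC ltr_pdivrMr ?modulus_gt0 // mul1r.
Qed.

(** By compactness the modulus has a maximum on T, which is not an interior point
    since the modulus increases somewhere near any given point. *)
Lemma poly_max_principle p T B x : closed T -> (forall z, T z -> modulus z <= B) ->
  T x -> exists2 y, T y /\ ~ T° y & modulus p.[x] <= modulus p.[y].
Proof.
move=> cT TB Tx.
have nonconst q : (1 < size q)%N -> exists2 y, T y /\ ~ T° y & modulus q.[x] <= modulus q.[y].
  move=> sq; have cq : continuous (@modulus R \o horner q).
    by move=> z; apply: continuous_comp; [exact: horner_continuous | exact: modulus_continuous].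
  have [y Ty yM] := compact_argmax cq (compact_modulus cT TB) (ex_intro _ x Tx).
  exists y; last exact: yM.
  split=> // /nbhs_modulus[e e0 eT].
  have [z zy] := poly_modulus_increases y sq e0.
  by rewrite ltNge; have /= -> := yM z (eT z zy).
have [/size1_polyC ->|] := leqP (size p) 1; last exact: nonconst.
(* For constant p it remains to find some frontier point, and the maximum of
   the modulus of the identity is one. *)
have [|y Ty _] := nonconst 'X; first by rewrite size_polyX.
by exists y => //; rewrite !hornerC.
Qed.

(** The form of holomorphy used below: it gives the maximum principle without
    Cauchy's theory, and it passes to iterates. *)
Definition poly_approximable (f : R[i] -> R[i]) := forall r e : R, 0 < e ->
  exists p, forall z, modulus z <= r -> modulus (f z - p.[z]) <= e.

Lemma closed_frontier T : closed T -> closed [set y | T y /\ ~ T° y].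
Proof.
move=> cT; have -> : [set y | T y /\ ~ T° y] = T `&` ~` T° by [].
by apply: closedI => //; apply: open_closedC; exact: open_interior.
Qed.

Lemma max_principle f T B x : poly_approximable f -> continuous f ->
  closed T -> (forall z, T z -> modulus z <= B) ->
  T x -> exists2 y, T y /\ ~ T° y & modulus (f x) <= modulus (f y).
Proof.
move=> fA cf cT TB Tx.
have cmf : continuous (@modulus R \o f).
  by move=> z; apply: continuous_comp; [exact: cf | exact: modulus_continuous].
have [y0 y0T _] := poly_max_principle 0 cT TB Tx.
have cF : compact [set y | T y /\ ~ T° y].
  by apply: (@compact_modulus _ _ B); [exact: closed_frontier | move=> z [/TB]].
have [y yT yM] := compact_argmax cmf cF (ex_intro _ _ y0T).
exists y => //; rewrite leNgt; apply/negP => lt.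
(* A polynomial within a third of the gap would violate its own maximum
   principle. *)
pose e := (modulus (f x) - modulus (f y)) / 3.
have e0 : 0 < e by rewrite /e; lra.
have [p pf] := fA B e e0.
have [z zT pz] := poly_max_principle p cT TB Tx.
have h1 := pf _ (TB _ Tx); have h2 := pf _ (TB _ zT.1).
have h3 := yM _ zT; rewrite /= in h3.
have h4 := modulusB (f x) p.[x]; have h5 := modulusB p.[z] (f z).
rewrite modulusC in h5; rewrite /e in h1 h2; lra.
Qed.

Definition locally_lipschitz (f : R[i] -> R[i]) := forall r : R, exists K : R,
  forall z w, modulus z <= r -> modulus w <= r ->
  modulus (f z - f w) <= K * modulus (z - w).

Lemma lipschitz_continuous f : locally_lipschitz f -> continuous f.
Proof.
move=> Lf x; apply/(@cvg_modulusP _ _ (nbhs x)) => e e0.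
have [K HK] := Lf (modulus x + 1).
have K1 : 0 < `|K| + 1 by rewrite ltr_wpDl.
apply/nbhs_modulus; exists (Num.min 1 (e / (`|K| + 1))) => [|y].
  by rewrite lt_min ltr01 divr_gt0.
rewrite lt_min ltr_pdivlMr // => /andP[y1 ye].
have := modulusB y x => h.
apply: le_lt_trans (HK _ _ _ _) _; [lra|lra|].
apply: le_lt_trans ye; rewrite mulrC; apply: ler_wpM2l; first exact: modulus_ge0.
by have := ler_norm K; lra.
Qed.

Lemma poly_approximable_comp f g : poly_approximable f -> locally_lipschitz f ->
  poly_approximable g -> poly_approximable (f \o g).
Proof.
move=> fA fL gA r e e0.
have [q1 q1g] := gA r 1 ltr01.
have [B gB] : exists B, forall z, modulus z <= r -> modulus (g z) <= B.
  have cq : continuous (@modulus R \o horner q1).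
    by move=> z; apply: continuous_comp; [exact: horner_continuous | exact: modulus_continuous].
  have [r0|r0] := leP 0 r; last first.
    by exists 0 => z zr; have := modulus_ge0 z; lra.
  have cD : compact [set z : R[i] | modulus z <= r].
    apply: (@compact_modulus _ _ r) => //.
    rewrite (_ : [set _ | _] = @modulus R @^-1` [set t | t <= r]) //.
    by apply: closed_comp => [z _|]; [exact: modulus_continuous | exact: closed_le].
  have [|y _ yM] := compact_argmax cq cD; first by exists 0; rewrite /= modulus0.
  exists (modulus q1.[y] + 1) => z zr; have := q1g z zr; have := modulusB (g z) q1.[z].
  by have /= := yM z zr; lra.
have [K HK] := fL (B + 1).
have [p pf] := fA (B + 1) (e / 2) (divr_gt0 e0 (ltr0Sn _ 1)).
have K1 : 0 < `|K| + 1 by rewrite ltr_wpDl.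
pose d := Num.min 1 (e / 2 / (`|K| + 1)).
have d0 : 0 < d by rewrite lt_min ltr01 !divr_gt0.
have [q qg] := gA r d d0.
exists (p \Po q) => z zr; rewrite horner_comp /=.
have := qg z zr; rewrite {1}/d le_min ler_pdivlMr // => /andP[h1 h2].
have gz := gB z zr; have h3 := modulusB q.[z] (g z); rewrite modulusC in h3.
have qz : modulus q.[z] <= B + 1 by lra.
have := pf _ qz; have := HK _ _ (_ : modulus (g z) <= B + 1) qz.
have -> : f (g z) - p.[q.[z]] = (f (g z) - f q.[z]) + (f q.[z] - p.[q.[z]]) by ring.
move=> /(_ ltac:(lra)) h4 h5; apply: le_trans (modulusD _ _) _.
have : K * modulus (g z - q.[z]) <= modulus (g z - q.[z]) * (`|K| + 1).
  by rewrite mulrC; apply: ler_wpM2l; [exact: modulus_ge0 | have := ler_norm K; lra].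
lra.
Qed.

End MaximumPrinciple.

(** * Regions of a square grid *)

Section Grid.
(* The grid has mesh d and lower left corner - B - B i; its lines are numbered
   from there. *)
Variables (R : realType) (B d : R).
Hypothesis d0 : 0 < d.
Implicit Types (x y z : R[i]) (W : nat -> nat -> bool).

Definition coord (k : nat) : R := k%:R * d - B.

Definition vertex (u : nat * nat) : R[i] := (coord u.1 +i* coord u.2)%C.

Definition between (k : nat) (t : R) := coord k <= t <= coord k.+1.

Definition cell i j : set R[i] := [set z | between i (complex.Re z) /\ between j (complex.Im z)].

Definition hseg i j : set R[i] := [set z | between i (complex.Re z) /\ complex.Im z = coord j].

Definition vseg i j : set R[i] := [set z | complex.Re z = coord i /\ between j (complex.Im z)].

Lemma coordS k : coord k.+1 = coord k + d.
Proof. by rewrite /coord -natr1; ring. Qed.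

Lemma coord_lt a b : (coord a < coord b) = (a < b)%N.
Proof. by rewrite /coord ltrD2r ltr_pM2r // ltr_nat. Qed.

Lemma coord_le a b : (coord a <= coord b) = (a <= b)%N.
Proof. by rewrite /coord lerD2r ler_pM2r // ler_nat. Qed.

Lemma coord_floor t : - B <= t -> exists a, coord a <= t < coord a.+1.
Proof.
move=> Bt; have h : 0 <= (t + B) / d by apply: divr_ge0; [lra|exact: ltW].
exists (Num.truncn ((t + B) / d)); have /andP[h1 h2] := truncn_itv h.
by rewrite /coord; move: h1 h2; rewrite ler_pdivlMr // ltr_pdivrMr // => h1 h2; apply/andP; split; lra.
Qed.

Lemma between_near t : exists2 e : R, 0 < e &
  forall s a, `|s - t| < e -> between a s -> between a t.
Proof.
have [Bt|tB] := leP (- B) t; last first.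
  exists (- B - t); first by rewrite subr_gt0.
  move=> s a st /andP[+ _]; have : - B <= coord a by rewrite /coord lerDr mulr_ge0 // ltW.
  have := ler_norm (s - t); lra.
have [i /andP[it ti]] := coord_floor Bt.
have [ti'|it'] := leP t (coord i).
  have tE : t = coord i by lra.
  exists d => // s a; rewrite ltr_norml => /andP[h1 h2] /andP[h3 h4].
  have ai : (a < i.+1)%N by rewrite -coord_lt coordS; lra.
  have ia : (i < a.+2)%N by rewrite -coord_lt !coordS; rewrite coordS in h4; lra.
  by rewrite /between tE !coord_le; lia.
exists (Num.min (t - coord i) (coord i.+1 - t)); first by rewrite lt_min !subr_gt0 it' ti.
move=> s a; rewrite lt_min !ltr_norml => /andP[/andP[h1 h2] /andP[h1' h2']] /andP[h3 h4].
have ai : (a < i.+1)%N by rewrite -coord_lt; lra.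
have ia : (i < a.+1)%N by rewrite -coord_lt; lra.
have -> : a = i by lia.
by rewrite /between it ltW.
Qed.

(** The closed cells form a locally finite family. *)
Lemma cell_near x : exists2 e : R, 0 < e &
  forall y i j, modulus (y - x) < e -> cell i j y -> cell i j x.
Proof.
have [e1 e10 h1] := between_near (complex.Re x).
have [e2 e20 h2] := between_near (complex.Im x).
exists (Num.min e1 e2); first by rewrite lt_min e10.
move=> y i j; rewrite lt_min => /andP[y1 y2] [c1 c2]; split.
  by apply: h1 c1; rewrite -raddfB; apply: le_lt_trans (modulus_Re _) y1.
by apply: h2 c2; rewrite -raddfB; apply: le_lt_trans (modulus_Im _) y2.
Qed.

Definition region W : set R[i] := [set z | exists i j, W i j /\ cell i j z].

Lemma closed_region W : closed (region W).
Proof.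
rewrite -[region W]setCK; apply: open_closedC; apply/open_modulusP => x xW.
have [e e0 h] := cell_near x; exists e => // y yx [i [j [Wij cy]]].
by apply: xW; exists i, j; split => //; exact: h cy.
Qed.

Lemma region_bounded n W : 0 <= B -> (forall i j, W i j -> (i < n)%N /\ (j < n)%N) ->
  forall z, region W z -> modulus z <= 2 * (n%:R * d + B).
Proof.
move=> B0 Wn z [i [j [/Wn[ltin ltjn] [/andP[h1 h2] /andP[h3 h4]]]]].
apply: le_trans (modulus_ReIm z) _.
have cn k : (k < n)%N -> coord k.+1 <= n%:R * d - B by rewrite -coord_le.
have c0 k : - B <= coord k by rewrite /coord lerDr mulr_ge0 // ltW.
have nd : 0 <= n%:R * d by rewrite mulr_ge0 // ltW.
have := c0 i; have := c0 j; have := cn _ ltin; have := cn _ ltjn => *.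
have : `|complex.Re z| <= n%:R * d + B by rewrite ler_norml; apply/andP; split; lra.
have : `|complex.Im z| <= n%:R * d + B by rewrite ler_norml; apply/andP; split; lra.
lra.
Qed.

Lemma between_next a b t : between a t -> between b t -> (a < b)%N ->
  b = a.+1 /\ t = coord b.
Proof.
move=> /andP[h1 h2] /andP[h3 h4] ab.
have : (b <= a.+1)%N by rewrite -coord_le; lra.
move=> ba; have bE : b = a.+1 by lia.
by split=> //; rewrite bE; rewrite bE in h3; lra.
Qed.

Definition untouched W x :=
  (forall i j, hseg i j.+1 x -> W i j.+1 = W i j) /\
  (forall i j, vseg i.+1 j x -> W i.+1 j = W i j).

(** Cells that share x are joined by crossing segments through x. *)
Lemma untouched_cells W x i j i' j' : untouched W x ->
  cell i j x -> cell i' j' x -> W i j = W i' j'.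
Proof.
move=> [Uh Uv] [c1 c2] [c1' c2'].
have H a b k : between a (complex.Re x) -> between b (complex.Re x) ->
    between k (complex.Im x) -> (a < b)%N -> W b k = W a k.
  move=> h1 h2 h3 ab; have [bE xE] := between_next h1 h2 ab.
  by rewrite bE; apply: Uv; split; rewrite // xE bE.
have V a b k : between a (complex.Im x) -> between b (complex.Im x) ->
    between k (complex.Re x) -> (a < b)%N -> W k b = W k a.
  move=> h1 h2 h3 ab; have [bE xE] := between_next h1 h2 ab.
  by rewrite bE; apply: Uh; split; rewrite // xE bE.
transitivity (W i' j).
  by case: (ltngtP i i') => [lt|lt|-> //]; [rewrite (H _ _ j c1 c1') | rewrite (H _ _ j c1' c1)].
by case: (ltngtP j j') => [lt|lt|-> //]; [rewrite (V _ _ i' c2 c2') | rewrite (V _ _ i' c2' c2)].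
Qed.

Lemma cell_exists x : - B <= complex.Re x -> - B <= complex.Im x ->
  exists i j, cell i j x.
Proof.
move=> /coord_floor[i /andP[h1 h2]] /coord_floor[j /andP[h3 h4]]; exists i, j.
by split; rewrite /between ?h1 ?h3 ltW.
Qed.

Lemma region_interior W x : (forall k, W k 0 = false /\ W 0 k = false) ->
  untouched W x -> region W x -> (region W)° x.
Proof.
move=> W0 U [i [j [Wij cx]]]; apply/nbhs_modulus.
have [e e0 h] := cell_near x; exists (Num.min e d); first by rewrite lt_min e0.
move=> y; rewrite lt_min => /andP[ye yd].
have pos k : (0 < k)%N -> d - B <= coord k.
  by move=> k0; rewrite /coord lerD2r ler_pMl // ler1n.
have i0 : (0 < i)%N by case: i Wij {cx}; rewrite // (W0 j).2.
have j0 : (0 < j)%N by case: j Wij {cx}; rewrite // (W0 i).1.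
have [/andP[c1 _] /andP[c2 _]] := cx.
have /ltr_normlP[r1 r2] := le_lt_trans (modulus_Re (y - x)) yd.
have /ltr_normlP[r3 r4] := le_lt_trans (modulus_Im (y - x)) yd.
have := pos _ i0; have := pos _ j0; rewrite !raddfB /= in r1 r2 r3 r4 => p1 p2.
have [||a [b cy]] := @cell_exists y; [lra|lra|].
by exists a, b; split => //; rewrite -(untouched_cells U cx (h _ _ _ ye cy)).
Qed.

(** Empty margins matter: a cell at the lower or left border of the grid would
    have a side that is not counted as a segment with index at least one. *)
Lemma region_frontier W x : (forall k, W k 0 = false /\ W 0 k = false) ->
  region W x -> ~ (region W)° x ->
  (exists i j, hseg i j.+1 x /\ W i j.+1 <> W i j) \/
  (exists i j, vseg i.+1 j x /\ W i.+1 j <> W i j).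
Proof.
move=> W0 xW; apply: contra_notP => /not_orP[/forallNP Nh /forallNP Nv].
apply: region_interior => //; split=> i j Sx; apply: contrapT => Wn.
  by have /forallNP/(_ j) := Nh i; apply.
by have /forallNP/(_ j) := Nv i; apply.
Qed.

End Grid.

(** The set O has no holes. The formulation by frontiers is what the maximum
    principle yields and what grid regions can use. *)
Definition filled (R : realType) (O : set R[i]) := forall (T : set R[i]) (b : R),
  closed T -> (forall z, T z -> modulus z <= b) ->
  (forall x, T x -> ~ T° x -> O x) -> T `<=` O.

(** * Separating two points inside one piece of a boundary *)

Section Separation.
Variable R : realType.
Implicit Types (x y z a p q : R[i]) (T X K : set R[i]).

(** Compactness makes the local scales uniform, as P passes to smaller scales. *)
Lemma lebesgue_number K (P : R -> R[i] -> Prop) : compact K ->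
  (forall e e' x, e <= e' -> P e' x -> P e x) ->
  (forall x, K x -> exists2 r : R, 0 < r & forall y, modulus (y - x) < r -> P r y) ->
  exists2 e : R, 0 < e & forall x, K x -> P e x.
Proof.
move=> /compact_near_coveringP cK Pdec Ploc.
have : \forall e \near (0 : R)^'+, K `<=` P e.
  apply: cK => x /Ploc[r r0 Pr].
  exists ([set y | modulus (y - x) < r], [set e : R | e < r]) => /=.
    split; first by apply/nbhs_modulus; exists r.
    exact: nbhs_right_lt.
  by move=> [y e] [/= yx er]; apply: Pdec (ltW er) _; exact: Pr.
move=> H; have : \forall e \near (0 : R)^'+, 0 < e /\ K `<=` P e.
  by near=> e; split; [by [] | near: e].
by move=> /filter_ex[e [e0 Ke]]; exists e.
Unshelve. all: by end_near. Qed.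

Definition segment p q : set R[i] := [set p + t%:C%C * (q - p) | t in `[0, 1]].

Lemma segment_left p q : segment p q p.
Proof. by exists 0; rewrite ?mul0r ?addr0 //= in_itv /= lexx ler01. Qed.

Lemma segment_right p q : segment p q q.
Proof. by exists 1; rewrite ?mul1r ?subrKC //= in_itv /= lexx ler01. Qed.

Lemma real_complex_continuous : continuous (fun t : R => t%:C%C).
Proof.
move=> t; apply/(@cvg_modulusP _ _ (nbhs t)) => e e0.
apply/nbhs_ballP; exists e => // s; rewrite /ball /= distrC -rmorphB /= modulus_real.
by [].
Qed.

Lemma segment_path_continuous p q : continuous (fun t : R => p + t%:C%C * (q - p)).
Proof.
move=> t; apply: (@continuousD _ R[i] R (cst p) (fun t : R => t%:C%C * (q - p))).
  exact: cst_continuous.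
apply: (@continuousM _ R (fun t : R => t%:C%C) (cst (q - p))).
  exact: real_complex_continuous.
exact: cst_continuous.
Qed.

Lemma connected_segment p q : connected (segment p q).
Proof.
apply: connected_continuous_connected; first exact: segment_connected.
exact/continuous_subspaceT/segment_path_continuous.
Qed.

Lemma compact_segment p q : compact (segment p q).
Proof.
apply: continuous_compact; last exact: segment_compact.
exact/continuous_subspaceT/segment_path_continuous.
Qed.

Lemma segmentE p q x : segment p q x -> exists2 t : R, 0 <= t <= 1 &
  complex.Re x = complex.Re p + t * (complex.Re q - complex.Re p) /\
  complex.Im x = complex.Im p + t * (complex.Im q - complex.Im p).
Proof.
move=> [t /=]; rewrite in_itv /= => t01 <-; exists t => //.
by case: p q => [a b] [c d] /=; split; ring.
Qed.

Lemma connected_open_split (C A B : set R[i]) x y : connected C -> open A -> open B ->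
  A `&` B = set0 -> C `<=` A `|` B -> C x -> C y -> A x -> A y.
Proof.
move=> cC oA oB AB CAB Cx Cy Ax.
have E : C `&` A = C.
  apply: cC; first by exists x.
    by exists A.
  exists (~` B); first exact: open_closedC.
  apply/seteqP; split=> z [Cz H]; split=> //.
    by move=> Bz; have : (A `&` B) z by []; rewrite AB.
  by case: (CAB z Cz).
by move: Cy; rewrite -{1}E => -[].
Qed.

Lemma connected_boundary (C X : set R[i]) x y : connected C -> C x -> C y -> X x -> ~ X y ->
  exists2 z, C z & boundary X z.
Proof.
move=> cC Cx Cy Xx Xy; apply: contrapT => H.
have nb z : C z -> ~ boundary X z by move=> Cz bz; apply: H; exists z.
have Xx' : X° x.
  by apply: contrapT => nX; apply: (nb x Cx); split=> //; exact: subset_closure.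
suff : X° y by move/interior_subset.
apply: (@connected_open_split C (X°) (~` closure X) x) => //.
- exact: open_interior.
- by apply: closed_openC; exact: closed_closure.
- apply/seteqP; split=> // z [/interior_subset Xz]; apply; exact: subset_closure.
- move=> z Cz; have [Xz|nX] := pselect (X° z); first by left.
  by right=> cz; exact: (nb z Cz (conj cz nX)).
Qed.

Lemma modulus_bounded_closure X (b : R) : (forall z, X z -> modulus z <= b) ->
  forall z, closure X z -> modulus z <= b.
Proof.
move=> Xb z cz; rewrite leNgt; apply/negP => bz.
have /closure_modulusP/(_ (modulus z - b)) := cz; rewrite subr_gt0 => /(_ bz)[y Xy].
have := modulusB z y; have := Xb _ Xy; rewrite (modulusC z y); lra.
Qed.

Lemma compact_boundary X (b : R) : (forall z, X z -> modulus z <= b) -> compact (boundary X).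
Proof.
move=> Xb; apply: (@compact_modulus _ _ b).
  apply: closedI; first exact: closed_closure.
  by apply: open_closedC; exact: open_interior.
by move=> z [cz _]; exact: (modulus_bounded_closure Xb cz).
Qed.

Definition separates X a1 a2 := (a1 \in X) != (a2 \in X).

(** Colour the vertices of a fine grid by membership in X, and give each cell the
    colour of its lower left vertex. The sides between cells of different
    colour are close to the boundary of X, so each lies in Y0 or in Y1, and
    those with a common end lie in the same one. Hence the sides in Y0 are even
    at each vertex, and their winding parity W0 defines a region with frontier
    in Y0; the symmetric difference W1 of W0 and the colouring has its frontier
    in Y1. As a1 and a2 avoid Y0 and Y1, membership in X is the sum mod 2 of
    membership in the two regions there, so one of them separates a1 from a2. *)
Lemma separate_two X (Y0 Y1 : set R[i]) (b : R) a1 a2 :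
  (forall z, X z -> modulus z <= b) ->
  open Y0 -> open Y1 -> Y0 `&` Y1 = set0 -> boundary X `<=` Y0 `|` Y1 ->
  ~ (Y0 `|` Y1) a1 -> ~ (Y0 `|` Y1) a2 -> separates X a1 a2 ->
  exists T (b' : R), [/\ closed T, forall z, T z -> modulus z <= b',
    (forall x, T x -> ~ T° x -> Y0 x) \/ (forall x, T x -> ~ T° x -> Y1 x)
    & separates T a1 a2].
Proof.
move=> Xb oY0 oY1 Y01 bdX a1Y a2Y sepX.
have [e e0 He] : exists2 e : R, 0 < e & forall x, boundary X x ->
    (forall y, modulus (y - x) < e -> Y0 y) \/ (forall y, modulus (y - x) < e -> Y1 y).
  apply: lebesgue_number; first exact: compact_boundary Xb.
    by move=> r r' x rr [] H; [left|right] => y yx; apply: H; exact: lt_le_trans rr.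
  have loc Y x : open Y -> Y x -> exists2 r : R, 0 < r & forall y, modulus (y - x) < r ->
      forall z, modulus (z - y) < r -> Y z.
    move=> /open_modulusP oY /oY[r r0 rY]; exists (r / 2); first by lra.
    move=> y yx z zy; apply: rY; have -> : z - x = (z - y) + (y - x) by ring.
    by apply: le_lt_trans (modulusD _ _) _; lra.
  move=> x /bdX[] Yx.
    by have [r r0 H] := loc _ _ oY0 Yx; exists r => // y /H; left.
  by have [r r0 H] := loc _ _ oY1 Yx; exists r => // y /H; right.
(* With mesh e / 8, the union of two neighbouring cells is within e of any of its
   points; the summand 3 d in B keeps the border cells of the grid white. *)
pose d := e / 8; have d0 : 0 < d by rewrite divr_gt0.
pose B := `|b| + modulus a1 + modulus a2 + 3 * d.
have [ma1 ma2] := (modulus_ge0 a1, modulus_ge0 a2).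
have bb := ler_norm b.
have B0 : 0 <= B by rewrite /B; have := normr_ge0 b; lra.
pose black i j := `[< X (vertex B d (i, j)) >].
pose n := (Num.truncn ((B + `|b|) / d)).+2.
have black_lt i j : black i j -> ((2 < i)%N /\ (i.+1 < n)%N) /\ ((2 < j)%N /\ (j.+1 < n)%N).
  move=> /asboolP /Xb h.
  have H k : `|coord B d k| <= b -> (2 < k)%N /\ (k.+1 < n)%N.
    rewrite ler_norml => /andP[h1 h2]; split.
      rewrite -(ltr_nat R); move: h1; rewrite /coord /B => h1.
      by rewrite -(ltr_pM2r d0); lra.
    rewrite /n !ltnS truncn_ge_nat; last by apply: divr_ge0; [have := normr_ge0 b; lra | exact: ltW].
    by rewrite ler_pdivlMr //; move: h2; rewrite /coord; lra.
  by split; apply: H; apply: le_trans h; [exact: (modulus_Re (vertex B d (i, j))) | exact: (modulus_Im (vertex B d (i, j)))].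
have black_near p q : complex.Re p - d <= complex.Re q <= complex.Re p + d ->
    complex.Im p - d <= complex.Im q <= complex.Im p + d -> `[< X p >] != `[< X q >] ->
    exists2 x, boundary X x &
      forall z, complex.Re p - d <= complex.Re z <= complex.Re p + d ->
        complex.Im p - d <= complex.Im z <= complex.Im p + d -> modulus (z - x) < e.
  move=> Rq Iq pq; have [x xpq bx] : exists2 x, segment p q x & boundary X x.
    move: pq; case: asboolP => [Xp|nXp]; case: asboolP => [Xq|nXq] // _.
      exact: (connected_boundary (@connected_segment p q) (segment_left _ _) (segment_right _ _) Xp).
    exact: (connected_boundary (@connected_segment p q) (segment_right _ _) (segment_left _ _) Xq).
  exists x => // z Rz Iz; have [t t01 [xR xI]] := segmentE xpq.
  apply: le_lt_trans (modulus_ReIm _) _.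
  have -> : complex.Re (z - x) = complex.Re z - complex.Re p - t * (complex.Re q - complex.Re p).
    by rewrite raddfB /= xR; ring.
  have -> : complex.Im (z - x) = complex.Im z - complex.Im p - t * (complex.Im q - complex.Im p).
    by rewrite raddfB /= xI; ring.
  have h1 : `|t * (complex.Re q - complex.Re p)| <= d.
    by rewrite ler_norml; case/andP: t01 => *; case/andP: Rq => *; apply/andP; split; nra.
  have h2 : `|t * (complex.Im q - complex.Im p)| <= d.
    by rewrite ler_norml; case/andP: t01 => *; case/andP: Iq => *; apply/andP; split; nra.
  have h3 : `|complex.Re z - complex.Re p| <= d by rewrite ler_distl.
  have h4 : `|complex.Im z - complex.Im p| <= d by rewrite ler_distl.
  have := ler_normB (complex.Re z - complex.Re p) (t * (complex.Re q - complex.Re p)).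
  have := ler_normB (complex.Im z - complex.Im p) (t * (complex.Im q - complex.Im p)).
  rewrite /d in h1 h2 h3 h4; lra.
pose Sh i j := if j is k.+1 then black i k != black i k.+1 else false.
pose Sv i j := if i is k.+1 then black k j != black k.+1 j else false.
have nearY (S : set R[i]) p q :
    complex.Re p - d <= complex.Re q <= complex.Re p + d ->
    complex.Im p - d <= complex.Im q <= complex.Im p + d ->
    `[< X p >] != `[< X q >] ->
    (forall z, S z -> complex.Re p - d <= complex.Re z <= complex.Re p + d /\
        complex.Im p - d <= complex.Im z <= complex.Im p + d) ->
    S `<=` Y0 \/ S `<=` Y1.
  move=> Rq Iq pq HS; have [x bx H] := black_near _ _ Rq Iq pq.
  by case: (He x bx) => HY; [left|right] => z Sz; apply: HY; case: (HS z Sz); exact: H.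
have cS k : coord B d k.+1 = coord B d k + d := coordS B d k.
have d2 := ltW d0.
have hsegY i j : Sh i j -> hseg B d i j `<=` Y0 \/ hseg B d i j `<=` Y1.
  case: j => //= j; rewrite /black eq_sym => bij; apply: nearY bij _ => /=; rewrite ?cS.
  - by apply/andP; split; lra.
  - by apply/andP; split; lra.
  - by move=> z [/andP[z1 z2]]; rewrite cS in z2; rewrite cS => ->; split; apply/andP; split; lra.
have vsegY i j : Sv i j -> vseg B d i j `<=` Y0 \/ vseg B d i j `<=` Y1.
  case: i => //= i; rewrite /black eq_sym => bij; apply: nearY bij _ => /=; rewrite ?cS.
  - by apply/andP; split; lra.
  - by apply/andP; split; lra.
  - by move=> z [+ /andP[z1 z2]]; rewrite cS in z2; rewrite cS => ->; split; apply/andP; split; lra.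
have disj z : Y0 z -> Y1 z -> False.
  by move=> z0 z1; have : (Y0 `&` Y1) z by []; rewrite Y01.
have hL i j : hseg B d i j (vertex B d (i, j)).
  by split=> //; rewrite /between /= cS; apply/andP; split; lra.
have hR i j : hseg B d i j (vertex B d (i.+1, j)).
  by split=> //; rewrite /between /= cS; apply/andP; split; lra.
have vD i j : vseg B d i j (vertex B d (i, j)).
  by split=> //; rewrite /between /= cS; apply/andP; split; lra.
have vU i j : vseg B d i j (vertex B d (i, j.+1)).
  by split=> //; rewrite /between /= cS; apply/andP; split; lra.
pose side u := `[< Y0 (vertex B d u) >].
have hside i j : Sh i j -> side (i, j) = side (i.+1, j).
  move=> /hsegY[] H; apply/asboolP/asboolP => // y0; first exact/H/hR.
  - exact/H/hL.
  - by case: (disj _ y0); exact/H/hL.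
  - by case: (disj _ y0); exact/H/hR.
have vside i j : Sv i j -> side (i, j) = side (i, j.+1).
  move=> /vsegY[] H; apply/asboolP/asboolP => // y0; first exact/H/vU.
  - exact/H/vD.
  - by case: (disj _ y0); exact/H/vD.
  - by case: (disj _ y0); exact/H/vU.
pose Th i j := Sh i j && side (i, j).
pose Tv i j := Sv i j && side (i, j).
have black0 k : black k 0%N = false /\ black 0%N k = false.
  by split; apply/negP => /black_lt[[? _] [? _]].
have Sh0 i : Sh i 0%N = false by [].
have Sv0 i : Sv i 0%N = false by case: i => //= i; rewrite !(black0 _).1.
have Sh0' j : Sh 0%N j = false by case: j => //= j; rewrite !(black0 _).2.
have Sv0' j : Sv 0%N j = false by [].
have Tmar : margin Th Tv by move=> k; rewrite /Th /Tv Sh0 Sv0 Sh0' Sv0'.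
have Tconf : confined n Th Tv.
  move=> i j; split=> /andP[+ _].
    case: j => //= j; case b1 : (black i j); case b2 : (black i j.+1) => // _.
      by have [[_ h1] [_ h2]] := black_lt _ _ b1; split => //; exact: ltnW.
    by have [[_ h1] [_ h2]] := black_lt _ _ b2; split => //; exact: ltnW.
  case: i => //= i; case b1 : (black i j); case b2 : (black i.+1 j) => // _.
    by have [[_ h1] [_ h2]] := black_lt _ _ b1; split => //; exact: ltnW.
  by have [[_ h1] [_ h2]] := black_lt _ _ b2; split => //; exact: ltnW.
have even i j : Th i j.+1 (+) Th i.+1 j.+1 = Tv i.+1 j (+) Tv i.+1 j.+1.
  have -> : Th i j.+1 = Sh i j.+1 && side (i.+1, j.+1).
    by rewrite /Th; case Eh : (Sh i j.+1) => //=; rewrite (hside i j.+1 Eh).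
  have -> : Tv i.+1 j = Sv i.+1 j && side (i.+1, j.+1).
    by rewrite /Tv; case Ev : (Sv i.+1 j) => //=; rewrite (vside i.+1 j Ev).
  rewrite /Th /Tv; case: (side _); rewrite ?andbF // !andbT /=.
  by case: (black i j); case: (black i j.+1); case: (black i.+1 j); case: (black i.+1 j.+1).
pose W0 := winding Th.
have W0h i j : W0 i j.+1 = W0 i j (+) Th i j.+1 by exact: winding_up.
have W0v i j : W0 i.+1 j = W0 i j (+) Tv i.+1 j.
  by apply: winding_right => // k; rewrite /Th /Tv ?Sh0 ?Sv0.
have W0unc : uncrossed Th Tv W0.
  split; first by rewrite /W0 winding0 /Th Sh0.
    by move=> i j /negbTE E; rewrite W0h E addbF.
  by move=> i j /negbTE E; rewrite W0v E addbF.
have xor_split (p q s w : bool) :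
    q (+) (w (+) ((p != q) && s)) = p (+) w (+) ((p != q) && ~~ s).
  by case: p; case: q; case: s; case: w.
pose W1 i j := black i j (+) W0 i j.
have W1h i j : W1 i j.+1 = W1 i j (+) (Sh i j.+1 && ~~ side (i, j.+1)).
  by rewrite /W1 W0h; exact: xor_split.
have W1v i j : W1 i.+1 j = W1 i j (+) (Sv i.+1 j && ~~ side (i.+1, j)).
  by rewrite /W1 W0v; exact: xor_split.
have W0m k : W0 k 0%N = false /\ W0 0%N k = false by exact: (uncrossed_margin _ Tmar W0unc).
have W1m k : W1 k 0%N = false /\ W1 0%N k = false.
  by rewrite /W1 !(W0m k).1 !(W0m k).2 !(black0 k).1 !(black0 k).2.
have W0n i j : W0 i j -> (i < n)%N /\ (j < n)%N.
  exact: (uncrossed_bounded Tmar Tconf W0unc).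
have W1n i j : W1 i j -> (i < n)%N /\ (j < n)%N.
  rewrite /W1; case b1 : (black i j); first by have [[_ h1] [_ h2]] := black_lt _ _ b1; split => //; exact: ltnW.
  exact: W0n.
have hY0 i j x : Th i j -> hseg B d i j x -> Y0 x.
  move=> /andP[E /asboolP y0]; case: (hsegY _ _ E) => H; first exact: H.
  by case: (disj _ y0); exact/H/hL.
have vY0 i j x : Tv i j -> vseg B d i j x -> Y0 x.
  move=> /andP[E /asboolP y0]; case: (vsegY _ _ E) => H; first exact: H.
  by case: (disj _ y0); exact/H/vD.
have hY1 i j x : Sh i j && ~~ side (i, j) -> hseg B d i j x -> Y1 x.
  move=> /andP[E /asboolP y0]; case: (hsegY _ _ E) => H; last exact: H.
  by case: y0; exact/H/hL.
have vY1 i j x : Sv i j && ~~ side (i, j) -> vseg B d i j x -> Y1 x.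
  move=> /andP[E /asboolP y0]; case: (vsegY _ _ E) => H; last exact: H.
  by case: y0; exact/H/vD.
have fr0 x : region B d W0 x -> ~ (region B d W0)° x -> Y0 x.
  move=> r ri; case: (region_frontier d0 W0m r ri) => -[i [j [xs]]].
    by rewrite W0h; case E : (Th _ _); [by move=> _; exact: hY0 E xs | by rewrite addbF].
  by rewrite W0v; case E : (Tv _ _); [by move=> _; exact: vY0 E xs | by rewrite addbF].
have fr1 x : region B d W1 x -> ~ (region B d W1)° x -> Y1 x.
  move=> r ri; case: (region_frontier d0 W1m r ri) => -[i [j [xs]]].
    by rewrite W1h; case E : (_ && _); [by move=> _; exact: hY1 E xs | by rewrite addbF].
  by rewrite W1v; case E : (_ && _); [by move=> _; exact: vY1 E xs | by rewrite addbF].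
have memE a : modulus a <= modulus a1 + modulus a2 -> ~ (Y0 `|` Y1) a ->
    (a \in X) = (a \in region B d W0) (+) (a \in region B d W1).
  move=> ma aY.
  have /ler_normlP[ra1 ra2] := le_trans (modulus_Re a) ma.
  have /ler_normlP[ia1 ia2] := le_trans (modulus_Im a) ma.
  have nb := normr_ge0 b.
  have [||i [j ca]] := @cell_exists R B d d0 a; [by rewrite /B; lra|by rewrite /B; lra|].
  have U0 : untouched B d W0 a.
    split=> k l s.
      by rewrite W0h; case E : (Th _ _); rewrite ?addbF //; case: aY; left; exact: hY0 E s.
    by rewrite W0v; case E : (Tv _ _); rewrite ?addbF //; case: aY; left; exact: vY0 E s.
  have U1 : untouched B d W1 a.
    split=> k l s.
      by rewrite W1h; case E : (_ && _); rewrite ?addbF //; case: aY; right; exact: hY1 E s.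
    by rewrite W1v; case E : (_ && _); rewrite ?addbF //; case: aY; right; exact: vY1 E s.
  have reg W : untouched B d W a -> (a \in region B d W) = W i j.
    move=> U; apply/idP/idP => [/set_mem[k [l [Wkl ckl]]]|Wij].
      by rewrite (untouched_cells d0 U ca ckl).
    by apply/mem_set; exists i, j.
  rewrite (reg _ U0) (reg _ U1) /W1 addbC addbK.
  have -> : (a \in X) = `[< X a >] by apply/idP/asboolP => [/set_mem|/mem_set].
  apply/eqP; apply: contraT => ne; have [/andP[c1 c2] /andP[c3 c4]] := ca.
  rewrite !cS in c2 c4.
  have [||z ->|S|S] := nearY [set a] a (vertex B d (i, j)) _ _ ne _.
  - by apply/andP => /=; split; lra.
  - by apply/andP => /=; split; lra.
  - by split; apply/andP; split; lra.
  - by case: aY; left; exact: S.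
  - by case: aY; right; exact: S.
have sepW : separates (region B d W0) a1 a2 || separates (region B d W1) a1 a2.
  move: sepX; rewrite /separates !memE //; [|lra|lra].
  by do 4!case: (_ \in region _ _ _).
have bd (W : nat -> nat -> bool) : (forall i j, W i j -> (i < n)%N /\ (j < n)%N) ->
    forall z, region B d W z -> modulus z <= 2 * (n%:R * d + B).
  by move=> Wn; exact: (region_bounded d0 B0 Wn).
case/orP: sepW => sW.
  exists (region B d W0), (2 * (n%:R * d + B)); split=> //; first exact: closed_region.
    exact: bd.
  by left.
exists (region B d W1), (2 * (n%:R * d + B)); split=> //; first exact: closed_region.
  exact: bd.
by right.
Qed.

Lemma open_forall_lt (M : nat) (A : nat -> set R[i]) : (forall i, open (A i)) ->
  open [set x | forall i, (i < M)%N -> A i x].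
Proof.
move=> oA; elim: M => [|M IH].
  by rewrite (_ : [set _ | _] = setT); [exact: openT | apply/seteqP; split].
rewrite (_ : [set _ | _] = [set x | forall i, (i < M)%N -> A i x] `&` A M).
  exact: openI.
apply/seteqP; split=> [x H|x [H HM] i].
  by split=> [i iM|]; apply: H; rewrite // ltnS ltnW.
by rewrite ltnS leq_eqVlt => /orP[/eqP ->|/H].
Qed.

(** Induction on the number of open sets, splitting off the last one. No boundary
    point of X lies on the frontier of Z M, so the boundary is covered by Z M
    and the part Y1 of the union of the other sets outside the closure of Z M. If
    the separating T has its frontier in Y1, it replaces X for the other sets. *)
Lemma separate_many (M : nat) (Z : nat -> set R[i]) X (b : R) a1 a2 :
  (forall i, open (Z i)) -> (forall z, X z -> modulus z <= b) ->
  (forall x, boundary X x -> (exists2 i, (i < M)%N & Z i x) /\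
     (forall i, (i < M)%N -> Z i x \/ ~ closure (Z i) x)) ->
  (forall i, (i < M)%N -> ~ Z i a1 /\ ~ Z i a2) -> separates X a1 a2 ->
  exists i T (b' : R), [/\ (i < M)%N, closed T, forall z, T z -> modulus z <= b',
    forall x, T x -> ~ T° x -> Z i x & separates T a1 a2].
Proof.
move=> oZ; elim: M X b => [|M IH] X b Xb bdX aZ sX.
  have nb x : ~ boundary X x by move=> /bdX[[]].
  suff [x _ /nb] : exists2 x, segment a1 a2 x & boundary X x by [].
  move: sX; rewrite /separates; case: (boolP (a1 \in X)) => [/set_mem X1|/negP X1];
    case: (boolP (a2 \in X)) => [/set_mem X2|/negP X2] // _.
    apply: (connected_boundary (@connected_segment a1 a2) (segment_left _ _) (segment_right _ _) X1).
    by move=> /mem_set.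
  apply: (connected_boundary (@connected_segment a1 a2) (segment_right _ _) (segment_left _ _) X2).
  by move=> /mem_set.
pose Y1 : set R[i] := ~` closure (Z M) `&`
  ((\bigcup_(i in [set i | (i < M)%N]) Z i) `&` [set x | forall i, (i < M)%N -> (Z i `|` ~` closure (Z i)) x]).
have oC i : open (~` closure (Z i)) by apply: closed_openC; exact: closed_closure.
have oY1 : open Y1.
  apply: openI => //; apply: openI; first by apply: bigcup_open => i _; exact: oZ.
  by apply: open_forall_lt => i; exact: openU.
have disj : Z M `&` Y1 = set0.
  by apply/seteqP; split=> // x [ZM [+ _]]; apply; exact: subset_closure.
have bdY : boundary X `<=` Z M `|` Y1.
  move=> x /bdX[[i iM Zi] H]; have [|nZ] := pselect (Z M x); first by left.
  right; split; first by case: (H M (ltnSn M)).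
  split=> [|k kM]; last by apply: H; exact: leqW.
  exists i => //=; move: iM; rewrite ltnS leq_eqVlt => /orP[/eqP iM|//].
  by case: nZ; rewrite -iM.
have aY a : (forall i, (i < M.+1)%N -> ~ Z i a) -> ~ (Z M `|` Y1) a.
  by move=> H [/H|[_ [[i /= iM /H]]]]; [exact | move=> /(_ (leqW iM))].
have [||T [b' [cT Tb' fr sT]]] := separate_two Xb (oZ M) oY1 disj bdY _ _ sX.
- by apply: aY => i /aZ[].
- by apply: aY => i /aZ[].
case: fr => fr; first by exists M, T, b'.
have bT x : boundary T x -> Y1 x.
  by move=> [cx nx]; apply: fr => //; rewrite [T](closure_id T).1.
have [||i [T' [b'' [iM cT' Tb fr' sT']]]] := IH T b' Tb' _ _ sT.
- by move=> x /bT[_ [[i iM Zi] H]]; split=> //; exists i.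
- by move=> i iM; apply: aZ; exact: leqW.
by exists i, T', b''; split=> //; exact: leqW.
Qed.

End Separation.

(** * Homotopies made of rows *)

Section NullHomotopy.
Variable R : realType.
Implicit Types (x y z : R[i]) (A O : set R[i]).

Definition convex_set A := forall x y, A x -> A y -> segment x y `<=` A.

Lemma convex_ball c (e : R) : convex_set [set z | modulus (z - c) < e].
Proof.
move=> x y /= xe ye z [t /=]; rewrite in_itv /= => /andP[t0 t1] <- /=.
have -> : x + t%:C%C * (y - x) - c = (1 - t)%:C%C * (x - c) + t%:C%C * (y - c).
  by rewrite rmorphB /=; ring.
apply: le_lt_trans (modulusD _ _) _; rewrite !modulusM !modulus_real.
rewrite !ger0_norm ?subr_ge0 //.
have [->|t0'] := eqVneq t 0; first by rewrite mul0r addr0 subr0 mul1r.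
have tp : 0 < t by rewrite lt_def t0'.
have : t * modulus (y - c) < t * e by rewrite ltr_pM2l.
have : (1 - t) * modulus (x - c) <= (1 - t) * e by apply: ler_wpM2l; lra.
lra.
Qed.

Lemma convex_box a b c d : convex_set
  [set z : R[i] | a <= complex.Re z <= b /\ c <= complex.Im z <= d].
Proof.
move=> x y /= [/andP[x1 x2] /andP[x3 x4]] [/andP[y1 y2] /andP[y3 y4]] z /segmentE.
move=> [t /andP[t0 t1] [zR zI]] /=; rewrite zR zI.
by split; apply/andP; split; nra.
Qed.

(** Tent functions: sums of their integer translates interpolate linearly. *)
Definition hat (u : R) : R := Num.max 0 (1 - `|u|).

Lemma hat_continuous : continuous hat.
Proof.
move=> u; apply: (@continuous_max R R (cst 0) (fun u => 1 - `|u|)).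
  exact: cst_continuous.
apply: (@continuousB R R R (cst 1) (fun u => `|u|)); first exact: cst_continuous.
exact: norm_continuous.
Qed.

Lemma hat_sum (N k : nat) (x : nat -> R[i]) (u : R) : (k < N)%N ->
  k%:R <= u <= k.+1%:R ->
  \sum_(i < N.+1) (hat (u - i%:R))%:C%C * x i = x k + (u - k%:R)%:C%C * (x k.+1 - x k).
Proof.
move=> kN /andP[ku uk].
rewrite (bigD1 (Ordinal (ltnW kN : (k < N.+1)%N))) //= (bigD1 (Ordinal (kN : (k.+1 < N.+1)%N))) /=; last first.
  by rewrite -val_eqE /= gtn_eqF.
rewrite big1 ?addr0 => [|i /andP[]]; last first.
  rewrite -!val_eqE /= => ik ik1.
  suff -> : hat (u - i%:R) = 0 by rewrite mul0r.
  rewrite /hat; apply/max_idPl; rewrite subr_le0.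
  case: (ltngtP i k) ik ik1 => // [lt _ _|lt _ ne].
    have : i.+1%:R <= k%:R :> R by rewrite ler_nat.
    by rewrite -natr1 => h; apply: le_trans (ler_norm _); lra.
  have : k.+2%:R <= i%:R :> R by rewrite ler_nat ltn_neqAle eq_sym ne.
  by rewrite -natr1 -normrN => h; apply: le_trans (ler_norm _); lra.
have -> : hat (u - k%:R) = 1 - (u - k%:R).
  rewrite /hat ger0_norm ?subr_ge0 //; apply/max_idPr; rewrite -natr1 in uk; lra.
have -> : hat (u - k.+1%:R) = u - k%:R.
  rewrite /hat -normrN ger0_norm ?opprB ?subr_ge0 // -natr1.
  by rewrite (max_idPr _); [ring | rewrite -natr1 in uk; lra].
by rewrite !(rmorphB, rmorph1) /=; ring.
Qed.

Lemma hat_sum_segment (N k : nat) (x : nat -> R[i]) (u : R) : (k < N)%N ->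
  k%:R <= u <= k.+1%:R ->
  segment (x k) (x k.+1) (\sum_(i < N.+1) (hat (u - i%:R))%:C%C * x i).
Proof.
move=> kN ku; rewrite (hat_sum _ kN ku); exists (u - k%:R) => //=.
by rewrite in_itv /=; move: ku; rewrite -natr1; lra.
Qed.

Lemma hat_index (N : nat) (t : R) : (0 < N)%N -> 0 <= t <= 1 ->
  exists2 k, (k < N)%N & k%:R <= N%:R * t <= k.+1%:R.
Proof.
move=> N0 /andP[t0 t1].
have Nt : 0 <= N%:R * t by rewrite mulr_ge0.
have [/eqP tE|] := boolP (t == 1).
  exists N.-1; first by rewrite prednK.
  by rewrite tE mulr1 prednK // lexx ler_nat leq_pred.
move=> tn1; have {}t1 : t < 1 by rewrite lt_neqAle tn1.
exists (Num.truncn (N%:R * t)); have /andP[h1 h2] := truncn_itv Nt.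
  rewrite -(ltr_nat R); apply: le_lt_trans h1 _.
  by rewrite gtr_pMr // ltr0n.
by rewrite h1 ltW.
Qed.

Lemma within_continuous_sum (T : topologicalType) (D : set T) (N : nat) (f : nat -> T -> R[i]) :
  (forall i, {within D, continuous (f i)}) ->
  {within D, continuous (fun p : T => \sum_(i < N) f i p)}.
Proof.
move=> cf; elim: N => [|N IH].
  have -> : (fun p : T => \sum_(i < 0) f i p) = cst 0 by apply/funext => p; rewrite big_ord0.
  by apply: continuous_subspaceT => p; exact: cst_continuous.
have -> : (fun p : T => \sum_(i < N.+1) f i p) = (fun p : T => \sum_(i < N) f i p) + f N.
  by apply/funext => p; rewrite big_ord_recr.
by move=> p; apply: continuousD; [exact: IH | exact: cf].
Qed.

(** Consecutive rows are joined by linear interpolation. *)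
Lemma null_homotopic_rows O (N : nat) (r : nat -> R -> R[i]) c : (0 < N)%N ->
  (forall j, {within `[0, 1], continuous (r j)}) ->
  (forall j, (j <= N)%N -> r j 0 = r j 1) -> (forall s : R, 0 <= s <= 1 -> r N s = c) ->
  (forall j (s : R), (j < N)%N -> 0 <= s <= 1 -> segment (r j s) (r j.+1 s) `<=` O) ->
  null_homotopic O (r 0%N).
Proof.
move=> N0 rc r01 rN rO.
exists (fun p => \sum_(j < N.+1) (hat (N%:R * p.2 - j%:R))%:C%C * r j p.1), c; split.
- pose f j (p : R * R) := (hat (N%:R * p.2 - j%:R))%:C%C * r j p.1.
  suff cf j : {within `[0, 1] `*` `[0, 1], continuous (f j)} by exact: within_continuous_sum cf.
  have -> : f j = (fun p : R * R => (hat (N%:R * p.2 - j%:R))%:C%C) \* (fun p => r j p.1) by [].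
  move=> p; apply: continuousM.
    move: p; apply: continuous_subspaceT => p.
    apply: (@continuous_comp _ _ _ (fun p : R * R => hat (N%:R * p.2 - j%:R)) (fun t => t%:C%C)); last exact: real_complex_continuous.
    apply: (@continuous_comp _ _ _ (fun p : R * R => N%:R * p.2 - j%:R) hat); last exact: hat_continuous.
    apply: (@continuousB R R _ (fun p : R * R => N%:R * p.2) (cst j%:R)); last exact: cst_continuous.
    apply: (@continuousM R _ (cst N%:R) (fun p : R * R => p.2)); first exact: cst_continuous.
    exact: cvg_snd.
  move: p; apply/subspace_continuousP => -[s t] [/= s01 t01].
  have /subspace_continuousP/(_ s s01) /= rs := rc j.
  apply/cvg_modulusP => e e0.
  have /cvg_modulusP/(_ e e0) := rs.
  rewrite !near_withinE => H.
  have : \forall p \near (s, t), `[0, 1]%classic p.1 -> modulus (r j p.1 - r j s) < e.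
    exact: (@cvg_fst _ _ (nbhs s) (nbhs t) _ _ H).
  by apply: filterS => p Hp [/= p1 _]; exact: Hp.
- move=> _ [[s t] [/= s01 t01] <-] /=.
  rewrite in_itv /= in s01; rewrite in_itv /= in t01.
  have [k kN kt] := hat_index N0 t01.
  exact: (rO k s kN s01 _ (hat_sum_segment (fun j => r j s) kN kt)).
- move=> s; rewrite in_itv /= => s01; split.
    rewrite (bigD1 ord0) //= mulr0 subr0 big1 ?addr0 => [|[[|j] jN] //= _].
      by rewrite /hat normr0 subr0 max_r ?ler01 // mul1r.
    suff -> : hat (0 - j.+1%:R) = 0 by rewrite mul0r.
    rewrite /hat sub0r normrN ger0_norm //; apply/max_idPl.
    by rewrite subr_le0 ler1n.
  rewrite (bigD1 ord_max) //= mulr1 subrr big1 ?addr0 => [|[j jN] /= jne].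
    by rewrite /hat normr0 subr0 max_r ?ler01 // mul1r rN.
  suff -> : hat (N%:R - j%:R) = 0 by rewrite mul0r.
  have jN' : (j < N)%N.
    by rewrite ltn_neqAle -ltnS jN andbT; apply: contra jne => /eqP jE; exact/eqP/val_inj.
  rewrite /hat ger0_norm ?subr_ge0 ?ler_nat 1?ltnW //; apply/max_idPl.
  by rewrite subr_le0 lerBrDr nat1r ler_nat.
- by move=> t _; apply: eq_bigr => j _; rewrite /= r01 // -ltnS.
Qed.

Lemma uniformly_continuous_path (g : R -> R[i]) (e : R) :
  {within `[0, 1], continuous g} -> 0 < e ->
  exists2 r : R, 0 < r & forall s s' : R, 0 <= s <= 1 -> 0 <= s' <= 1 ->
    `|s' - s| < r -> modulus (g s' - g s) < e.
Proof.
move=> /subspace_continuousP cg e0.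
pose P (r s : R) := 0 <= s <= 1 -> forall s', 0 <= s' <= 1 -> `|s' - s| < r -> modulus (g s' - g s) < e.
have : \forall r \near (0 : R)^'+, `[0, 1] `<=` P r.
  have /compact_near_coveringP := @segment_compact R 0 1; apply => x x01.
  have /cvg_modulusP/(_ (e / 2)) := cg x x01; rewrite divr_gt0 // => /(_ isT).
  rewrite !near_withinE => /nbhs_ballP[r /= r0 Hr].
  have {}Hr s : `|s - x| < r -> 0 <= s <= 1 -> modulus (g s - g x) < e / 2.
    by move=> sx s01; apply: Hr; rewrite /ball /= ?in_itv //= distrC.
  exists (ball x (r / 2), [set t | t < r / 2]) => /=.
    by split; [apply: nbhsx_ballx; lra | apply: nbhs_right_lt; lra].
  move=> [s t] [/=]; rewrite /ball /= distrC => sx tr s01 s' s01' ss'.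
  have h1 : modulus (g s - g x) < e / 2 by apply: Hr => //; lra.
  have h2 : modulus (g s' - g x) < e / 2.
    apply: Hr => //; have := ler_normD (s' - s) (s - x).
    have -> : s' - s + (s - x) = s' - x by ring.
    by lra.
  have -> : g s' - g s = (g s' - g x) + (g x - g s) by ring.
  by apply: le_lt_trans (modulusD _ _) _; rewrite (modulusC (g x)); lra.
move=> H; have : \forall r \near (0 : R)^'+, 0 < r /\ `[0, 1] `<=` P r.
  by near=> r; split; [by [] | near: r].
move=> /filter_ex[r [r0 Pr]]; exists r => // s s' s01 s01'.
by apply: Pr; rewrite //= in_itv.
Unshelve. all: by end_near. Qed.

Lemma within_reparametrization (g : R -> R[i]) (c : R -> R) :
  {within `[0, 1], continuous g} -> continuous c ->
  (forall s : R, 0 <= s <= 1 -> 0 <= c s <= 1) ->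
  {within `[0, 1], continuous (g \o c)}.
Proof.
move=> /subspace_continuousP cg cc c01; apply/subspace_continuousP => s /= s01.
rewrite in_itv /= in s01.
apply/cvg_modulusP => e e0.
have cs01 : [set` `[0, 1]] (c s) by rewrite /= in_itv /= c01.
have /cvg_modulusP/(_ e e0) := cg (c s) cs01.
rewrite !near_withinE => H; have {}H := cc s _ H.
have {H} : \forall t \near s, [set` `[0, 1]] (c t) -> modulus (g (c t) - g (c s)) < e by exact: H.
apply: filterS => t Ht /=; rewrite in_itv /= => /c01 ct; apply: Ht.
by rewrite /= in_itv.
Qed.

Lemma path_bounded (g : R -> R[i]) : {within `[0, 1], continuous g} ->
  exists2 b : R, 0 <= b & forall s : R, 0 <= s <= 1 -> modulus (g s) <= b.
Proof.
move=> cg; have [|||s _ Hs] := @compact_EVT_max R R (@modulus R \o g) `[0, 1].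
- by exists 0; rewrite /= in_itv /= lexx ler01.
- exact: segment_compact.
- by move=> s; exact: (continuous_comp (cg s) (@modulus_continuous R (g s))).
exists (modulus (g s)); first exact: modulus_ge0.
by move=> t t01; apply: Hs; rewrite inE /= in_itv.
Qed.

Lemma polygonal_continuous (N : nat) (x : nat -> R[i]) :
  {within `[0, 1], continuous (fun s : R => \sum_(i < N.+1) (hat (N%:R * s - i%:R))%:C%C * x i)}.
Proof.
pose f i (s : R) := (hat (N%:R * s - i%:R))%:C%C * x i.
suff cf i : {within `[0, 1], continuous (f i)} by exact: within_continuous_sum cf.
apply: continuous_subspaceT => s.
apply: (@continuousM _ R (fun s : R => (hat (N%:R * s - i%:R))%:C%C) (cst (x i))); last exact: cst_continuous.
apply: (@continuous_comp _ _ _ (fun s : R => hat (N%:R * s - i%:R)) (fun t => t%:C%C)); last exact: real_complex_continuous.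
apply: (@continuous_comp _ _ _ (fun s : R => N%:R * s - i%:R) hat); last exact: hat_continuous.
apply: (@continuousB R R _ (fun s : R => N%:R * s) (cst i%:R)); last exact: cst_continuous.
by apply: (@continuousM R _ (cst N%:R) (fun s : R => s)); [exact: cst_continuous | exact: cvg_id].
Qed.

End NullHomotopy.

(** * Closed curves in a set without holes are null-homotopic *)

Section SimplyConnected.
Variable R : realType.
Implicit Types (x y z : R[i]) (A O : set R[i]).

Section Approximation.
(* O contains the e-neighbourhood of the closed curve g, whose modulus is at most
   b. The grid has mesh d = e / 16 and m lines; over a time step 1 / n the curve
   moves by less than d, and V s is a cell that contains g s. Points at most two
   meshes apart in each coordinate are within 4 d < e of each other, and the
   summand 3 d in B keeps the cells of the curve off the border of the grid. *)
Variables (O : set R[i]) (g : R -> R[i]) (e b : R) (m n : nat) (V : R -> nat * nat).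
Let d := e / 16.
Let B := b + 3 * d.
Hypothesis e0 : 0 < e.
Hypothesis b0 : 0 <= b.
Hypothesis n0 : (0 < n)%N.
Hypothesis gb : forall s : R, 0 <= s <= 1 -> modulus (g s) <= b.
Hypothesis gO : forall (s : R) z, 0 <= s <= 1 -> modulus (z - g s) < e -> O z.
Hypothesis g01 : g 0 = g 1.
Hypothesis gn : forall s s' : R, 0 <= s <= 1 -> 0 <= s' <= 1 -> `|s' - s| <= n%:R^-1 ->
  modulus (g s' - g s) < d.
Hypothesis V01 : V 0 = V 1.
Hypothesis Vg : forall s : R, 0 <= s <= 1 -> cell B d (V s).1 (V s).2 (g s).
Hypothesis mb : (b + B) / d < m%:R.

Let d0 : 0 < d.
Proof. by rewrite divr_gt0. Qed.

Definition node (k : nat) : R := k%:R / n%:R.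

Let n0R : 0 < n%:R :> R.
Proof. by rewrite ltr0n. Qed.

Lemma node01 k : (k <= n)%N -> 0 <= node k <= 1.
Proof.
move=> kn; rewrite divr_ge0 ?ler0n //= ler_pdivrMr // mul1r ler_nat //.
Qed.

Lemma node_step k : (k < n)%N -> modulus (g (node k.+1) - g (node k)) < d.
Proof.
move=> kn; apply: gn; rewrite ?node01 // 1?ltnW //.
by rewrite /node -mulrBl -natr1 addrAC subrr add0r mul1r ger0_norm // invr_ge0.
Qed.

(** The lattice loop follows the cells visited at the times 0, 1/n, 2/n, ...: after
    an even number of moves it is at the lower left vertex of the cell, and an
    odd corner takes the horizontal half of the passage to the next cell. *)
Definition corner (k : nat) : nat * nat :=
  if odd k then ((V (node k./2.+1)).1, (V (node k./2)).2) else V (node k./2).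

(** The time at which the curve is close to the k-th corner and to its successor;
    the minimum with n covers the default entries after the end of the loop. *)
Definition centre (k : nat) : R := node (minn k./2 n).

Lemma centre01 k : 0 <= centre k <= 1.
Proof. by rewrite node01 // geq_minr. Qed.

Definition lattice_loop : seq (nat * nat) := [seq corner k | k <- iota 0 n.*2.+1].

Lemma nth_lattice_loop k : nth (V 0) lattice_loop k = if (k <= n.*2)%N then corner k else V 0.
Proof.
case: leqP => kn; first by rewrite (nth_map 0%N) ?size_iota // nth_iota.
by rewrite nth_default // size_map size_iota.
Qed.

Lemma coordB k : coord B d k.+1 = coord B d k + d.
Proof. exact: coordS. Qed.

Lemma near_point z z' : `|complex.Re z - complex.Re z'| <= 2 * d ->
  `|complex.Im z - complex.Im z'| <= 2 * d -> modulus (z - z') < e.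
Proof.
move=> h1 h2; apply: le_lt_trans (modulus_ReIm _) _.
have h3 : complex.Re (z - z') = complex.Re z - complex.Re z' by rewrite raddfB.
have h4 : complex.Im (z - z') = complex.Im z - complex.Im z' by rewrite raddfB.
have h5 : 4 * d = e / 4 by rewrite /d; field.
have e1 := e0; rewrite h3 h4; lra.
Qed.

Lemma near_vertex s a c : 0 <= s <= 1 -> cell B d a c (g s) ->
  modulus (vertex B d (a, c) - g s) < e.
Proof.
move=> s01 [/andP[h1 h2] /andP[h3 h4]]; rewrite !coordB in h2 h4.
have := d0 => dp.
by apply: near_point => /=; rewrite ler_norml; apply/andP; split; lra.
Qed.

Lemma corner_near k : modulus (vertex B d (nth (V 0) lattice_loop k) - g (centre k)) < e /\
  modulus (vertex B d (nth (V 0) lattice_loop k.+1) - g (centre k)) < e.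
Proof.
have dp := d0.
have V0near : modulus (vertex B d (V 0) - g 1) < e.
  rewrite -g01 {1}(surjective_pairing (V 0)); apply: near_vertex; first by rewrite lexx ler01.
  by apply: Vg; rewrite lexx ler01.
have Vn : V (node n) = V 0 by rewrite /node divff ?gt_eqF.
have gnn : g (node n) = g 1 by rewrite /node divff ?gt_eqF.
rewrite !nth_lattice_loop /centre; have [lt|ge] := ltnP k n.*2; last first.
  have kn : (n <= k./2)%N by rewrite -(doubleK n) half_leq.
  rewrite (minn_idPr kn) gnn; split=> //.
  have [kle|//] := leqP k n.*2; have -> : k = n.*2 by apply/eqP; rewrite eqn_leq kle.
  by rewrite /corner odd_double doubleK Vn.
rewrite leq_eqVlt lt orbT.
have k2n : (k./2 < n)%N by rewrite -ltn_double; apply: leq_ltn_trans lt; rewrite -{2}(odd_double_half k) leq_addl.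
rewrite (minn_idPl (ltnW k2n)).
have Rk := le_lt_trans (modulus_Re _) (node_step k2n).
have Ik := le_lt_trans (modulus_Im _) (node_step k2n).
move: Rk Ik; rewrite !raddfB /= => /ltr_normlP[r1 r2] /ltr_normlP[i1 i2].
have [/andP[h1 h2] /andP[h3 h4]] := Vg (node01 (ltnW k2n)).
have [/andP[h5 h6] /andP[h7 h8]] := Vg (node01 k2n).
rewrite !coordB in h2 h4 h6 h8.
rewrite /corner /= uphalf_half; case: (odd k) => /=; split;
  by apply: near_point => /=; rewrite ?add1n ?add0n ler_norml; apply/andP; split; lra.
Qed.

Definition Eh i j := [&& (0 < i)%N, (0 < j)%N, (i < m)%N, (j < m)%N & `[< hseg B d i j `<=` O >]].
Definition Ev i j := [&& (0 < i)%N, (0 < j)%N, (i < m)%N, (j < m)%N & `[< vseg B d i j `<=` O >]].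

Lemma between_range a t : `|t| <= b -> between B d a t -> (1 < a)%N /\ (a < m)%N.
Proof.
have dp := d0; move=> /ler_normlP[t1 t2] /andP[h1 h2]; split.
  rewrite -ltnS -(ltr_nat R) -(ltr_pM2r dp); move: h2; rewrite /coord /B; lra.
rewrite -(ltr_nat R); apply: le_lt_trans mb; rewrite ler_pdivlMr //.
move: h1; rewrite /coord; lra.
Qed.

Lemma cell_range s a c : 0 <= s <= 1 -> cell B d a c (g s) ->
  ((1 < a)%N /\ (a < m)%N) /\ ((1 < c)%N /\ (c < m)%N).
Proof.
move=> s01 [h1 h2]; split.
  by apply: between_range h1; apply: le_trans (modulus_Re _) (gb s01).
by apply: between_range h2; apply: le_trans (modulus_Im _) (gb s01).
Qed.

Lemma Eh_near s a c k : 0 <= s <= 1 -> cell B d a c (g s) -> (k = a \/ a = k.+1) -> Eh k c.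
Proof.
move=> s01 cg ka; have [[a1 am] [c1 cm]] := cell_range s01 cg.
apply/and5P; split; [by case: ka; lia|by lia|by case: ka; lia|by []|].
apply/asboolP => z [/andP[z1 z2] z3]; apply: (gO s01).
have dp := d0; have [/andP[h1 h2] /andP[h3 h4]] := cg; rewrite !coordB in z2 h2 h4.
by case: ka => ?; subst; rewrite ?coordB in h1 h2 z1 z2 z3 *; apply: near_point; rewrite ler_norml; apply/andP; split; lra.
Qed.

Lemma Ev_near s a c k : 0 <= s <= 1 -> cell B d a c (g s) -> (k = c \/ c = k.+1) -> Ev a k.
Proof.
move=> s01 cg ka; have [[a1 am] [c1 cm]] := cell_range s01 cg.
apply/and5P; split; [by lia|by case: ka; lia|by []|by case: ka; lia|].
apply/asboolP => z [z3 /andP[z1 z2]]; apply: (gO s01).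
have dp := d0; have [/andP[h1 h2] /andP[h3 h4]] := cg; rewrite !coordB in z2 h2 h4.
by case: ka => ?; subst; rewrite ?coordB in h3 h4 z1 z2 z3 *; apply: near_point; rewrite ler_norml; apply/andP; split; lra.
Qed.

Lemma between_close a a' t t' : between B d a t -> between B d a' t' -> `|t' - t| < d ->
  [\/ a' = a, a' = a.+1 | a = a'.+1].
Proof.
move=> /andP[h1 h2] /andP[h3 h4] /ltr_normlP[t1 t2].
have a1 : (a < a'.+2)%N by rewrite -(coord_lt B d0) !coordB; rewrite coordB in h4; lra.
have a2 : (a' < a.+2)%N by rewrite -(coord_lt B d0) !coordB; rewrite coordB in h2; lra.
case: (ltngtP a' a) => [lt|gt|->]; last by constructor 1.
  by constructor 3; apply/eqP; rewrite eqn_leq lt andbT.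
by constructor 2; apply/eqP; rewrite eqn_leq gt andbT.
Qed.

Lemma corner_step k : (k < n.*2)%N ->
  (corner k == corner k.+1) || edge Eh Ev (corner k) (corner k.+1).
Proof.
move=> lt.
have k2n : (k./2 < n)%N by rewrite -ltn_double; apply: leq_ltn_trans lt; rewrite -{2}(odd_double_half k) leq_addl.
have s01 := node01 (ltnW k2n); have s01' := node01 k2n.
have cg := Vg s01; have cg' := Vg s01'.
have Rk := le_lt_trans (modulus_Re _) (node_step k2n).
have Ik := le_lt_trans (modulus_Im _) (node_step k2n).
rewrite !raddfB /= in Rk Ik.
rewrite /corner /= uphalf_half; case: (odd k) => /=; rewrite ?add1n ?add0n.
  move: cg cg'; case: (V (node k./2)) => a c; case: (V (node k./2.+1)) => a' c' /= cg cg'.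
  case: (between_close cg.2 cg'.2 Ik) => [->|cE|cE]; first by rewrite eqxx.
    have H : Ev a' c by apply: (Ev_near s01' cg'); right.
    by apply/orP; right; rewrite /edge /= cE H !eqxx /= ?orbT.
  have H : Ev a' c' by apply: (Ev_near s01' cg'); left.
  by apply/orP; right; rewrite /edge /= cE H !eqxx /= ?orbT.
move: cg cg'; case: (V (node k./2)) => a c; case: (V (node k./2.+1)) => a' c' /= cg cg'.
case: (between_close cg.1 cg'.1 Rk) => [->|cE|cE]; first by rewrite eqxx.
  have H : Eh a c by apply: (Eh_near s01 cg); left.
  by apply/orP; right; rewrite /edge /= cE H !eqxx /= ?orbT.
have H : Eh a' c by apply: (Eh_near s01 cg); right.
by apply/orP; right; rewrite /edge /= cE H !eqxx /= ?orbT.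
Qed.

Definition together (s : seq (nat * nat)) :=
  exists A, [/\ convex_set A, A `<=` O & forall u, u \in s -> A (vertex B d u)].

Lemma together_sub s s' : {subset s <= s'} -> together s' -> together s.
Proof. by move=> ss [A [cA AO As]]; exists A; split => // u /ss; exact: As. Qed.

Lemma convex_hseg i j : convex_set (hseg B d i j).
Proof.
have -> : hseg B d i j = [set z | coord B d i <= complex.Re z <= coord B d i.+1 /\ coord B d j <= complex.Im z <= coord B d j].
  apply/seteqP; split=> z /=.
    by case=> z1 ->; rewrite lexx.
  by case=> z1 z2; split=> //; apply/eqP; rewrite eq_le andbC.
exact: convex_box.
Qed.

Lemma convex_vseg i j : convex_set (vseg B d i j).
Proof.
have -> : vseg B d i j = [set z | coord B d i <= complex.Re z <= coord B d i /\ coord B d j <= complex.Im z <= coord B d j.+1].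
  apply/seteqP; split=> z /=.
    by case=> -> z1; rewrite lexx.
  by case=> z2 z1; split=> //; apply/eqP; rewrite eq_le andbC.
exact: convex_box.
Qed.

Lemma hseg_ends i j : hseg B d i j (vertex B d (i, j)) /\ hseg B d i j (vertex B d (i.+1, j)).
Proof.
by have dp := d0; split; split=> //; rewrite /between /= coordB; apply/andP; split; lra.
Qed.

Lemma vseg_ends i j : vseg B d i j (vertex B d (i, j)) /\ vseg B d i j (vertex B d (i, j.+1)).
Proof.
by have dp := d0; split; split=> //; rewrite /between /= coordB; apply/andP; split; lra.
Qed.

Lemma together_edge u w : edge Eh Ev u w -> together [:: u; w].
Proof.
case/edgeP=> -[i [j [/and5P[_ _ _ _ /asboolP HO] ij]]].
  exists (hseg B d i j); split=> //; first exact: convex_hseg.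
  move=> v; have [h1 h2] := hseg_ends i j.
  by case/orP: ij => /andP[/eqP -> /eqP ->]; rewrite !inE => /orP[] /eqP ->.
exists (vseg B d i j); split=> //; first exact: convex_vseg.
move=> v; have [h1 h2] := vseg_ends i j.
by case/orP: ij => /andP[/eqP -> /eqP ->]; rewrite !inE => /orP[] /eqP ->.
Qed.

Lemma grid_margin : margin Eh Ev.
Proof. by move=> k; rewrite /Eh /Ev /= !andbF. Qed.

Lemma grid_confined : confined m Eh Ev.
Proof. by move=> i j; split=> /and5P[_ _ ? ? _]. Qed.

(** A union of enclosed cells has its frontier on edges inside O, so it lies in O
    because O is filled. *)
Lemma together_cell W i j : filled O -> uncrossed Eh Ev W -> W i j ->
  together [:: (i, j.+1); (i, j); (i.+1, j); (i.+1, j.+1)].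
Proof.
move=> fO ucW Wij; have dp := d0.
have b1 := b0; have B0 : 0 <= B by rewrite /B; lra.
have RO : region B d W `<=` O.
  apply: (fO _ (2 * (m%:R * d + B))); first exact: closed_region.
    by apply: (region_bounded d0 B0) => ? ?; exact: uncrossed_bounded grid_margin grid_confined ucW.
  move=> x xW xi.
  have [||] := region_frontier d0 _ xW xi.
  - by move=> k; exact: uncrossed_margin grid_margin ucW.
  - move=> [k [l [xs Wne]]]; case: ucW => _ Wh _.
    case E : (Eh k l.+1); last by case: Wne; apply: Wh; rewrite E.
    by case/and5P: E => _ _ _ _ /asboolP; apply.
  - move=> [k [l [xs Wne]]]; case: ucW => _ _ Wv.
    case E : (Ev k.+1 l); last by case: Wne; apply: Wv; rewrite E.
    by case/and5P: E => _ _ _ _ /asboolP; apply.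
exists (cell B d i j); split.
- exact: convex_box.
- by move=> x xc; apply: RO; exists i, j.
- move=> u; rewrite !inE => /or4P[] /eqP ->; split;
    by rewrite /between /= coordB; apply/andP; split; lra.
Qed.

Lemma together_loop k :
  together [:: nth (V 0) lattice_loop k; nth (V 0) lattice_loop k.+1].
Proof.
exists [set z | modulus (z - g (centre k)) < e]; split.
- exact: convex_ball.
- by move=> z; apply: gO; exact: centre01.
- by have [h1 h2] := corner_near k; move=> u; rewrite !inE => /orP[] /eqP ->.
Qed.

Lemma lattice_loop_contracts : filled O ->
  exists T (x : nat -> seq (nat * nat)),
  [/\ x 0%N = lattice_loop, x T = [:: V 0], forall j, head (V 0) (x j) = V 0 &
      forall j, (j < T)%N -> contiguous together (V 0) (x j) (x j.+1)].
Proof.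
move=> fO; apply: (chain_rows (tog := together)).
have E0 : lattice_loop = V 0 :: [seq corner k | k <- iota 1 n.*2].
  by rewrite /lattice_loop /= /corner /= /node mul0r.
have wf : wf_loop together (V 0) lattice_loop.
  by split; [rewrite E0 | exact: together_loop].
suff H : heq together lattice_loop [:: V 0] by case: (heq_chain together_sub (V 0) H) => + _; exact.
rewrite E0.
apply: (heq_enclosed together_sub grid_margin grid_confined together_edge).
- by move=> W i j; exact: together_cell.
- rewrite /walk; apply/(pathP (V 0)) => k; rewrite size_map size_iota => kn.
  have := corner_step kn.
  rewrite -(_ : nth (V 0) (V 0 :: [seq corner k | k <- iota 1 n.*2]) k = corner k); last first.
    by rewrite -E0 nth_lattice_loop ltnW.
  by rewrite (nth_map 0%N) ?size_iota // nth_iota // add1n.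
- rewrite -[LHS]/(last (V 0) (V 0 :: _)) -E0 -nth_last size_map size_iota /= nth_lattice_loop leqnn.
  by rewrite /corner odd_double doubleK /node divff ?gt_eqF.
Qed.

End Approximation.

(** The rows of the homotopy: first the curve g is reparametrized in n steps so that
    it runs synchronously with a lattice loop close to it; then the loop
    replaces the curve; then the loop contracts as a lattice path. *)
Theorem filled_null_homotopic O (g : R -> R[i]) :
  open O -> filled O -> closed_curve O g -> null_homotopic O g.
Proof.
move=> oO fO [cg gO g01].
have gO' s : 0 <= s <= 1 -> O (g s) by move=> s01; apply: gO; exists s; rewrite //= in_itv.
have [b b0 gb] := path_bounded cg.
have [e e0 He] : exists2 e : R, 0 < e & forall x, (g @` `[0, 1]) x ->
    forall z, modulus (z - x) < e -> O z.
  apply: lebesgue_number.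
  - by apply: continuous_compact => //; exact: segment_compact.
  - by move=> r r' x rr H z zx; apply: H; exact: lt_le_trans rr.
  - move=> x /gO Ox; move/open_modulusP: oO => /(_ x Ox)[r r0 Hr].
    exists (r / 2) => [|y yx z zy]; first by lra.
    by apply: Hr; rewrite -(subrK y z) -addrA; apply: le_lt_trans (modulusD _ _) _; lra.
have gOe s z : 0 <= s <= 1 -> modulus (z - g s) < e -> O z.
  by move=> s01; apply: He; exists s; rewrite //= in_itv.
pose d := e / 16; have d0 : 0 < d by rewrite divr_gt0.
have [r r0 Hr] := uniformly_continuous_path cg d0.
have [n n0 nr] : exists2 n, (0 < n)%N & n%:R^-1 < r.
  exists (Num.truncn r^-1).+1 => //.
  rewrite -[ltRHS]invrK ltf_pV2 ?posrE ?invr_gt0 ?ltr0n //.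
  have ri : 0 <= r^-1 by rewrite invr_ge0 ltW.
  by have /andP[] := truncn_itv ri.
have gn s s' : 0 <= s <= 1 -> 0 <= s' <= 1 -> `|s' - s| <= n%:R^-1 -> modulus (g s' - g s) < d.
  by move=> s01 s01' ss; apply: Hr => //; exact: le_lt_trans nr.
pose B := b + 3 * d.
have cellU z : exists u : nat * nat, modulus z <= b -> cell B d u.1 u.2 z.
  have [zb|nzb] := pselect (modulus z <= b); last by exists (0%N, 0%N).
  have /ler_normlP[r1 r2] := le_trans (modulus_Re z) zb.
  have /ler_normlP[i1 i2] := le_trans (modulus_Im z) zb.
  have [||i [j cz]] := @cell_exists R B d d0 z; [by rewrite /B; lra|by rewrite /B; lra|].
  by exists (i, j).
have [U HU] := choice cellU.
pose V s := U (g s).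
have V01 : V 0 = V 1 by rewrite /V g01.
have Vg s : 0 <= s <= 1 -> cell B d (V s).1 (V s).2 (g s) by move=> s01; apply: HU; exact: gb.
have [m mb] : exists m, (b + B) / d < m%:R.
  exists (Num.truncn ((b + B) / d)).+1.
  have /truncn_itv/andP[] // : 0 <= (b + B) / d by apply: divr_ge0; [rewrite /B; lra | exact: ltW].
have [T [x [x0 xT xh xc]]] := lattice_loop_contracts e0 b0 n0 gb gOe g01 gn V01 Vg mb fO.
have near k := corner_near e0 n0 g01 gn V01 Vg k.
rewrite -x0 in near.
have [N N0 sizeN] : exists2 N, (0 < N)%N & forall j, (j <= T)%N -> (size (x j) <= N)%N.
  exists (\max_(j < T.+1) size (x j)).+1 => // j jT; apply: leqW.
  exact: (leq_bigmax (Ordinal (jT : (j < T.+1)%N))).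
(* All lattice rows are drawn as polygons with N sides, N exceeding all lengths.
   The initial loop has 2 n sides, so it is complete at time 2 n / N, and w is the
   parametrization of g that matches it. *)
pose pt j k := vertex B d (nth (V 0) (x j) k).
pose pl j (s : R) := \sum_(k < N.+1) (hat (N%:R * s - k%:R))%:C%C * pt j k.
pose w (s : R) := Num.min 1 (N%:R / n.*2%:R * s).
pose c (j : nat) (s : R) := (1 - j%:R / n%:R) * s + j%:R / n%:R * w s.
pose row j := if (j <= n)%N then g \o c j else pl (j - n.+1)%N.
have -> : g = row 0%N.
  by apply/funext => s; rewrite /row /= /c mul0r mul0r subr0 mul1r addr0.
have nR : 0 < n%:R :> R by rewrite ltr0n.
have n2R : 0 < n.*2%:R :> R by rewrite ltr0n double_gt0.
have NR : 0 < N%:R :> R by rewrite ltr0n.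
have jn01 j : (j <= n)%N -> 0 <= (j%:R / n%:R : R) <= 1.
  move=> jn; apply/andP; split; first exact: divr_ge0.
  by rewrite ler_pdivrMr // mul1r ler_nat.
have w01 s : 0 <= s <= 1 -> 0 <= w s <= 1.
  move=> /andP[s0 s1]; rewrite /w ge_min lexx andbT le_min ler01 /=.
  by apply: mulr_ge0 => //; apply: divr_ge0; exact: ltW.
have c01 j s : (j <= n)%N -> 0 <= s <= 1 -> 0 <= c j s <= 1.
  move=> /jn01 /andP[j0 j1] s01; have /andP[w0 w1] := w01 _ s01.
  by case/andP: s01 => s0 s1; rewrite /c; apply/andP; split; nra.
have wc : continuous w.
  move=> s; apply: (@continuous_min R R (cst 1) (fun s => N%:R / n.*2%:R * s)).
    exact: cst_continuous.
  by apply: (@continuousM R _ (cst _) (fun s : R => s)); [exact: cst_continuous | exact: cvg_id].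
have cc j : continuous (c j).
  move=> s; apply: (@continuousD R R R (fun s => (1 - j%:R / n%:R) * s) (fun s => j%:R / n%:R * w s)).
    by apply: (@continuousM R _ (cst _) (fun s : R => s)); [exact: cst_continuous | exact: cvg_id].
  by apply: (@continuousM R _ (cst _) w); [exact: cst_continuous | exact: wc].
have ptN j : (j <= T)%N -> pt j N = vertex B d (V 0) by move=> /sizeN ?; rewrite /pt nth_default.
have pt0 j : pt j 0%N = vertex B d (V 0) by rewrite /pt nth0 xh.
have pl0 j : pl j 0 = pt j 0%N.
  by rewrite /pl (hat_sum (k := 0%N)) ?mulr0 ?subr0 ?mul0r ?addr0 ?lexx ?ler01.
have pl1 j : pl j 1 = pt j N.
  rewrite /pl (hat_sum (k := N.-1)) ?prednK // mulr1 ?ler_nat ?leq_pred ?leqnn //.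
  have -> : N%:R - N.-1%:R = 1 :> R.
    by rewrite -{1}(prednK N0) -natr1; ring.
  by rewrite mul1r subrKC.
have Nn : (n.*2 < N)%N.
  by apply: leq_trans (sizeN 0%N (leq0n _)); rewrite x0 size_map size_iota.
have rowT s : 0 <= s <= 1 -> row (n.+1 + T)%N s = vertex B d (V 0).
  move=> s01; have [k kN ks] := hat_index N0 s01.
  rewrite /row leqNgt ltn_addr //= addKn /pl (hat_sum _ kN ks) /pt xT.
  have nthE l : nth (V 0) [:: V 0] l = V 0 by case: l => // l; rewrite nth_default.
  by rewrite !nthE subrr mulr0 addr0.
apply: (@null_homotopic_rows _ O (n.+1 + T)%N row (vertex B d (V 0))); [by []| | |exact: rowT|].
- move=> j; rewrite /row; case: leqP => jn; last exact: polygonal_continuous.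
  by apply: within_reparametrization => // s; exact: c01.
- move=> j jT; rewrite /row; case: leqP => jn.
    have w0 : w 0 = 0 by rewrite /w mulr0; apply/min_idPr; exact: ler01.
    have w1 : w 1 = 1.
      by rewrite /w mulr1; apply/min_idPl; rewrite ler_pdivlMr // mul1r ler_nat ltnW.
    by rewrite /= /c w0 w1 !mulr0 !mulr1 addr0 subrK.
  by rewrite pl0 pl1 pt0 ptN // leq_subLR.
- move=> j s jT s01; rewrite /row.
  case: (ltngtP j n) => [jn|jn|jn].
  + rewrite /=; apply: subset_trans (_ : [set z | modulus (z - g (c j s)) < e] `<=` _); last first.
      by move=> z; apply: gOe; apply: c01 s01; exact: ltnW.
    apply: convex_ball => /=; first by rewrite subrr modulus0.
    have d_e : d < e by rewrite /d; lra.
    apply: lt_trans d_e; apply: gn; [by apply: c01 s01; exact: ltnW|exact: c01|].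
    have -> : c j.+1 s - c j s = n%:R^-1 * (w s - s) by rewrite /c -natr1; ring.
    have ni : 0 < n%:R^-1 :> R by rewrite invr_gt0.
    rewrite normrM (gtr0_norm ni) ger_pMr // ler_norml.
    by have /andP[w0 w1] := w01 _ s01; case/andP: s01 => s0 s1; apply/andP; split; lra.
  + have jT' : (j - n.+1 < T)%N by rewrite ltn_subLR.
    have -> : (j.+1 - n.+1 = (j - n.+1).+1)%N by rewrite subSn.
    set j' := (j - n.+1)%N in jT' *.
    have [k kN ks] := hat_index N0 s01.
    have [A [cA AO As]] := xc _ jT' k.
    apply: subset_trans AO; apply: (cA _ _).
      apply: (cA _ _ _ _ _ (hat_sum_segment (pt j') kN ks)); apply: As; rewrite !inE eqxx ?orbT //.
    by apply: (cA _ _ _ _ _ (hat_sum_segment (pt j'.+1) kN ks)); apply: As; rewrite !inE eqxx ?orbT.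
  + rewrite jn subnn /=.
    have [k kN ks] := hat_index N0 s01.
    have cn : c n s = w s by rewrite /c divff ?gt_eqF // subrr mul0r add0r mul1r.
    apply: subset_trans (_ : [set z | modulus (z - g (centre n k)) < e] `<=` _); last first.
      by move=> z; apply: gOe; exact: centre01.
    have [k1 k2] := near k.
    apply: convex_ball => /=; last exact: (convex_ball k1 k2 (hat_sum_segment (pt 0%N) kN ks)).
    have d_e : d < e by rewrite /d; lra.
    rewrite cn; apply: lt_trans d_e; apply: gn; [exact: centre01|exact: w01|].
    rewrite /centre /w; have [le|ge] := leqP n k./2.
      have n2k : (n.*2 <= k)%N by rewrite -(odd_double_half k) (leq_trans _ (leq_addl _ _)) // leq_double.
      have -> : Num.min 1 (N%:R / n.*2%:R * s) = 1.
        apply/min_idPl; rewrite mulrAC ler_pdivlMr // mul1r.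
        by case/andP: ks => ks _; apply: le_trans ks; rewrite ler_nat.
      by rewrite /node divff ?gt_eqF // subrr normr0 invr_ge0 ler0n.
    have nE : n.*2%:R = 2 * n%:R :> R by rewrite -mul2n natrM.
    have kE : k%:R = (odd k)%:R + 2 * k./2%:R :> R.
      by rewrite -{1}(odd_double_half k) natrD -mul2n natrM.
    have kh : k./2.+1%:R <= n%:R :> R by rewrite ler_nat.
    have ok : 0 <= ((odd k)%:R : R) <= 1 by case: (odd k); rewrite ?lexx ler01.
    have -> : N%:R / n.*2%:R * s = N%:R * s / 2 / n%:R by rewrite nE; field; rewrite gt_eqF.
    have [ks1 ks2] : k%:R <= N%:R * s /\ N%:R * s <= k%:R + 1 by move: ks; rewrite -natr1 => /andP.
    rewrite -natr1 in kh; case/andP: ok => ok0 ok1.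
    have le1 : N%:R * s / 2 / n%:R <= 1 by rewrite ler_pdivrMr // mul1r; lra.
    rewrite (min_idPr le1) /node -mulrBl normrM normfV (gtr0_norm nR).
    rewrite ger_pMl ?invr_gt0 // ler_norml; apply/andP; split; lra.
Qed.

End SimplyConnected.

(** * Polynomials with nonnegative coefficients and complex limits *)

Section MajorantBounds.
Variable R : realType.
Implicit Types (p : {poly R[i]}) (z w : R[i]).

Definition nneg_poly p := forall i, 0 <= p`_i.

(** For nonnegative coefficients this is the value of p at the real number r. *)
Definition majorant p (r : R) : R := complex.Re p.[r%:C%C].

Lemma nneg_poly_cons p c : nneg_poly (p * 'X + c%:P) ->
  [/\ nneg_poly p, 0 <= complex.Re c & modulus c = complex.Re c].
Proof.
move=> H; split=> [i||].
- by have := H i.+1; rewrite coefD coefMX coefC /= addr0.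
- by have := H 0%N; rewrite coefD coefMX coefC /= add0r lecE => /andP[].
- have := H 0%N; rewrite coefD coefMX coefC /= add0r lecE => /andP[/eqP ci cr].
  by rewrite [in LHS](_ : c = (complex.Re c)%:C%C) ?modulus_real ?ger0_norm //; case: c ci {cr H} => a b /= ->.
Qed.

Lemma majorant_cons p c r : majorant (p * 'X + c%:P) r = majorant p r * r + complex.Re c.
Proof.
rewrite /majorant hornerMXaddC raddfD /=; congr (_ + _).
by case: (p.[_]) => a b /=; rewrite mulr0 subr0.
Qed.

(** The Taylor coefficients of p at r are nonnegative and sum up to p(r + 1), so
    p(r + 1) bounds p(r), p'(r) and p''(r)/2 at once. The induction follows
    Horner's scheme. *)
Lemma nneg_poly_bounds p (r : R) : nneg_poly p -> 0 <= r -> forall z w,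
  modulus z <= r -> modulus w <= r ->
  [/\ modulus p.[z] <= majorant p (r + 1),
      modulus (p.[w] - p.[z]) <= modulus (w - z) * majorant p (r + 1) &
      modulus (p.[w] - p.[z] - (w - z) * p^`().[z]) <= modulus (w - z) ^+ 2 * majorant p (r + 1)].
Proof.
move=> + r0; elim/poly_ind: p => [_|p c IH /nneg_poly_cons[/IH {}IH c0 cE]] z w zr wr.
  rewrite /majorant !horner0 deriv0 horner0 !subr0 mulr0 modulus0 /=.
  by split; rewrite ?mulr0 ?subr0 ?modulus0.
have [b0 b1 b2] := IH _ _ zr wr; have [b0' _ _] := IH _ _ wr zr.
set b := majorant p _ in b0 b1 b2 b0' *.
have bp : 0 <= b := le_trans (modulus_ge0 _) b0.
rewrite majorant_cons -/b derivD derivM derivX derivC addr0 mulr1 !hornerE.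
have := modulus_ge0 (w - z); set h := modulus (w - z) in b1 b2 *; move=> h0.
have m0 := modulus_ge0 z.
split.
- apply: le_trans (modulusD _ _) _; rewrite cE modulusM.
  have : modulus p.[z] * modulus z <= b * r by apply: ler_pM; rewrite ?modulus_ge0.
  nra.
- have -> : p.[w] * w + c - (p.[z] * z + c) = (p.[w] - p.[z]) * z + p.[w] * (w - z) by ring.
  apply: le_trans (modulusD _ _) _; rewrite !modulusM -/h.
  have h1 : modulus (p.[w] - p.[z]) * modulus z <= h * b * r.
    by apply: ler_pM; rewrite ?modulus_ge0.
  have h2 : modulus p.[w] * h <= b * h by apply: ler_wpM2r.
  nra.
- have -> : p.[w] * w + c - (p.[z] * z + c) - (w - z) * (p^`().[z] * z + p.[z]) =
     (p.[w] - p.[z] - (w - z) * p^`().[z]) * z + (w - z) * (p.[w] - p.[z]) by ring.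
  apply: le_trans (modulusD _ _) _; rewrite !modulusM -/h.
  set e2 := modulus (_ - _ - _) in b2 *.
  have h1 : e2 * modulus z <= h ^+ 2 * b * r by apply: ler_pM; rewrite ?modulus_ge0.
  have h2 : h * modulus (p.[w] - p.[z]) <= h * (h * b) by apply: ler_wpM2l.
  have h3 : 0 <= h ^+ 2 * complex.Re c by rewrite mulr_ge0 ?exprn_ge0.
  have -> : h ^+ 2 * (b * (r + 1) + complex.Re c) = h ^+ 2 * b * r + h * (h * b) + h ^+ 2 * complex.Re c by ring.
  lra.
Qed.

Lemma complex_complete (u : nat -> R[i]) :
  (forall e : R, 0 < e -> exists N : nat, forall m n, (N <= m)%N -> (N <= n)%N -> modulus (u m - u n) < e) ->
  exists l : R[i], u @ \oo --> l.
Proof.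
move=> cu.
have part (f : R[i] -> R) : (forall z w, `|f z - f w| <= modulus (z - w)) ->
    exists l : R, forall e : R, 0 < e -> \forall n \near \oo, `|f (u n) - l| < e.
  move=> fl; have cf : cvgn (f \o u).
    apply/cauchy_cvgP/cauchyP => e e0; have [N HN] := cu e e0.
    exists (f (u N)); exists N => // n /= Nn; rewrite /ball /=.
    by apply: le_lt_trans (fl _ _) _; apply: HN.
  exists (limn (f \o u)) => e e0.
  have /cvgrPdist_lt/(_ e e0) := cf; apply: filterS => n; rewrite /= distrC //.
have [a Ha] := part (@complex.Re R) (fun z w => eq_ind _ (fun t => `|t| <= _) (modulus_Re (z - w)) _ (raddfB _ z w)).
have [b Hb] := part (@complex.Im R) (fun z w => eq_ind _ (fun t => `|t| <= _) (modulus_Im (z - w)) _ (raddfB _ z w)).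
exists (a +i* b)%C; apply/cvg_modulusP => e e0.
have e20 : 0 < e / 2 by rewrite divr_gt0.
near=> n; apply: le_lt_trans (modulus_ReIm _) _; rewrite !raddfB /=.
have h1 : `|complex.Re (u n) - a| < e / 2 by near: n; exact: Ha.
have h2 : `|complex.Im (u n) - b| < e / 2 by near: n; exact: Hb.
lra.
Unshelve. all: by end_near. Qed.

Lemma cvg_complex_unique (u : nat -> R[i]) (a b : R[i]) : u @ \oo --> a -> u @ \oo --> b -> a = b.
Proof. by move=> ua ub; exact: (cvg_unique (@norm_hausdorff _ R[i]) ua ub). Qed.

Lemma cvg_modulus_le (u : nat -> R[i]) (v : nat -> R) (l a : R[i]) (c : R) :
  u @ \oo --> l -> v @ \oo --> c -> (\forall n \near \oo, modulus (u n - a) <= v n) ->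
  modulus (l - a) <= c.
Proof.
move=> /cvg_modulusP ul /cvgrPdist_lt vc uv; apply/ler_addgt0Pr => e e0.
have e20 : 0 < e / 2 by rewrite divr_gt0.
have [n [[h1 h2] h3]] : exists n, (modulus (u n - l) < e / 2 /\ `|c - v n| < e / 2) /\ modulus (u n - a) <= v n.
  apply: (@filter_ex _ \oo); near=> n; split; last by near: n.
  by split; near: n; [exact: ul | exact: vc].
move/ltr_normlP : h2 => [h2 h2'].
have -> : l - a = (l - u n) + (u n - a) by ring.
apply: le_trans (modulusD _ _) _; rewrite modulusC; lra.
Unshelve. all: by end_near. Qed.

End MajorantBounds.

(** * The linearizer of lam X + X^d at the origin *)

Section Linearizer.
Variables (R : realType) (lam : R) (d : nat).
Hypothesis lam4 : 4 <= lam.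
Hypothesis d3 : (3 <= d)%N.
Implicit Types (z w : R[i]) (r s : R).

Let lam0 : 0 < lam.
Proof. by apply: lt_le_trans lam4. Qed.

Definition qpoly : {poly R[i]} := lam%:C%C *: 'X + 'X^d.

Definition qmap z : R[i] := lam%:C%C * z + z ^+ d.

Definition qreal r : R := lam * r + r ^+ d.

Lemma qpolyE z : qpoly.[z] = qmap z.
Proof. by rewrite /qpoly !hornerE. Qed.

Lemma qreal_complex r : qmap r%:C%C = (qreal r)%:C%C.
Proof. by rewrite /qmap /qreal rmorphD rmorphM rmorphXn. Qed.

Lemma iter_qreal_complex n r : iter n qmap r%:C%C = (iter n qreal r)%:C%C.
Proof. by elim: n => //= n ->; exact: qreal_complex. Qed.

Lemma qreal_ge0 r : 0 <= r -> 0 <= qreal r.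
Proof. by move=> r0; rewrite addr_ge0 ?mulr_ge0 ?exprn_ge0 // ltW. Qed.

Lemma qreal_homo r s : 0 <= r -> r <= s -> qreal r <= qreal s.
Proof.
move=> r0 rs; rewrite lerD ?ler_pM2l // lerXn2r // nnegrE //; exact: le_trans rs.
Qed.

Lemma iter_qreal_ge0 n r : 0 <= r -> 0 <= iter n qreal r.
Proof. by move=> r0; elim: n => //= n; exact: qreal_ge0. Qed.

Lemma iter_qreal_homo n r s : 0 <= r -> r <= s -> iter n qreal r <= iter n qreal s.
Proof.
by move=> r0 rs; elim: n => //= n IH; apply: qreal_homo => //; exact: iter_qreal_ge0.
Qed.

Lemma modulus_qmap z : modulus (qmap z) <= qreal (modulus z).
Proof.
apply: le_trans (modulusD _ _) _.
by rewrite modulusM modulus_real modulusX gtr0_norm.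
Qed.

(** Expanding z^k around w, each term of positive order is bounded by the
    corresponding one of (a + b)^k around a. *)
Lemma exprD_sub_bound z w (a b : R) k : modulus w <= a -> modulus (z - w) <= b ->
  modulus (z ^+ k - w ^+ k) <= (a + b) ^+ k - a ^+ k.
Proof.
move=> wa zwb; have a0 := le_trans (modulus_ge0 _) wa; have b0 := le_trans (modulus_ge0 _) zwb.
have zab : modulus z <= a + b.
  by rewrite -(subrK w z) addrC; apply: le_trans (modulusD _ _) _; rewrite lerD.
elim: k => [|k IH]; first by rewrite !expr0 !subrr modulus0.
have -> : z ^+ k.+1 - w ^+ k.+1 = z * (z ^+ k - w ^+ k) + (z - w) * w ^+ k by rewrite !exprS; ring.
have -> : (a + b) ^+ k.+1 - a ^+ k.+1 = (a + b) * ((a + b) ^+ k - a ^+ k) + b * a ^+ k by rewrite !exprS; ring.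
apply: le_trans (modulusD _ _) _; rewrite !modulusM modulusX.
by apply: lerD; apply: ler_pM; rewrite ?modulus_ge0 ?exprn_ge0 ?modulus_ge0 // lerXn2r // ?nnegrE ?modulus_ge0.
Qed.

Lemma qmap_sub_bound z w (a b : R) : modulus w <= a -> modulus (z - w) <= b ->
  modulus (qmap z - qmap w) <= qreal (a + b) - qreal a.
Proof.
move=> wa zwb; have h := @exprD_sub_bound z w a b d wa zwb.
have -> : qmap z - qmap w = lam%:C%C * (z - w) + (z ^+ d - w ^+ d) by rewrite /qmap; ring.
apply: le_trans (modulusD _ _) _; rewrite modulusM modulus_real gtr0_norm //.
have -> : qreal (a + b) - qreal a = lam * b + ((a + b) ^+ d - a ^+ d) by rewrite /qreal; ring.
by apply: lerD => //; rewrite ler_pM2l.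
Qed.

Lemma iter_qmap_sub_bound n z w (a b : R) : modulus w <= a -> modulus (z - w) <= b ->
  modulus (iter n qmap z - iter n qmap w) <= iter n qreal (a + b) - iter n qreal a.
Proof.
elim: n z w a b => [|n IH] z w a b wa zwb; first by rewrite /= addrAC subrr add0r.
rewrite !iterSr.
have := IH (qmap z) (qmap w) (qreal a) (qreal (a + b) - qreal a); rewrite subrKC.
apply; last exact: qmap_sub_bound.
apply: le_trans (modulus_qmap _) _; apply: qreal_homo => //; exact: modulus_ge0.
Qed.

(** The polynomials q^n(z / lam^n), whose limit is the linearizer; [approxR] is
    their restriction to the real line, which majorizes them. *)
Definition approx n z : R[i] := iter n qmap (z * (lam ^- n)%:C%C).

Definition approxR n r : R := iter n qreal (r * lam ^- n).

(** The recursion rescales on the right, so that nonnegativity of the coefficients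
    is preserved at each step. *)
Fixpoint approx_poly n : {poly R[i]} :=
  if n is k.+1 then qpoly \Po (approx_poly k \Po ((lam^-1)%:C%C *: 'X)) else 'X.

Lemma approxS n z : approx n.+1 z = qmap (approx n (z * (lam^-1)%:C%C)).
Proof. by rewrite /approx /= -mulrA -rmorphM /= exprS invfM. Qed.

Lemma approx_polyE n z : (approx_poly n).[z] = approx n z.
Proof.
elim: n z => [|n IH] z; first by rewrite /= hornerX /approx /= expr0 invr1 mulr1.
by rewrite /= !horner_comp qpolyE approxS IH !hornerE mulrC.
Qed.

Lemma approx_real n r : approx n r%:C%C = (approxR n r)%:C%C.
Proof. by rewrite /approx -rmorphM iter_qreal_complex. Qed.

Lemma approx_poly_nneg n : nneg_poly (approx_poly n).
Proof.
suff H : approx_poly n \is a polyOver Num.nneg by move=> i; have /polyOverP/(_ i) := H.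
have lC : lam%:C%C \is Num.nneg by rewrite nnegrE lecR ltW.
have lC' : (lam^-1)%:C%C \is Num.nneg by rewrite nnegrE lecR invr_ge0 ltW.
elim: n => [|n IH] /=; first exact: polyOverX.
apply: polyOver_comp; first by rewrite rpredD ?polyOverZ ?polyOverX // rpredX // polyOverX.
by apply: polyOver_comp; rewrite ?polyOverZ ?polyOverX.
Qed.

Lemma majorant_approx n r : majorant (approx_poly n) r = approxR n r.
Proof. by rewrite /majorant approx_polyE approx_real. Qed.

Let lamX n : 0 < lam ^- n.
Proof. by rewrite invr_gt0 exprn_gt0. Qed.

Lemma approxR_ge0 n r : 0 <= r -> 0 <= approxR n r.
Proof. by move=> r0; rewrite iter_qreal_ge0 // mulr_ge0 // ltW. Qed.

(** Differences of consecutive approximations are majorized by the same differences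
    on the real line. These telescope, so that convergence on the positive reals
    implies locally uniform convergence. *)
Lemma approx_step n z r : modulus z <= r ->
  modulus (approx n.+1 z - approx n z) <= approxR n.+1 r - approxR n r.
Proof.
move=> zr; rewrite /approx /approxR !iterSr.
have E t : t * lam ^- n = lam * (t * lam ^- n.+1).
  by rewrite exprS invfM [RHS]mulrCA [lam * _]mulrA divff ?gt_eqF // mul1r.
have EC : z * (lam ^- n)%:C%C = lam%:C%C * (z * (lam ^- n.+1)%:C%C).
  by rewrite mulrCA -rmorphM exprS invfM mulrA divff ?gt_eqF // mul1r.
set zn := z * (lam ^- n.+1)%:C%C in EC *.
have zn_r : modulus zn <= r * lam ^- n.+1.
  by rewrite /zn modulusM modulus_real gtr0_norm // ler_wpM2r // ltW.
have -> : qreal (r * lam ^- n.+1) = r * lam ^- n + (r * lam ^- n.+1) ^+ d by rewrite /qreal (E r).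
apply: iter_qmap_sub_bound.
  by rewrite modulusM modulus_real gtr0_norm // ler_wpM2r // ltW.
rewrite EC /qmap addrAC subrr add0r modulusX lerXn2r // nnegrE ?modulus_ge0 //.
exact: le_trans (modulus_ge0 _) zn_r.
Qed.

Lemma approx_diff n m z r : modulus z <= r -> (n <= m)%N ->
  modulus (approx m z - approx n z) <= approxR m r - approxR n r.
Proof.
move=> zr; elim: m => [|m IH]; first by rewrite leqn0 => /eqP ->; rewrite !subrr modulus0.
rewrite leq_eqVlt => /orP[/eqP ->|]; first by rewrite !subrr modulus0.
rewrite ltnS => /IH {}IH; have := approx_step m zr.
have -> : approx m.+1 z - approx n z = (approx m.+1 z - approx m z) + (approx m z - approx n z) by ring.
by move=> h; apply: le_trans (modulusD _ _) _; lra.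
Qed.

Lemma approxR_homo r : 0 <= r -> nondecreasing_seq (approxR ^~ r).
Proof.
move=> r0 n m nm; rewrite -subr_ge0; apply: le_trans (approx_diff (z := 0) _ nm).
  exact: modulus_ge0.
by rewrite modulus0.
Qed.

(** The bound reproduces itself under P(z) -> q(P(z / lam)): with a = |z| / lam it
    requires lam a^2 / 4 + (9 a / 8)^2 <= lam^2 a^2 / 4, which holds for
    lam >= 4. *)
Lemma approx_near0 n z : modulus z <= 2 -> modulus (approx n z - z) <= modulus z ^+ 2 / 4.
Proof.
elim: n z => [|n IH] z z2.
  by rewrite /approx /= expr0 invr1 mulr1 subrr modulus0 divr_ge0 // exprn_ge0 // modulus_ge0.
rewrite approxS; set w := z * (lam^-1)%:C%C.
have zE : z = lam%:C%C * w by rewrite /w mulrCA -rmorphM divff ?gt_eqF // mulr1.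
have lw : modulus z = lam * modulus w by rewrite zE modulusM modulus_real gtr0_norm.
set a := modulus w in lw; have a0 : 0 <= a := modulus_ge0 w.
have l4 := lam4; have h4 : 4 * a <= lam * a by rewrite ler_wpM2r.
have a2 : a <= 1 / 2 by lra.
have h := IH w (_ : a <= 2); rewrite -/a in h.
have h1 : modulus (approx n w - w) <= a ^+ 2 / 4 by apply: h; lra.
set p := approx n w in h1 *.
have p1 : modulus p <= 9 / 8 * a.
  rewrite -(subrK w p); apply: le_trans (modulusD _ _) _; rewrite -/a; nra.
have pd : modulus p ^+ d <= (9 / 8 * a) ^+ 2.
  apply: (@le_trans _ _ (modulus p ^+ 2)).
    by apply: ler_wiXn2l; [exact: modulus_ge0 | lra | exact: ltnW].
  by rewrite lerXn2r // nnegrE ?modulus_ge0 //; lra.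
have -> : qmap p - z = lam%:C%C * (p - w) + p ^+ d by rewrite zE /qmap; ring.
apply: le_trans (modulusD _ _) _; rewrite modulusM modulus_real gtr0_norm // modulusX lw.
have h2 : lam * modulus (p - w) <= lam * (a ^+ 2 / 4) by rewrite ler_pM2l.
apply: le_trans (lerD h2 pd) _.
rewrite !exprMn; have : 0 <= a ^+ 2 by rewrite exprn_ge0.
have : 0 <= lam ^+ 2 / 4 - lam / 4 - (9 / 8) ^+ 2 by rewrite !expr2; nra.
by move=> u1 u2; have := mulr_ge0 u1 u2; nra.
Qed.

(** Rescaling by lam^m moves r into the unit interval, where the approximations are
    at most 5/4. *)
Lemma approxR_bounded r : 0 <= r -> exists b, forall n, approxR n r <= b.
Proof.
move=> r0; have [m rm] : exists m, r * lam ^- m <= 1.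
  have [m hm] : exists m : nat, r <= m%:R by exists (Num.truncn r).+1; have /andP[_ /ltW] := truncn_itv r0.
  exists m; rewrite ler_pdivrMr ?exprn_gt0 // mul1r; apply: le_trans hm _.
  apply: (@le_trans _ _ (2 ^+ m)); first by rewrite -natrX ler_nat ltnW // ltn_expl.
  by have l4 := lam4; rewrite lerXn2r // ?nnegrE //; lra.
exists (iter m qreal (5 / 4)) => n; apply: le_trans (approxR_homo r0 (leq_addl m n)) _.
have -> : approxR (m + n)%N r = iter m qreal (approxR n (r * lam ^- m)).
  by rewrite /approxR iterD exprD invfM mulrA.
have rm0 : 0 <= r * lam ^- m by rewrite mulr_ge0 // ltW.
apply: iter_qreal_homo; first exact: approxR_ge0.
set s := r * lam ^- m in rm rm0 *.
have := @approx_near0 n s%:C%C; rewrite approx_real -rmorphB !modulus_real (ger0_norm rm0) => h.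
have {}h := h (le_trans rm (ler1n _ 2)); have := ler_norm (approxR n s - s); nra.
Qed.

Lemma approxR_cvg r : 0 <= r -> cvgn (approxR ^~ r).
Proof.
move=> r0; apply: nondecreasing_is_cvgn; first exact: approxR_homo.
by have [b Hb] := approxR_bounded r0; exists b => _ [n _ <-].
Qed.

Definition poincare z : R[i] := lim ((approx ^~ z) @ \oo).

Local Notation L := poincare.

Definition approxR_lim r : R := limn (approxR ^~ r).

Lemma approxR_tail r e : 0 <= r -> 0 < e ->
  exists N, forall n, (N <= n)%N -> approxR_lim r - approxR n r < e.
Proof.
move=> r0 e0; have /cvgrPdist_lt/(_ e e0)[N _ HN] := approxR_cvg r0.
by exists N => n Nn; apply: le_lt_trans (ler_norm _) _; exact: HN.
Qed.

Lemma approxR_le_lim n r : 0 <= r -> approxR n r <= approxR_lim r.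
Proof.
move=> r0; apply: (@nondecreasing_cvgn_le _ (approxR ^~ r)); first exact: approxR_homo.
exact: approxR_cvg.
Qed.

Lemma approx_cvg z : (approx ^~ z) @ \oo --> L z.
Proof.
suff [l Hl] : exists l : R[i], (approx ^~ z) @ \oo --> l by have := cvgP _ Hl.
apply: complex_complete => e e0.
have r0 := modulus_ge0 z; have [N HN] := approxR_tail r0 e0.
have H n m : (N <= n)%N -> (n <= m)%N -> modulus (approx m z - approx n z) < e.
  move=> Nn nm; apply: le_lt_trans (approx_diff (lexx _) nm) _.
  by apply: le_lt_trans _ (HN n Nn); rewrite lerD2r; exact: approxR_le_lim.
exists N => m n Nm Nn; case: (leqP n m) => [nm|/ltnW mn]; first exact: H.
by rewrite modulusC; exact: H.
Qed.

Lemma poincare_approx n z r : modulus z <= r ->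
  modulus (L z - approx n z) <= approxR_lim r - approxR n r.
Proof.
move=> zr; have r0 := le_trans (modulus_ge0 _) zr.
apply: (@cvg_modulus_le _ (approx ^~ z) (fun m => approxR m r - approxR n r)).
- exact: approx_cvg.
- apply: cvgB; [exact: approxR_cvg | exact: cvg_cst].
- by exists n => // m /= nm; exact: approx_diff.
Qed.

Lemma poincare_near0 z : modulus z <= 2 -> modulus (L z - z) <= modulus z ^+ 2 / 4.
Proof.
move=> z2; apply: (@cvg_modulus_le _ (approx ^~ z) (fun=> modulus z ^+ 2 / 4)).
- exact: approx_cvg.
- exact: cvg_cst.
- by apply: nearW => n; exact: approx_near0.
Qed.

Lemma poincare0 : L 0 = 0.
Proof.
apply/eqP; rewrite -modulus_eq0 eq_le modulus_ge0 andbT.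
by have := @poincare_near0 0; rewrite modulus0 subr0 expr0n mul0r; apply.
Qed.

Lemma poincare_functional z : L (lam%:C%C * z) = qmap (L z).
Proof.
have h1 : (fun n => approx n.+1 (lam%:C%C * z)) @ \oo --> L (lam%:C%C * z).
  by have := @approx_cvg (lam%:C%C * z); rewrite -(cvg_shiftS (approx ^~ (lam%:C%C * z))).
apply: (cvg_complex_unique h1).
have -> : (fun n => approx n.+1 (lam%:C%C * z)) = horner qpoly \o (approx ^~ z).
  apply/funext => n /=; rewrite qpolyE approxS; congr (qmap (approx _ _)).
  by rewrite mulrAC -rmorphM divff ?gt_eqF // mul1r.
rewrite -qpolyE; apply: continuous_cvg; [exact: horner_continuous | exact: approx_cvg].
Qed.

Lemma poincare_lipschitz : locally_lipschitz L.
Proof.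
move=> r; have [r0|r0] := leP 0 r; last first.
  by exists 0 => z w zr; have := modulus_ge0 z; lra.
exists (approxR_lim (r + 1)) => z w zr wr.
rewrite -[L z - L w]subr0.
apply: (@cvg_modulus_le _ (fun n => approx n z - approx n w) (fun=> approxR_lim (r + 1) * modulus (z - w))).
- by apply: cvgB; exact: approx_cvg.
- exact: cvg_cst.
- apply: nearW => n; rewrite subr0 -!approx_polyE.
  have [_ h _] := nneg_poly_bounds (approx_poly_nneg n) r0 wr zr.
  apply: le_trans h _; rewrite majorant_approx // mulrC; apply: ler_wpM2r; first exact: modulus_ge0.
  by apply: approxR_le_lim; lra.
Qed.

Lemma poincare_poly_approximable : poly_approximable L.
Proof.
move=> r e e0; have [r0|r0] := leP 0 r; last first.
  by exists 0 => z zr; have := modulus_ge0 z; lra.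
have [N HN] := approxR_tail r0 e0.
exists (approx_poly N) => z zr; rewrite approx_polyE.
by apply: le_trans (poincare_approx N zr) _; exact/ltW/HN.
Qed.

Lemma poincare_real r : 0 <= r -> r <= modulus (L r%:C%C).
Proof.
move=> r0; apply/ler_addgt0Pr => e e0; have [N HN] := approxR_tail r0 e0.
have zr : modulus (r%:C%C : R[i]) <= r by rewrite modulus_real ger0_norm.
have h1 := poincare_approx N zr.
have h2 := HN N (leqnn _).
have h3 : r <= approxR N r.
  apply: (@le_trans _ _ (approxR 0 r)); last exact: approxR_homo.
  by rewrite /approxR /= expr0 invr1 mulr1.
have := modulusB (approx N r%:C%C) (L r%:C%C).
rewrite modulusC; rewrite approx_real in h1 *; rewrite modulus_real (ger0_norm (le_trans r0 h3)); lra.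
Qed.

(** Taylor's formula of order two passes from the approximations to the limit,
    since its error is bounded uniformly. The derivatives of the approximations
    form a Cauchy sequence because difference quotients with a small fixed step
    t approximate them uniformly and converge. *)
Lemma poincare_quadratic z r : modulus z < r -> exists D : R[i], forall w, modulus w <= r ->
  modulus (L w - L z - (w - z) * D) <= modulus (w - z) ^+ 2 * approxR_lim (r + 1).
Proof.
move=> zr; have zr' := ltW zr; have r0 : 0 <= r := le_trans (modulus_ge0 _) zr'.
pose D n := (approx_poly n)^`().[z].
set B := approxR_lim (r + 1).
have B0 : 0 <= B by apply: le_trans (approxR_le_lim 0 _); [apply: approxR_ge0 | ]; lra.
have quad n w : modulus w <= r ->
    modulus (approx n w - approx n z - (w - z) * D n) <= modulus (w - z) ^+ 2 * B.
  move=> wr; have [_ _] := nneg_poly_bounds (approx_poly_nneg n) r0 zr' wr.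
  rewrite !approx_polyE => h; apply: le_trans h _; apply: ler_wpM2l; first by rewrite exprn_ge0 ?modulus_ge0.
  by rewrite majorant_approx; apply: approxR_le_lim; lra.
have [l Dl] : exists l : R[i], D @ \oo --> l.
  apply: complex_complete => e e0.
  pose t := Num.min (r - modulus z) (e / (4 * (B + 1))).
  have t0 : 0 < t by rewrite lt_min subr_gt0 zr divr_gt0 //; lra.
  have tB : t * B <= e / 4.
    have h : t <= e / (4 * (B + 1)) by rewrite ge_min lexx orbT.
    apply: (@le_trans _ _ (e / (4 * (B + 1)) * (B + 1))).
      by apply: ler_pM => //; [exact: ltW | lra].
    have -> : e / (4 * (B + 1)) * (B + 1) = e / 4 by field; rewrite gt_eqF //; lra.
    by [].
  pose w := z + t%:C%C.
  have wz : w - z = t%:C%C by rewrite /w addrC addKr.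
  have wr : modulus w <= r.
    apply: le_trans (modulusD _ _) _; rewrite modulus_real gtr0_norm //.
    have : t <= r - modulus z by rewrite ge_min lexx.
    lra.
  have phi n : modulus ((approx n w - approx n z) / t%:C%C - D n) <= t * B.
    have h := quad n w wr; rewrite wz modulus_real (gtr0_norm t0) in h.
    have tC : t%:C%C != 0 :> R[i] by rewrite -modulus_eq0 modulus_real gtr0_norm // gt_eqF.
    have -> : (approx n w - approx n z) / t%:C%C - D n = (approx n w - approx n z - t%:C%C * D n) / t%:C%C by field.
    by rewrite modulusM modulusV modulus_real gtr0_norm // ler_pdivrMr // mulrAC -expr2.
  have et : 0 < e * t / 8 by rewrite divr_gt0 // mulr_gt0.
  have /cvg_modulusP/(_ _ et)[N1 _ H1] := @approx_cvg w.
  have /cvg_modulusP/(_ _ et)[N2 _ H2] := @approx_cvg z.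
  exists (maxn N1 N2) => m n; rewrite !geq_max => /andP[m1 m2] /andP[n1 n2].
  have {H1}[a1 a2] := (H1 _ m1, H1 _ n1); have {H2}[b1 b2] := (H2 _ m2, H2 _ n2).
  rewrite /= in a1 a2 b1 b2.
  have p1 := phi m; have p2 := phi n.
  set pm := (approx m w - approx m z) / _ in p1; set pn := (approx n w - approx n z) / _ in p2.
  have pmn : modulus (pm - pn) <= e / 2.
    have -> : pm - pn = ((approx m w - L w) - (approx n w - L w) - (approx m z - L z) + (approx n z - L z)) / t%:C%C.
      by rewrite /pm /pn; ring.
    rewrite modulusM modulusV modulus_real (gtr0_norm t0) ler_pdivrMr //.
    have := modulusD ((approx m w - L w) - (approx n w - L w) - (approx m z - L z)) (approx n z - L z).
    have := modulusD ((approx m w - L w) - (approx n w - L w)) (- (approx m z - L z)).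
    have := modulusD (approx m w - L w) (- (approx n w - L w)).
    rewrite !modulusN; lra.
  have -> : D m - D n = (pm - pn) - (pm - D m) + (pn - D n) by ring.
  have t1 : t * B < t * (B + 1) by rewrite ltr_pM2l //; lra.
  have t2 : t * (B + 1) <= e / 4.
    have h : t <= e / (4 * (B + 1)) by rewrite ge_min lexx orbT.
    apply: (@le_trans _ _ (e / (4 * (B + 1)) * (B + 1))).
      by rewrite ler_wpM2r //; lra.
    have -> : e / (4 * (B + 1)) * (B + 1) = e / 4 by field; rewrite gt_eqF //; lra.
    by [].
  have := modulusD ((pm - pn) - (pm - D m)) (pn - D n).
  have := modulusD (pm - pn) (- (pm - D m)); rewrite modulusN; lra.
exists l => w wr.
rewrite -[L w - L z - (w - z) * l]subr0.
apply: (@cvg_modulus_le _ (fun n => approx n w - approx n z - (w - z) * D n) (fun=> modulus (w - z) ^+ 2 * B)).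
- apply: cvgB; first by apply: cvgB; exact: approx_cvg.
  by apply: cvgM; [exact: cvg_cst | exact: Dl].
- exact: cvg_cst.
- by apply: nearW => n; rewrite subr0; exact: quad.
Qed.

Lemma poincare_entire : entire L.
Proof.
move=> z; have [|D HD] := @poincare_quadratic z (modulus z + 1); first by rewrite ltrDl.
set B := approxR_lim _ in HD.
apply: (cvgP D); apply/cvg_modulusP => e e0.
rewrite near_withinE; apply/nbhs_modulus.
have B1 : 0 < `|B| + 1 by rewrite ltr_wpDl.
exists (Num.min 1 (e / (`|B| + 1))) => [|h]; first by rewrite lt_min ltr01 divr_gt0.
rewrite subr0 lt_min => /andP[h1 he] h0.
have hm : 0 < modulus h by rewrite modulus_gt0.
have := HD (h + z); rewrite addrK => HDh.
have -> : h^-1 *: ((L \o shift z) (h *: 1) - L z) - D = (L (h + z) - L z - h * D) / h.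
  rewrite /= /shift /= /GRing.scale /= mulr1; field.
  exact: h0.
rewrite modulusM modulusV ltr_pdivrMr //.
apply: le_lt_trans (HDh _) _.
  by apply: le_trans (modulusD _ _) _; lra.
rewrite expr2 -mulrA mulrC ltr_pM2r //.
rewrite ltr_pdivlMr // in he; apply: le_lt_trans he; apply: ler_wpM2l; first exact: ltW.
by have := ler_norm B; lra.
Qed.

End Linearizer.

(** * Growth of the iterates of the polynomial *)

Section Growth.
Variables (R : realType) (lam : R) (d : nat).
Hypothesis lam4 : 4 <= lam.
Hypothesis d3 : (3 <= d)%N.
Implicit Types (z w : R[i]) (r s : R).

Local Notation qmap := (qmap lam d).
Local Notation qreal := (qreal lam d).

Let lam0 : 0 < lam.
Proof. by apply: lt_le_trans lam4. Qed.

Let lam1 : 1 <= lam.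
Proof. by apply: le_trans lam4; rewrite ler1n. Qed.

Let d1 : (0 < d)%N.
Proof. exact: leq_trans d3. Qed.

(** For y >= 1 one has q(y) <= (lam + 1) y^d, hence
    (lam + 1) q(y) <= ((lam + 1) y)^d, which iterates. The start 5/4 is the bound
    for the linearizer on the unit disc. *)
Lemma iter_qreal_upper n : iter n qreal (5 / 4) < lam ^+ (2 * d ^ n) / 2.
Proof.
have l4 := lam4; pose H := (lam + 1) * (5 / 4).
have H0 : 0 < H by rewrite /H; lra.
have up k : 1 <= iter k qreal (5 / 4) /\ (lam + 1) * iter k qreal (5 / 4) <= H ^+ (d ^ k).
  elim: k => [|k [IH1 IH2]]; first by rewrite /= expn0 expr1 /H; split; lra.
  set y := iter k qreal (5 / 4) in IH1 IH2 *; rewrite /= -/y.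
  have yd : 1 <= y ^+ d by exact: exprn_ege1.
  have yyd : y <= y ^+ d by rewrite -[leLHS]expr1; apply: ler_weXn2l.
  split; first by rewrite /qreal; nra.
  rewrite expnSr exprM; apply: (@le_trans _ _ (((lam + 1) * y) ^+ d)); last first.
    by rewrite lerXn2r // nnegrE ?exprn_ge0 //; nra.
  have h1 : qreal y <= (lam + 1) * y ^+ d by rewrite /qreal; nra.
  apply: (@le_trans _ _ ((lam + 1) * ((lam + 1) * y ^+ d))); first by rewrite ler_wpM2l //; lra.
  rewrite exprMn mulrA -expr2 ler_wpM2r ?exprn_ge0 //; first by lra.
  by apply: ler_weXn2l; [lra | exact: ltnW].
have [u1 u2] := up n.
have D0 : (0 < d ^ n)%N by rewrite expn_gt0 d1.
have h1 : 2 * H ^+ (d ^ n) <= (2 * H) ^+ (d ^ n).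
  rewrite [(2 * H) ^+ _]exprMn ler_wpM2r ?exprn_ge0 //; first exact: ltW.
  by rewrite -[leLHS]expr1; apply: ler_weXn2l => //; lra.
have h2 : (2 * H) ^+ (d ^ n) < lam ^+ (2 * d ^ n).
  rewrite exprM ltrXn2r ?nnegrE //; first by rewrite -lt0n.
  - by lra.
  - by rewrite /H expr2; nra.
rewrite ltr_pdivlMr //; apply: le_lt_trans _ (le_lt_trans h1 h2).
by nra.
Qed.

(** For |w| >= lam - 1 >= 3 the term w^d has at least twice the modulus of
    lam w. *)
Lemma modulus_qmap_lower w : lam - 1 <= modulus w ->
  modulus w <= modulus (qmap w) /\ 2 * (modulus w / 2) ^+ d <= modulus (qmap w).
Proof.
move=> lw; have l4 := lam4; set x := modulus w in lw *.
have h : x ^+ d - lam * x <= modulus (qmap w).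
  have := modulusB (w ^+ d) (- (lam%:C%C * w)); rewrite opprK addrC.
  by rewrite modulusN modulusM modulusX modulus_real gtr0_norm // addrC [in X in _ <= X]addrC.
have x1 : 1 <= x by lra.
have xd : x ^+ 2 * x <= x ^+ d by rewrite -exprSr; apply: ler_weXn2l.
have x2 : 2 * lam <= x ^+ 2.
  apply: (@le_trans _ _ ((lam - 1) ^+ 2)); first by rewrite expr2; nra.
  by rewrite lerXn2r // nnegrE; lra.
have xdl : 2 * lam * x <= x ^+ d by apply: le_trans xd; rewrite ler_wpM2r //; lra.
have half : x ^+ d / 2 <= modulus (qmap w) by lra.
split; first by apply: le_trans half; nra.
apply: le_trans half; rewrite expr_div_n.
have d2 : 4 <= 2 ^+ d :> R.
  have -> : 4 = 2 ^+ 2 :> R by rewrite expr2; ring.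
  by apply: ler_weXn2l; [lra | exact: ltnW].
rewrite mulrCA ler_wpM2l ?exprn_ge0 //; first by lra.
by rewrite ler_pdivrMr ?exprn_gt0 //; lra.
Qed.

Lemma iter_qmap_lower n w : lam - 1 <= modulus w ->
  2 * (modulus w / 2) ^+ (d ^ n) <= modulus (iter n qmap w).
Proof.
move=> lw; have l4 := lam4.
suff [] : modulus w <= modulus (iter n qmap w) /\ 2 * (modulus w / 2) ^+ (d ^ n) <= modulus (iter n qmap w) by [].
elim: n => [|n [IH1 IH2]]; first by rewrite /= expn0 expr1; split=> //; lra.
have [h1 h2] := @modulus_qmap_lower (iter n qmap w) (le_trans lw IH1).
split; first exact: le_trans IH1 h1.
apply: le_trans h2; rewrite expnSr exprM ler_wpM2l // lerXn2r ?nnegrE ?exprn_ge0 ?divr_ge0 ?modulus_ge0 //.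
by rewrite ler_pdivlMr // mulrC.
Qed.

Lemma modulus_qmap_unit w : modulus w = 1 -> lam - 1 <= modulus (qmap w).
Proof.
move=> w1; have := modulusB (lam%:C%C * w) (- (w ^+ d)); rewrite opprK modulusN.
by rewrite modulusM modulusX modulus_real gtr0_norm // w1 mulr1 expr1n.
Qed.

(** The left side is exponential in j and the right side doubly exponential. *)
Lemma fast_exponent : exists2 j, (0 < j)%N & lam ^+ (2 + j) <= (3 / 2) ^+ (d ^ j.-1).
Proof.
have [a la] : exists a : nat, lam <= (3 / 2) ^+ a.
  pose m := (Num.truncn lam).+1.
  have lm : lam <= m%:R by have /andP[_ /ltW] := truncn_itv (ltW lam0).
  exists (2 * m)%N; apply: le_trans lm _; rewrite exprM.
  apply: (@le_trans _ _ (2 ^+ m)); first by rewrite -natrX ler_nat ltnW // ltn_expl.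
  by rewrite lerXn2r ?nnegrE // expr2; lra.
exists (a + 4)%N; first by rewrite addn4.
have -> : (a + 4).-1 = (a + 3)%N by lia.
apply: (@le_trans _ _ (((3 / 2) ^+ a) ^+ (2 + (a + 4)))).
  by rewrite lerXn2r ?nnegrE ?exprn_ge0 //; exact: ltW.
rewrite -exprM; apply: ler_weXn2l; first by lra.
apply: (@leq_trans (3 ^ (a + 3))); last by rewrite leq_exp2r // addn_gt0 orbT.
have sq t : (t ^ 2 <= 3 ^ t)%N.
  elim: t => // t IH; rewrite [(3 ^ t.+1)%N]expnS.
  case: t IH => [|[|t]] // IH; nia.
by apply: leq_trans (sq _); nia.
Qed.

End Growth.

(** * The holes of the web *)

Section SeparatedSets.
Variable R : realType.
Implicit Types (x y z : R[i]) (A B : set R[i]).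

(** The points closer to some x of A than half the distance from x to B: an open set,
    and disjoint from the one with A and B exchanged by the triangle
    inequality. *)
Definition away A B : set R[i] := [set z | exists2 x, A x & exists2 e : R, modulus (z - x) < e &
  forall y, B y -> 2 * e <= modulus (y - x)].

Lemma open_away A B : open (away A B).
Proof.
apply/open_modulusP => z [x Ax [e zx He]]; exists (e - modulus (z - x)); first by rewrite subr_gt0.
move=> y yz; exists x => //; exists e => //.
have -> : y - x = (y - z) + (z - x) by ring.
by apply: le_lt_trans (modulusD _ _) _; lra.
Qed.

Lemma sub_away A B : A `&` closure B = set0 -> A `<=` away A B.
Proof.
move=> AB x Ax; have nx : ~ closure B x by move=> Bx; have : (A `&` closure B) x by []; rewrite AB.
apply: contrapT => H; apply: nx; apply/closure_modulusP => e e0.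
apply: contrapT => H2; apply: H; exists x => //; exists (e / 2); first by rewrite subrr modulus0 divr_gt0.
move=> y By; rewrite mulrC divfK // leNgt; apply/negP => yx; apply: H2; by exists y.
Qed.

Lemma away_disjoint A B : away A B `&` away B A = set0.
Proof.
apply/seteqP; split=> // z [[x Ax [e zx He]] [y By [e' zy He']]].
have h1 := He y By; have h2 := He' x Ax; have h3 := modulusD (x - z) (z - y).
rewrite subrKA in h3; rewrite modulusC in h1; rewrite (modulusC x z) in h3; lra.
Qed.

End SeparatedSets.

Section Web.
Variables (R : realType) (lam : R) (d : nat) (L : R[i] -> R[i]).
Hypothesis lam4 : 4 <= lam.
Hypothesis d3 : (3 <= d)%N.
Hypothesis L0 : L 0 = 0.
Hypothesis Lfun : forall z, L (lam%:C%C * z) = qmap lam d (L z).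
Hypothesis Lnear : forall z, modulus z <= 2 -> modulus (L z - z) <= modulus z ^+ 2 / 4.
Hypothesis Llip : locally_lipschitz L.
Hypothesis Lapp : poly_approximable L.
Implicit Types (z w : R[i]) (r s : R).

Local Notation qmap := (qmap lam d).

Let lam0 : 0 < lam.
Proof. by apply: lt_le_trans lam4. Qed.

Let lam1 : 1 <= lam.
Proof. by apply: le_trans lam4; rewrite ler1n. Qed.

Let d1 : (0 < d)%N.
Proof. exact: leq_trans d3. Qed.

Lemma L_continuous : continuous L.
Proof. exact: lipschitz_continuous. Qed.

Lemma iter_continuous k : continuous (iter k L).
Proof.
elim: k => [|k IH] z; first exact: cvg_id.
by apply: (@continuous_comp _ _ _ (iter k L) L); [exact: IH | exact: L_continuous].
Qed.

Lemma iter_approximable k : poly_approximable (iter k L).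
Proof.
elim: k => [|k IH]; last exact: (@poly_approximable_comp _ L (iter k L)).
move=> r e e0; exists 'X => z _; rewrite hornerX subrr modulus0; exact: ltW.
Qed.

Lemma L_iter n z : L ((lam ^+ n)%:C%C * z) = iter n qmap (L z).
Proof.
elim: n => [|n IH]; first by rewrite expr0 mul1r.
by rewrite exprS rmorphM -mulrA Lfun IH.
Qed.

Lemma L_rescale n z : L z = iter n qmap (L ((lam ^- n)%:C%C * z)).
Proof. by rewrite -L_iter mulrA -rmorphM divff ?mul1r // expf_neq0 // gt_eqF. Qed.

Lemma modulus_rescale n z : modulus ((lam ^- n)%:C%C * z) = modulus z / lam ^+ n.
Proof. by rewrite modulusM modulus_real gtr0_norm ?invr_gt0 ?exprn_gt0 // mulrC. Qed.

(** Rescale z into the unit disc, where |L| <= 5/4, and iterate q. *)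
Lemma L_upper n z : modulus z <= lam ^+ n -> modulus (L z) < lam ^+ (2 * d ^ n) / 2.
Proof.
move=> zn; rewrite (L_rescale n); set u := _ * z.
have u1 : modulus u <= 1 by rewrite /u modulus_rescale ler_pdivrMr ?exprn_gt0 // mul1r.
have lu : modulus (L u) <= 5 / 4.
  have h := Lnear (le_trans u1 (ler1n _ 2)); have h2 := modulusB (L u) u.
  have : modulus u ^+ 2 <= 1 by rewrite exprn_ile1 // modulus_ge0.
  lra.
apply: le_lt_trans (iter_qreal_upper lam4 d3 n).
apply: le_trans (iter_qreal_homo _ lam4 n (modulus_ge0 _) lu).
elim: n {zn u u1 lu} (L u) => [|n IH] w //=.
apply: le_trans (modulus_qmap d lam4 _) _.
by apply: qreal_homo => //; exact: modulus_ge0.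
Qed.

Lemma connected_ivt (C : set R[i]) (f : R[i] -> R) x y (c : R) : connected C ->
  continuous f -> C x -> C y -> f x <= c <= f y -> exists2 z, C z & f z = c.
Proof.
move=> cC cf Cx Cy fc.
have /connected_intervalP iC : connected (f @` C).
  by apply: connected_continuous_connected => //; exact: continuous_subspaceT.
have [z Cz zc] : (f @` C) c by apply: (iC (f x) (f y)); [by exists x|by exists y|].
by exists z.
Qed.

(** This takes the place of a minimum modulus estimate. On C, the modulus of
    L(z / lam^n) is 0 at the origin and at least 1 where |z| = 2 lam^n, so it is 1
    somewhere. One application of q makes it at least lam - 1 >= 3, and the
    remaining n - 1 applications make it large. *)
Lemma crossing (C : set R[i]) n y : connected C -> C 0 -> C y -> (0 < n)%N ->
  2 * lam ^+ n <= modulus y ->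
  exists2 z, C z & 2 * (3 / 2) ^+ (d ^ n.-1) <= modulus (L z).
Proof.
move=> cC C0 Cy n0 yn; have l4 := lam4.
pose sc z := (lam ^- n)%:C%C * z.
have csc : continuous sc.
  by move=> z; apply: (@continuousM _ _ (cst _) id); [exact: cst_continuous | exact: cvg_id].
have cm : continuous (fun z => modulus (sc z)).
  by move=> z; apply: (continuous_comp (csc z)); exact: modulus_continuous.
have sc0 : sc 0 = 0 by rewrite /sc mulr0.
have lt0 : 0 < lam ^+ n by rewrite exprn_gt0.
have [u Cu u2] : exists2 u, C u & modulus (sc u) = 2.
  apply: (connected_ivt cC cm C0 Cy); rewrite sc0 modulus0 ler0n /=.
  by rewrite modulus_rescale ler_pdivlMr.
have Lu : 1 <= modulus (L (sc u)).
  have su2 : modulus (sc u) <= 2 by rewrite u2.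
  have h := Lnear su2; rewrite u2 expr2 in h.
  have := modulusB (sc u) (L (sc u)); rewrite modulusC u2; lra.
have cl : continuous (fun z => modulus (L (sc z))).
  move=> z; apply: (@continuous_comp _ _ _ sc (@modulus R \o L) z (csc z)).
  exact: (@continuous_comp _ _ _ L (@modulus R) (sc z) (@L_continuous _) (@modulus_continuous R _)).
have [z Cz z1] : exists2 z, C z & modulus (L (sc z)) = 1.
  by apply: (connected_ivt cC cl C0 Cu); rewrite sc0 L0 modulus0 ler01.
exists z => //; rewrite (L_rescale n) -/(sc z) -(prednK n0) iterSr prednK //.
have q1 := modulus_qmap_unit d lam4 z1.
apply: le_trans (iter_qmap_lower lam4 d3 n.-1 q1).
rewrite ler_wpM2l // lerXn2r // ?nnegrE ?divr_ge0 ?modulus_ge0 //.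
by rewrite ler_pM2r ?invr_gt0 //; lra.
Qed.

(** The exponent in the upper bound for L: it maps the disc of radius lam^n into the
    one of radius lam^(speed n). *)
Definition speed n : nat := (2 * d ^ n)%N.

Definition level (N k : nat) : nat := iter k speed N.

Definition radius (N k : nat) : R := lam ^+ level N k / 2.

Lemma speed_gt n : (n < speed n)%N.
Proof.
rewrite /speed; apply: (@leq_trans (d ^ n)); last by rewrite leq_pmull.
by apply: ltn_expl; exact: ltnW.
Qed.

Lemma speed_homo m n : (m <= n)%N -> (speed m <= speed n)%N.
Proof. by move=> mn; rewrite leq_mul2l leq_pexp2l. Qed.

Lemma level_ge N k : (N + k <= level N k)%N.
Proof.
elim: k => [|k IH]; first by rewrite addn0.
by rewrite addnS /=; apply: leq_ltn_trans IH (speed_gt _).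
Qed.

Lemma level_homo N M k : (N <= M)%N -> (level N k <= level M k)%N.
Proof. by move=> NM; elim: k => //= k; exact: speed_homo. Qed.

(** Once an orbit is slower than the radii it stays so, which makes this an
    increasing union of open sets; its complement consists of fast escaping
    points. *)
Definition slow (N : nat) : set R[i] := [set z | exists k, modulus (iter k L z) < radius N k].

Lemma slow_step N k z : modulus (iter k L z) < radius N k ->
  modulus (iter k.+1 L z) < radius N k.+1.
Proof.
move=> h; apply: L_upper; apply: ltW; apply: lt_le_trans h _.
by rewrite /radius ler_pdivrMr // ler_peMr ?exprn_ge0 ?ler1n // ltW.
Qed.

Lemma slow_later N j k z : (j <= k)%N -> modulus (iter j L z) < radius N j ->
  modulus (iter k L z) < radius N k.
Proof.
move=> + H; elim: k => [|k IH]; first by rewrite leqn0 => /eqP <-.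
by rewrite leq_eqVlt => /orP[/eqP <-//|]; rewrite ltnS => /IH; exact: slow_step.
Qed.

Lemma open_slow N : open (slow N).
Proof.
have -> : slow N = \bigcup_k [set z | modulus (iter k L z) < radius N k].
  by apply/seteqP; split=> z [k]; [exists k | exists k].
by apply: bigcup_open => k _; apply: open_modulus_lt; exact: iter_continuous.
Qed.

Lemma slow_compact N (K : set R[i]) : compact K -> K `<=` slow N ->
  exists k, forall z, K z -> modulus (iter k L z) < radius N k.
Proof.
move=> /compact_near_coveringP cK Ks.
have : \forall k \near \oo, K `<=` [set z | modulus (iter k L z) < radius N k].
  apply: cK => z /Ks[k zk].
  exists ([set w | modulus (iter k L w) < radius N k], [set l | (k <= l)%N]) => /=.
    split; last by exists k.
    have := @open_modulus_lt _ _ (radius N k) (@iter_continuous k).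
    by rewrite openE => /(_ z zk).
  by move=> [w l] [/= wk kl]; exact: slow_later wk.
by move=> [k _ Hk]; exists k => z; exact: (Hk k (leqnn k)).
Qed.

Lemma iter_max_principle k T (b : R) x : closed T -> (forall z, T z -> modulus z <= b) ->
  T x -> exists2 y, T y /\ ~ T° y & modulus (iter k L x) <= modulus (iter k L y).
Proof.
by move=> cT Tb Tx; apply: (max_principle (@iter_approximable k) (@iter_continuous k) cT Tb Tx).
Qed.

(** The frontier of T is compact, so a single iterate shows that all its points are
    slow, and the maximum principle for that iterate extends this to T. *)
Lemma filled_slow N : filled (slow N).
Proof.
move=> T b cT Tb fr x Tx.
have [||k Hk] := @slow_compact N [set y | T y /\ ~ T° y].
- by apply: (@compact_modulus _ _ b); [exact: closed_frontier | move=> z [/Tb]].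
- by move=> y [Ty nTy]; exact: fr.
have [y yT xy] := @iter_max_principle k T b x cT Tb Tx.
by exists k; apply: le_lt_trans xy (Hk y yT).
Qed.

Lemma radius_unbounded (N : nat) (b : R) : exists k0, forall k, (k0 <= k)%N -> b <= radius N k.
Proof.
have [m bm] : exists m : nat, b <= m%:R.
  have [b0|b0] := leP 0 b; last by exists 0%N; exact: ltW.
  by exists (Num.truncn b).+1; have /andP[_ /ltW] := truncn_itv b0.
exists m => k mk; apply: le_trans bm _; rewrite /radius ler_pdivlMr //.
apply: (@le_trans _ _ (4 ^+ level N k)); last by rewrite lerXn2r ?nnegrE // ltW.
rewrite -natrX -natrM ler_nat.
have ml : (m <= level N k)%N.
  by apply: leq_trans mk _; apply: leq_trans (level_ge N k); exact: leq_addl.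
have h4 : (level N k * 2 <= 4 ^ level N k)%N.
  elim: (level N k) => // t IH; rewrite expnS; nia.
by apply: leq_trans h4; rewrite leq_mul2r.
Qed.

Lemma fast_escapes N z : ~ slow N z -> escaping_set L z.
Proof.
move=> zN; apply/cvgryPge => b; have [k0 Hk0] := radius_unbounded N b.
exists k0 => // k /= kk; apply: le_trans (Hk0 k kk) _.
by rewrite leNgt; apply/negP => lt; apply: zN; exists k.
Qed.

(** The number of additional powers of lam after which the minimum modulus bound
    exceeds the maximum modulus bound. *)
Definition reach := sval (cid2 (fast_exponent lam4 d3)).

Lemma reach_gt0 : (0 < reach)%N.
Proof. by rewrite /reach; case: cid2. Qed.

Lemma reachP : lam ^+ (2 + reach) <= (3 / 2) ^+ (d ^ reach.-1).
Proof. by rewrite /reach; case: cid2. Qed.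

Lemma reach_speed n : lam ^+ (speed n + reach) <= (3 / 2) ^+ (d ^ (n + reach).-1).
Proof.
have -> : (n + reach).-1 = (reach.-1 + n)%N by have := reach_gt0; lia.
rewrite expnD exprM; apply: (@le_trans _ _ ((lam ^+ (2 + reach)) ^+ (d ^ n))); last first.
  rewrite lerXn2r ?nnegrE ?exprn_ge0 //; first exact: ltW.
  exact: reachP.
rewrite -exprM; apply: ler_weXn2l => //; rewrite /speed mulnDl leq_add2l.
by rewrite leq_pmulr // expn_gt0 d1.
Qed.

(** The component of the origin in the set of slow points, described by continua. *)
Definition hole (N : nat) : set R[i] := [set z | exists C : set R[i],
  [/\ compact C, connected C, C `<=` slow N, C 0 & C z]].

(** If a continuum C in the slow set joined 0 to a point of modulus at least
    2 lam^(N + reach), then each image of C under an iterate of L would again join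
    0 = L(0) to a point whose modulus exceeds the radius in question. By compactness, however, some iterate takes all of C below its
    radius. *)
Lemma hole_bounded N z : hole N z -> modulus z < 2 * lam ^+ (N + reach).
Proof.
move=> [C [cC conC Cs C0 Cz]]; rewrite ltNge; apply/negP => zN.
have H k : exists2 y, C y & 2 * lam ^+ (level N k + reach) <= modulus (iter k L y).
  elim: k => [|k [y Cy yk]]; first by exists z.
  have conk : connected (iter k L @` C).
    by apply: connected_continuous_connected => //; apply: continuous_subspaceT; exact: iter_continuous.
  have C0k : (iter k L @` C) 0.
    by exists 0 => //; elim: k {y Cy yk conk} => //= k ->.
  have n0 : (0 < level N k + reach)%N by rewrite addn_gt0 reach_gt0 orbT.
  have [|_ [x Cx <-] xk] := crossing conk C0k _ n0 yk; first by exists y.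
  exists x => //; apply: le_trans xk; rewrite ler_wpM2l //; exact: reach_speed.
have [k Hk] := slow_compact cC Cs; have [y Cy yk] := H k.
have := le_lt_trans yk (Hk y Cy); rewrite /radius exprD.
have h1 : 0 < lam ^+ level N k by rewrite exprn_gt0.
have h2 : 1 <= lam ^+ reach by exact: exprn_ege1.
by move=> h3; nra.
Qed.

Lemma hole_slow N : hole N `<=` slow N.
Proof. by move=> z [C [_ _ Cs _ Cz]]; exact: Cs. Qed.

Lemma hole_extend N z (C : set R[i]) : hole N z -> compact C -> connected C -> C `<=` slow N ->
  C z -> C `<=` hole N.
Proof.
move=> [D [cD conD Ds D0 Dz]] cC conC Cs Cz w Cw; exists (D `|` C); split.
- exact: compactU.
- by apply: connectedU => //; exists z.
- by move=> x [/Ds|/Cs].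
- by left.
- by right.
Qed.

Lemma hole_convex_extend N z w : hole N z -> segment z w `<=` slow N -> hole N w.
Proof.
move=> hz zw; apply: (hole_extend hz (@compact_segment _ z w) (@connected_segment _ z w) zw).
  exact: segment_left.
exact: segment_right.
Qed.

Lemma hole0 N : hole N 0.
Proof.
exists [set 0]; split; [exact: compact_set1|exact: connected1| |by []|by []].
by move=> _ ->; exists 0%N; rewrite /= modulus0 divr_gt0 // exprn_gt0.
Qed.

Lemma hole_disc N z : modulus z < lam ^+ N / 2 -> hole N z.
Proof.
move=> zN; apply: (hole_convex_extend (hole0 N)) => w zw; exists 0%N => /=.
rewrite -[w]subr0; apply: (@convex_ball R 0 (lam ^+ N / 2) 0 z) => //=.
  by rewrite subr0 modulus0 divr_gt0 // exprn_gt0.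
by rewrite subr0.
Qed.

Lemma open_hole N : open (hole N).
Proof.
apply/open_modulusP => z hz; have /open_modulusP := @open_slow N.
move=> /(_ z (hole_slow hz)) [e e0 He]; exists e => // w wz.
apply: (hole_convex_extend hz) => x xzw; apply: He.
by apply: (@convex_ball R z e z w) xzw => //=; rewrite subrr modulus0.
Qed.

Lemma connected_hole N : connected (hole N).
Proof.
have -> : hole N = \bigcup_(C in [set C | [/\ compact C, connected C, C `<=` slow N & C 0]]) C.
  apply/seteqP; split=> [z [C [h1 h2 h3 h4 h5]]|z [C [h1 h2 h3 h4] h5]]; by exists C.
apply: bigcup_connected; last by move=> C [].
by exists 0 => C [].
Qed.

Lemma slow_homo N : slow N `<=` slow N.+1.
Proof.
move=> z [k zk]; exists k; apply: lt_le_trans zk _; rewrite /radius ler_pM2r ?invr_gt0 //.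
by apply: ler_weXn2l => //; exact: level_homo.
Qed.

Lemma hole_homo N M : (N <= M)%N -> hole N `<=` hole M.
Proof.
move=> NM z [C [h1 h2 h3 h4 h5]]; exists C; split => // w /h3.
elim: M NM => [|M IH]; first by rewrite leqn0 => /eqP ->.
by rewrite leq_eqVlt => /orP[/eqP ->//|]; rewrite ltnS => /IH {}IH /IH; exact: slow_homo.
Qed.

(** A slow boundary point would have a slow disc around it, which meets the hole and
    hence belongs to it. *)
Lemma hole_boundary N : boundary (hole N) `<=` escaping_set L.
Proof.
move=> x [/closure_modulusP cx nx]; apply: (@fast_escapes N) => xs.
have /open_modulusP/(_ x xs)[e e0 He] := @open_slow N.
have [y hy yx] := cx e e0; apply: nx.
rewrite (interior_id _).1; last exact: open_hole.
apply: (hole_convex_extend hy) => w wyx; apply: He.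
by apply: (@convex_ball R x e y x) wyx => //=; rewrite subrr modulus0.
Qed.

Lemma hole_cover z : exists N, hole N z.
Proof.
have [k Hk] := radius_unbounded 0 (modulus z + 1).
exists (level 0 k); apply: hole_disc; apply: lt_le_trans (Hk k (leqnn k)); by rewrite ltrDl.
Qed.

(** The set of slow points is filled, so curves contract there; every point moves
    along a continuum that starts in the hole, so the contraction stays in it. *)
Lemma hole_simply_connected N : simply_connected_domain (hole N).
Proof.
split; first by split; [exact: open_hole | exact: connected_hole | exists 0; exact: hole0].
move=> g [cg gh g01].
have [h [c [hc hs hg h01]]] : null_homotopic (slow N) g.
  apply: filled_null_homotopic; [exact: open_slow | exact: filled_slow |].
  by split => // z /gh; exact: hole_slow.
exists h, c; split=> //.
move=> _ [[s t] [/= s01 t01] <-].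
have gs : hole N (g s) by apply: gh; exists s.
have ct : {within `[0, 1], continuous (fun t => h (s, t))}.
  apply/subspace_continuousP => u /= u01; apply/cvg_modulusP => e e0.
  move/subspace_continuousP : hc => /(_ (s, u)) /=.
  move=> /(_ (conj s01 u01)) /cvg_modulusP /(_ e e0).
  rewrite !near_withinE => -[[A B] [/= As Bu] AB]; apply: filterS Bu => v Bv v01.
  by apply: (AB (s, v)) => //=; split => //=; exact: nbhs_singleton As.
apply: (hole_extend gs (C := (fun t => h (s, t)) @` `[0, 1])).
- by apply: continuous_compact => //; exact: segment_compact.
- by apply: connected_continuous_connected => //; exact: segment_connected.
- by move=> _ [u u01 <-]; apply: hs; exists (s, u).
- by exists 0; [rewrite /= in_itv /= lexx ler01 | case: (hg s s01)].
- by exists t.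
Qed.

(** * Connectedness of the escaping set *)

Lemma escapingP z : escaping_set L z <->
  forall b : R, exists k0, forall k, (k0 <= k)%N -> b <= modulus (iter k L z).
Proof.
split=> [/cvgryPge zb b|zb].
  by have [k0 _ H] := zb b; exists k0 => k kk; exact: H.
by apply/cvgryPge => b; have [k0 H] := zb b; exists k0 => // k; exact: H.
Qed.

Lemma escaping_iter k z : escaping_set L (iter k L z) -> escaping_set L z.
Proof.
move=> /escapingP H; apply/escapingP => b; have [k0 Hk] := H b.
exists (k0 + k)%N => l kl; have l0 : (k0 <= l - k)%N by lia.
by have := Hk _ l0; rewrite -iterD subnK //; lia.
Qed.

(** An orbit that does not escape visits some fixed disc infinitely often, and each
    disc lies in a hole. *)
Lemma nonescaping_returns z : ~ escaping_set L z -> exists N, forall k0,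
  exists2 k, (k0 <= k)%N & hole N (iter k L z).
Proof.
move=> nz; apply: contrapT => H; apply: nz; apply/escapingP => b.
have [k1 Hk1] := radius_unbounded 0 b.
apply: contrapT => nb; apply: H; exists (level 0 k1) => k2.
apply: contrapT => H2; apply: nb; exists k2 => k kk; rewrite leNgt; apply/negP => lt.
apply: H2; exists k => //; apply: hole_disc; apply: lt_le_trans lt _.
exact: (Hk1 k1 (leqnn _)).
Qed.

Lemma open_return N k : open [set z | hole N (iter k L z)].
Proof. by apply: open_comp (@open_hole N) => z _; exact: iter_continuous. Qed.

(** The boundary of a hole escapes, hence so do its preimages. *)
Lemma return_boundary N k z : closure [set w | hole N (iter k L w)] z ->
  hole N (iter k L z) \/ escaping_set L z.
Proof.
move=> cz; have [h|nh] := pselect (hole N (iter k L z)); [by left|right].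
apply: (@escaping_iter k); apply: (@hole_boundary N); split; last by move/interior_subset.
by move=> A /iter_continuous /cz [w [/= hw Aw]]; exists (iter k L w).
Qed.

Lemma hole_join N a b : hole N a -> hole N b -> exists C : set R[i],
  [/\ compact C, connected C, C `<=` hole N, C a & C b].
Proof.
move=> [C [h1 h2 h3 h4 h5]] [D [k1 k2 k3 k4 k5]]; exists (C `|` D); split.
- exact: compactU.
- by apply: connectedU => //; exists 0.
- by move=> z [Cz|Dz]; [exists C | exists D].
- by left.
- by right.
Qed.

Lemma escaping_avoids_hole N z : escaping_set L z ->
  exists k0, forall k, (k0 <= k)%N -> 2 * lam ^+ (N + reach) <= modulus (iter k L z).
Proof. by move=> /escapingP; apply. Qed.

(** Suppose the escaping set splits into two separated parts, with disjoint open
    neighbourhoods OA and OB, and take a and b from the two parts. Choose a hole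
    that contains a and b, joined in it by a continuum C, and let X be the part of
    OA in that hole. A boundary point of X in the hole is in neither OA nor OB, so it
    does not escape: some late iterate of it lies in a hole that excludes the same
    iterates of a and b. The other boundary points form a compact set F0 in OA away
    from C. So the boundary of X is covered by finitely many open sets, each with
    frontier off it, and some T with frontier in one of these separates a from b.
    If the frontier of T is near F0, it misses C, although C joins a to b. If
    instead the frontier is mapped by an iterate into a hole, the maximum
    principle bounds that iterate on T, although T contains a or b. *)
Lemma connected_escaping : connected (escaping_set L).
Proof.
apply: contrapT => /connectedPn[E [E0 EU [sep1 sep2]]].
have [a Ea] := E0 false; have [b Eb] := E0 true.
pose OA := away (E false) (E true); pose OB := away (E true) (E false).
have OAB : OA `&` OB = set0 by exact: away_disjoint.
have oA : open OA by exact: open_away.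
have oB : open OB by exact: open_away.
have EA : E false `<=` OA by apply: sub_away.
have EB : E true `<=` OB by apply: sub_away; rewrite setIC.
have esc z : escaping_set L z -> OA z \/ OB z.
  by rewrite EU => -[/EA|/EB]; [left|right].
have ea : escaping_set L a by rewrite EU; left.
have eb : escaping_set L b by rewrite EU; right.
have clA z : closure OA z -> ~ OB z.
  move=> cz Bz; have [w [Aw Bw]] := cz OB (open_nbhs_nbhs (conj oB Bz)).
  by have : (OA `&` OB) w by []; rewrite OAB.
have [Na ha] := hole_cover a; have [Nb hb] := hole_cover b.
pose N := maxn Na Nb.
have hNa : hole N a := hole_homo (leq_maxl _ _) ha.
have hNb : hole N b := hole_homo (leq_maxr _ _) hb.
have [C [cC conC CN Ca Cb]] := hole_join hNa hNb.
have clC : closed C by apply: compact_closed => //; exact: norm_hausdorff.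
pose X := OA `&` hole N.
have oX : open X by apply: openI => //; exact: open_hole.
have Xb z : X z -> modulus z <= 2 * lam ^+ (N + reach) by move=> [_ /hole_bounded /ltW].
have bdX z : boundary X z -> ~ OB z /\ (hole N z -> ~ OA z) /\ (~ hole N z -> OA z).
  move=> [cz nz]; have [cA cN] := closureI cz.
  rewrite (interior_id _).1 // in nz; split; first exact: clA.
  split=> [hz Az|nh]; first by apply: nz.
  have : escaping_set L z.
    by apply: (@hole_boundary N); split=> //; move/interior_subset.
  by move=> /esc[//|Bz]; case: (clA z cA Bz).
have cbX : compact (boundary X) by exact: compact_boundary Xb.
pose F0 := boundary X `&` ~` hole N.
have cF0 : compact F0.
  apply: (@subclosed_compact _ _ (boundary X)) => //; last by move=> z [].
  apply: closedI; first by apply: compact_closed => //; exact: norm_hausdorff.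
  by apply: open_closedC; exact: open_hole.
pose S := OA `&` ~` C.
have oS : open S by apply: openI => //; exact: closed_openC.
have F0S : F0 `<=` S.
  move=> z [bz nz]; split; first by have [_ [_]] := bdX z bz; apply.
  by move=> /CN.
have [e e0 He] : exists2 e : R, 0 < e & forall x, F0 x -> forall z, modulus (z - x) < e -> S z.
  apply: lebesgue_number => //; first by move=> r r' x rr H z zx; apply: H; exact: lt_le_trans rr.
  move=> x /F0S Sx; move/open_modulusP : oS => /(_ x Sx)[r r0 Hr].
  exists (r / 2) => [|y yx z zy]; first by rewrite divr_gt0.
  by apply: Hr; rewrite -(subrK y z) -addrA; apply: le_lt_trans (modulusD _ _) _; lra.
pose Z0 : set R[i] := [set z | exists2 x, F0 x & modulus (z - x) < e / 2].
have oZ0 : open Z0.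
  apply/open_modulusP => z [x Fx zx]; exists (e / 2 - modulus (z - x)); first by rewrite subr_gt0.
  move=> y yz; exists x => //; have -> : y - x = (y - z) + (z - x) by ring.
  by apply: le_lt_trans (modulusD _ _) _; lra.
have clZ0 : closure Z0 `<=` S.
  move=> z /closure_modulusP/(_ (e / 2)); rewrite divr_gt0 // => /(_ isT)[y [x Fx yx] yz].
  apply: (He x Fx); have -> : z - x = (z - y) + (y - x) by ring.
  by apply: le_lt_trans (modulusD _ _) _; rewrite modulusC; lra.
(* The iterate with index k takes c beyond the hole with index m. *)
pose far m k c := 2 * lam ^+ (m + reach) <= modulus (iter k L c).
pose Zmk (m k : nat) : set R[i] := [set z | hole m (iter k L z)] `&` (~` closure Z0 `&`
  [set _ | far m k a /\ far m k b]).
(* Enumeration of the pieces: Z0 first, then the sets Zmk, through the encoding of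
   pairs of natural numbers. *)
pose Z i : set R[i] := if i is i'.+1 then
  (if unpickle i' is Some (m, k) then Zmk m k else set0) else Z0.
have oZ i : open (Z i).
  case: i => [|i] //=; case: (unpickle i) => [[m k]|]; last exact: open0.
  apply: openI; first exact: open_return.
  apply: openI; first by apply: closed_openC; exact: closed_closure.
  have [f|nf] := pselect (far m k a /\ far m k b).
    by rewrite (_ : [set _ | _] = setT); [exact: openT | apply/seteqP; split].
  by rewrite (_ : [set _ | _] = set0); [exact: open0 | apply/seteqP; split].
have hit x : boundary X x -> exists i, Z i x.
  move=> bx; have [hx|nhx] := pselect (hole N x); last first.
    by exists 0%N; exists x => //; rewrite subrr modulus0 divr_gt0.
  have [nB [nA _]] := bdX x bx.
  have nx : ~ escaping_set L x by move=> /esc[]; [exact: nA | exact: nB].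
  have [m Hm] := nonescaping_returns nx.
  have [ka Ha] := escaping_avoids_hole m ea; have [kb Hb] := escaping_avoids_hole m eb.
  have [k kk hk] := Hm (maxn ka kb).
  exists (pickle (m, k)).+1; rewrite /= pickleK; split=> //; split.
    by move=> /clZ0[Ax _]; exact: (nA hx Ax).
  by split; [apply: Ha | apply: Hb]; move: kk; rewrite geq_max => /andP[].
have [M HM] : exists M : nat, forall x, boundary X x -> exists2 i, (i < M)%N & Z i x.
  have /compact_near_coveringP cov := cbX.
  have : \forall M \near \oo, boundary X `<=` [set x | exists2 i, (i < M)%N & Z i x].
    apply: cov => x /hit[i Zx].
    exists (Z i, [set M | (i < M)%N]) => /=; first by split; [exact: open_nbhs_nbhs | exists i.+1].
    by move=> [y M] [/= Zy iM]; exists i.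
  by move=> [M _ HM]; exists M => x; exact: (HM M (leqnn M)).
have loc x i : boundary X x -> Z i x \/ ~ closure (Z i) x.
  move=> bx; have [nB [nA yA]] := bdX x bx; have [hx|nhx] := pselect (hole N x).
    have nx : ~ escaping_set L x by move=> /esc[]; [exact: nA | exact: nB].
    have nS : ~ closure Z0 x by move=> /clZ0[Ax _]; exact: (nA hx Ax).
    case: i => [|i] /=; first by right.
    case: (unpickle i) => [[m k]|]; last by right; rewrite closure0.
    have [[hm f]|nz] := pselect (hole m (iter k L x) /\ (far m k a /\ far m k b)); first by left.
    right=> /closureI[/return_boundary[hm|//] /closureI[_ cf]]; apply: nz; split=> //.
    by have [w [fw _]] := cf setT filterT.
  have Zx : Z0 x by exists x => //; rewrite subrr modulus0 divr_gt0.
  case: i => [|i] /=; first by left.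
  case: (unpickle i) => [[m k]|]; last by right; rewrite closure0.
  right=> cx; have [w [[_ [nw _]] Zw]] := cx Z0 (open_nbhs_nbhs (conj oZ0 Zx)).
  by apply: nw; exact: subset_closure.
have Zab i : ~ Z i a /\ ~ Z i b.
  case: i => [|i] /=.
    by split=> /subset_closure/clZ0 [_ nC]; exact: nC.
  case: (unpickle i) => [[m k]|]; last by split.
  split=> -[/= /hole_bounded h [_ [fa fb]]].
    by move: h; rewrite ltNge; apply/negP/negPn.
  by move: h; rewrite ltNge; apply/negP/negPn.
have sX : separates X a b.
  rewrite /separates (_ : a \in X); last by apply/mem_set; split=> //; exact: EA.
  by rewrite (_ : (b \in X) = false) //; apply/negP => /set_mem[Ab _]; exact: (clA b (subset_closure Ab) (EB b Eb)).
have [i [T [b' [iM cT Tb fr sT]]]] : exists i T (b' : R), [/\ (i < M)%N, closed T,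
    forall z, T z -> modulus z <= b', forall x, T x -> ~ T° x -> Z i x & separates T a b].
  by apply: (separate_many oZ Xb) => // x bx; split; [exact: HM | move=> i _; exact: loc].
have TaTb : (exists2 x, C x & boundary T x) /\ (T a \/ T b).
  move: sT; rewrite /separates; case: (boolP (a \in T)) => [/set_mem Ta|/negP nTa];
    case: (boolP (b \in T)) => [/set_mem TB|/negP nTb] // _.
  - split; last by left.
    by apply: (connected_boundary conC Ca Cb Ta) => /mem_set.
  - split; last by right.
    by apply: (connected_boundary conC Cb Ca TB) => /mem_set.
have frT x : boundary T x -> Z i x.
  by move=> [cx nx]; apply: fr => //; rewrite [T](closure_id T).1.
case: TaTb => -[x Cx bTx] Tab.
(* The frontier of T cannot lie near F0, since it meets C. *)
case: i {iM} fr frT => [|i] /= fr frT.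
  by have [_ nC] := clZ0 _ (subset_closure (frT x bTx)); exact: nC.
case: (unpickle i) fr frT => [[m k]|] fr frT; last by have := frT x bTx.
have [_ [_ [fa fb]]] := frT x bTx.
(* Nor can an iterate map it into a hole, by the maximum principle. *)
have no c : far m k c -> ~ T c.
  move=> fc Tc; have [y [Ty nTy] cy] := iter_max_principle k cT Tb Tc.
  have [/hole_bounded h _] := fr y Ty nTy.
  by have := le_lt_trans fc (le_lt_trans cy h); rewrite ltxx.
by case: Tab; exact: no.
Qed.

Theorem escaping_spiders_web : spiders_web (escaping_set L).
Proof.
split; first exact: connected_escaping.
exists hole; split; last first.
  by apply/seteqP; split=> // z _; have [N hz] := hole_cover z; exists N.
move=> N; split.
- pose b : R := 2 * lam ^+ (N + reach).
  exists b%:C%C; split; first by rewrite realE lecR mulr_ge0 ?exprn_ge0 // ltW.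
  move=> M bM z hz /=; apply: le_trans (ltW bM).
  by rewrite norm_modulus lecR ltW // hole_bounded.
- exact: hole_simply_connected.
- exact: hole_homo.
- exact: hole_boundary.
Qed.

End Web.

(** * The order of growth *)

Section Order.
Variables (R : realType) (lam : R) (d : nat) (L : R[i] -> R[i]).
Hypothesis lam4 : 4 <= lam.
Hypothesis d3 : (3 <= d)%N.
Hypothesis L_bound : forall n z, modulus z <= lam ^+ n -> modulus (L z) <= lam ^+ (2 * d ^ n).
Hypothesis L_growth : forall n, 2 ^+ (d ^ n) <= modulus (L (lam ^+ n.+1)%:C%C).
Implicit Types (r x y : R).

Let lam0 : 0 < lam.
Proof. by apply: lt_le_trans lam4. Qed.

Let lam1 : 1 <= lam.
Proof. by apply: le_trans lam4; rewrite ler1n. Qed.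

Let lnlam1 : 1 <= ln lam.
Proof.
have l2 : 1 / 2 <= ln 2 :> R.
  have := le_ln1Dx (_ : -1 < - (1 / 2 : R)); have -> : 1 + - (1 / 2) = 2^-1 :> R by field.
  by rewrite lnV ?posrE // => /(_ ltac:(lra)); lra.
have -> : 1 = ln 2 *+ 2 + (1 - ln 2 *+ 2) :> R by ring.
apply: (@le_trans _ _ (ln (2 ^+ 2))); first by rewrite lnXn //; rewrite mulr2n; lra.
by rewrite ler_ln ?posrE // ?exprn_gt0 //; apply: le_trans lam4; rewrite expr2; lra.
Qed.

Let lnd0 : 0 < ln d%:R :> R.
Proof. by rewrite ln_gt0 // ltr1n; exact: ltnW. Qed.

(** Monotonicity in spite of the convention ln x = 0 for x <= 0. *)
Lemma ln_homo x y : x <= y -> 1 <= y -> ln x <= ln y.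
Proof.
move=> xy y1; have [x0|x0] := leP x 0; first by rewrite (ln0 x0) ln_ge0.
by rewrite ler_ln // posrE; exact: lt_le_trans xy.
Qed.

Lemma max_modulus_upper n r : 0 <= r -> r <= lam ^+ n -> max_modulus L r <= lam ^+ (2 * d ^ n).
Proof.
move=> r0 rn; apply: ge_sup.
  by exists (modulus (L r%:C%C)), r%:C%C; rewrite //= modulus_real ger0_norm.
by move=> _ [z /= zr <-]; apply: L_bound; rewrite zr.
Qed.

Lemma max_modulus_lower n z : modulus z <= lam ^+ n -> modulus (L z) <= max_modulus L (modulus z).
Proof.
move=> zn; apply: ub_le_sup; last by exists z.
exists (lam ^+ (2 * d ^ n)) => _ [w /= wz <-]; apply: L_bound; by rewrite wz.
Qed.

(** Up to terms of lower order this is (n + 2) ln d / ((n + 1) ln lam); the error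
    tends to 0. *)
Lemma order_upper n r : lam ^+ n.+1 <= r -> r <= lam ^+ n.+2 ->
  ln (ln (max_modulus L r)) / ln r <=
  ln d%:R / ln lam + (ln d%:R + ln (2 * ln lam)) / (n.+1%:R * ln lam).
Proof.
move=> nr rn; have ll := lnlam1; have dd := lnd0.
have lamn : 1 < lam ^+ n.+1.
  by rewrite exprn_egt1 //; apply: lt_le_trans lam4; rewrite ltr1n.
have r1 : 1 < r by exact: lt_le_trans nr.
have r0 : 0 <= r by lra.
have c0 : 0 <= ln (2 * ln lam) by rewrite ln_ge0 //; lra.
have up : ln (ln (max_modulus L r)) <= n.+2%:R * ln d%:R + ln (2 * ln lam).
  have h1 : ln (max_modulus L r) <= (2 * d ^ n.+2)%:R * ln lam.
    apply: le_trans (ln_homo (max_modulus_upper r0 rn) _) _; first by rewrite exprn_ege1.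
    by rewrite lnXn // mulr_natl.
  have D1 : 1 <= (d ^ n.+2)%:R :> R by rewrite ler1n expn_gt0 (leq_trans _ d3).
  apply: le_trans (ln_homo h1 _) _; first by rewrite natrM; nra.
  have -> : (2 * d ^ n.+2)%:R * ln lam = d%:R ^+ n.+2 * (2 * ln lam) :> R.
    by rewrite natrM natrX; ring.
  have d0 : 0 < d%:R :> R by rewrite ltr0n (leq_trans _ d3).
  rewrite lnM ?posrE ?exprn_gt0 ?mulr_gt0 //; last by lra.
  by rewrite lnXn // [n.+2%:R * _]mulr_natl.
have lnr : n.+1%:R * ln lam <= ln r.
  by rewrite mulr_natl -lnXn // ler_ln ?posrE ?exprn_gt0 //; lra.
have n1 : 1 <= n.+1%:R :> R by rewrite ler1n.
have den : 0 < n.+1%:R * ln lam by rewrite mulr_gt0 //; lra.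
apply: (@le_trans _ _ ((n.+2%:R * ln d%:R + ln (2 * ln lam)) / (n.+1%:R * ln lam))).
  apply: (@le_trans _ _ ((n.+2%:R * ln d%:R + ln (2 * ln lam)) / ln r)).
    by rewrite ler_pM2r // invr_gt0; lra.
  have num : 0 <= n.+2%:R * ln d%:R + ln (2 * ln lam) by rewrite addr_ge0 // mulr_ge0 // ltW.
  by rewrite ler_wpM2l // lef_pV2 ?posrE //; lra.
rewrite le_eqVlt; apply/orP; left; apply/eqP.
rewrite -[n.+2%:R]natr1; field; apply/andP; split; apply: lt0r_neq0; lra.
Qed.

Lemma order_lower n : ln d%:R / ln lam - (ln d%:R - ln (ln 2)) / (n.+1%:R * ln lam) <=
  ln (ln (max_modulus L (lam ^+ n.+1))) / ln (lam ^+ n.+1).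
Proof.
have ll := lnlam1; have dd := lnd0.
have ln20 : 0 < ln 2 :> R by rewrite ln_gt0 // ltr1n.
have h : 2 ^+ (d ^ n) <= max_modulus L (lam ^+ n.+1).
  apply: le_trans (L_growth n) _.
  have m : modulus ((lam ^+ n.+1)%:C%C : R[i]) = lam ^+ n.+1 by rewrite modulus_real ger0_norm // exprn_ge0 // ltW.
  by have := @max_modulus_lower n.+1 (lam ^+ n.+1)%:C%C; rewrite m; apply.
have p2 : 0 < 2 ^+ (d ^ n) :> R by rewrite exprn_gt0.
have D0 : 0 < (d ^ n)%:R :> R by rewrite ltr0n expn_gt0 (leq_trans _ d3).
have h1 : (d ^ n)%:R * ln 2 <= ln (max_modulus L (lam ^+ n.+1)).
  by rewrite mulr_natl -lnXn // ler_ln ?posrE //; exact: lt_le_trans h.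
have d0 : 0 < d%:R :> R by rewrite ltr0n (leq_trans _ d3).
have h2 : n%:R * ln d%:R + ln (ln 2) <= ln (ln (max_modulus L (lam ^+ n.+1))).
  apply: (@le_trans _ _ (ln ((d ^ n)%:R * ln 2))).
    by rewrite lnM ?posrE // natrX lnXn // mulr_natl.
  by rewrite ler_ln ?posrE ?mulr_gt0 //; apply: lt_le_trans h1; rewrite mulr_gt0.
have n1 : 1 <= n.+1%:R :> R by rewrite ler1n.
rewrite lnXn // -[ln lam *+ _]mulr_natl.
have den : 0 < n.+1%:R * ln lam by rewrite mulr_gt0 //; lra.
apply: (@le_trans _ _ ((n%:R * ln d%:R + ln (ln 2)) / (n.+1%:R * ln lam))); last first.
  by rewrite ler_pM2r // invr_gt0.
rewrite le_eqVlt; apply/orP; left; apply/eqP.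
have -> : n%:R = n.+1%:R - 1 :> R by rewrite -natr1; ring.
by field; apply/andP; split; apply: lt0r_neq0; lra.
Qed.

(** The upper bound holds for all large r, since each r lies between two
    consecutive powers of lam; the lower bound is needed along the powers of
    lam only. *)
Lemma entire_order_eq : entire_order L = (ln d%:R / ln lam)%:E.
Proof.
have ll := lnlam1; have dd := lnd0.
have arch (K e : R) : 0 < e -> exists n : nat, forall m, (n <= m)%N -> K / (m.+1%:R * ln lam) <= e.
  move=> e0; have [n Hn] : exists n : nat, `|K| / e <= n%:R.
    exists (Num.truncn (`|K| / e)).+1.
    by have /truncn_itv/andP[_ /ltW] : 0 <= `|K| / e by rewrite divr_ge0 // ltW.
  exists n => m nm; have mr : n%:R <= m.+1%:R :> R by rewrite ler_nat ltnW.
  have m1 : 1 <= m.+1%:R :> R by rewrite ler1n.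
  rewrite ler_pdivrMr; last by rewrite mulr_gt0 //; lra.
  rewrite ler_pdivrMr // in Hn; have := ler_norm K.
  have h : n%:R * e <= m.+1%:R * e by rewrite ler_pM2r.
  have h2 : m.+1%:R * e <= e * (m.+1%:R * ln lam).
    by rewrite [e * _]mulrC mulrAC ler_peMr // mulr_ge0 // ltW.
  lra.
have between_powers r : lam < r -> exists n, lam ^+ n.+1 <= r /\ r <= lam ^+ n.+2.
  move=> lr; have ex : exists n, r <= lam ^+ n.
    have [n Hn] : exists n : nat, r <= n%:R.
      have l4 := lam4; have r0 : 0 <= r by lra.
      by exists (Num.truncn r).+1; have /andP[_ /ltW] := truncn_itv r0.
    exists n; apply: le_trans Hn _; apply: (@le_trans _ _ (2 ^+ n)).
      by rewrite -natrX ler_nat ltnW // ltn_expl.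
    by rewrite lerXn2r ?nnegrE //; have := lam4; lra.
  case: (ex_minnP ex) => [] [|[|n]] rn min; [exfalso|exfalso|].
  - by have l1 := lam1; rewrite expr0 in rn; lra.
  - by rewrite expr1 in rn; lra.
  - exists n; split=> //; rewrite leNgt; apply/negP => lt.
    by have := min n.+1 (ltW lt); rewrite ltnn.
apply/eqP; rewrite eq_le; apply/andP; split.
- apply/lee_addgt0Pr => e e0; have [n Hn] := arch (ln d%:R + ln (2 * ln lam)) e e0.
  apply: ge_ereal_inf.
  exists (ereal_sup [set (ln (ln (max_modulus L r)) / ln r)%:E | r in [set r | lam ^+ n.+1 < r]]).
    by exists [set r | lam ^+ n.+1 < r] => //; apply: nbhs_pinfty_gt; exact: num_real.
  apply/ereal_supP => _ [r /= nr <-]; rewrite -EFinD lee_fin.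
  have lr : lam < r.
    by apply: le_lt_trans nr; rewrite -[leLHS]expr1; apply: ler_weXn2l.
  have [m [m1 m2]] := between_powers r lr.
  apply: le_trans (order_upper m1 m2) _; rewrite lerD2l; apply: Hn.
  have : lam ^+ n.+1 < lam ^+ m.+2 by exact: lt_le_trans m2.
  by rewrite ltr_eXn2l ?ltnS // (lt_le_trans _ lam4) // ltr1n.
- apply/ereal_infP => _ [V [M [_ MV]] <-]; apply/lee_subgt0Pr => e e0.
  have [n Hn] := arch (ln d%:R - ln (ln 2)) e e0.
  have [k kM] : exists k : nat, M < lam ^+ k.+1.
    have [M0|M0] := ltP M 1; first by exists 0%N; apply: lt_le_trans M0 _; rewrite expr1.
    exists (Num.truncn M).+1; have /truncn_itv/andP[_ h] : 0 <= M by lra.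
    apply: lt_le_trans h _; apply: (@le_trans _ _ (2 ^+ (Num.truncn M).+2)).
      by rewrite -natrX ler_nat; apply: ltnW; apply: ltnW; exact: ltn_expl.
    by rewrite lerXn2r ?nnegrE //; have := lam4; lra.
  pose m := maxn n k; apply: le_ereal_sup_tmp.
  exists (ln (ln (max_modulus L (lam ^+ m.+1))) / ln (lam ^+ m.+1))%:E.
    exists (lam ^+ m.+1) => //; apply: MV; apply: lt_le_trans kM _.
    by apply: ler_weXn2l => //; rewrite ltnS leq_maxr.
  rewrite -EFinB lee_fin; apply: le_trans (order_lower m).
  by rewrite lerD2l lerN2; apply: Hn; rewrite leq_maxl.
Qed.

End Order.

Lemma repelling_zero (R : realType) (lam : R) (d : nat) : 4 <= lam -> (3 <= d)%N ->
  (2 <= (size (qpoly lam d)).-1)%N /\ repelling_fixed_point (qpoly lam d) 0 /\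
  (qpoly lam d)^`().[0] = lam%:C%C.
Proof.
move=> l4 d3.
have sz : size (qpoly lam d) = d.+1.
  rewrite /qpoly addrC size_polyDl size_polyXn //.
  by apply: leq_ltn_trans (size_scale_leq _ _) _; rewrite size_polyX ltnS ltnW.
have der : (qpoly lam d)^`().[0] = lam%:C%C.
  have d10 : (0 < d.-1)%N by lia.
  by rewrite /qpoly derivD derivZ derivX derivXn !hornerE hornerMn hornerXn expr0n gtn_eqF //= mul0rn addr0.
split; first by rewrite sz /= ltnW.
split=> //; split.
  by rewrite qpolyE /qmap mulr0 expr0n add0r; case: d d3 {sz der}.
by rewrite der modulus_real gtr0_norm; lra.
Qed.

Theorem mainTheorem3 (R : realType) (rho : R) (hrho : 0 < rho) :
  exists (p : {poly R[i]}) (z0 : R[i]) (L : R[i] -> R[i]),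
    [/\ (2 <= (size p).-1)%N,
        repelling_fixed_point p z0,
        linearizer p z0 L,
        entire_order L = rho%:E
      & spiders_web (escaping_set L)].
Proof.
(* A degree d >= 4^rho makes lam = d^(1/rho) at least 4. *)
have [d d3 dl] : exists2 d : nat, (3 <= d)%N & rho * ln 4 <= ln d%:R.
  pose m := (Num.truncn (expR (rho * ln 4))).+1.
  have h : expR (rho * ln 4) <= m%:R by have /andP[_ /ltW] := truncn_itv (expR_ge0 (rho * ln 4)).
  exists (m + 3)%N; first exact: leq_addl.
  have hm : expR (rho * ln 4) <= (m + 3)%:R by apply: le_trans h _; rewrite ler_nat leq_addr.
  by rewrite -[leLHS]expRK ler_ln // posrE ?expR_gt0 // (lt_le_trans _ hm) ?expR_gt0.
pose lam : R := expR (ln d%:R / rho).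
have lam4 : 4 <= lam.
  rewrite -ler_ln ?posrE ?expR_gt0 // expRK ler_pdivlMr // mulrC //.
have lnlam : ln d%:R / ln lam = rho.
  rewrite expRK invf_div mulrA mulrC mulrA mulVf ?mul1r // gt_eqF // ln_gt0 // ltr1n.
  exact: ltnW.
have [sz [rep der]] := repelling_zero lam4 d3.
pose L := poincare lam d.
have Lfun := poincare_functional lam4 d3.
have Lnear := poincare_near0 lam4 d3.
exists (qpoly lam d), 0, L; split=> //.
- split.
  + exact: poincare_entire.
  + move=> [c Hc]; have := poincare_real lam4 d3 ler01.
    by rewrite -/L Hc -(Hc 0) /L poincare0 // modulus0; lra.
  + exact: poincare0.
  + by move=> z; rewrite der qpolyE /L Lfun.
- rewrite -[RHS]/(rho%:E) -lnlam; apply: entire_order_eq => // [n z zn|n].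
    apply: ltW; apply: lt_le_trans (L_upper lam4 d3 Lfun (fun z => Lnear z) zn) _.
    by rewrite ler_pdivrMr // ler_peMr ?ler1n // exprn_ge0 // expR_ge0.
  have -> : (lam ^+ n.+1)%:C%C = (lam ^+ n)%:C%C * lam%:C%C :> R[i] by rewrite exprSr rmorphM.
  rewrite /L (L_iter Lfun) -/L.
  have h := poincare_real lam4 d3 (ltW (expR_gt0 (ln d%:R / rho))).
  have h' : lam - 1 <= modulus (L lam%:C%C) by rewrite /lam in h *; lra.
  apply: le_trans (iter_qmap_lower lam4 d3 n h').
  apply: (@le_trans _ _ (1 * (modulus (L lam%:C%C) / 2) ^+ (d ^ n))).
    rewrite mul1r lerXn2r ?nnegrE ?divr_ge0 ?modulus_ge0 //.
    by rewrite ler_pdivlMr //; apply: le_trans h; rewrite -/lam; lra.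
  by rewrite ler_wpM2r ?exprn_ge0 ?divr_ge0 ?modulus_ge0 // ler1n.
- apply: (escaping_spiders_web lam4 d3) => //.
  + exact: poincare0.
  + exact: poincare_lipschitz.
  + exact: poincare_poly_approximable.
Qed.
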